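(* Let $f(z)=f(|z|)$ and $g(z)=g(|z|)$ be real-valued radial functions which, as functions of $r=|z|$, lie in $C^{2,\delta}$ for $r\in(0,1+\varepsilon)$ for some $\delta>0$ and $\varepsilon>0$, and are otherwise bounded. Then, as $N\uparrow\infty$, $$\mathrm{Cov}_N\bigl(X(f),X(g)\bigr)=\frac12\int_0^1 f'(r)g'(r)\,r\,dr+o(1).$$ Moreover, the centered (but unnormalized) random variable $X(f)-E[X(f)]$ under $P_N$ converges in distribution, as $N\uparrow\infty$, to a Gaussian random variable of mean zero and variance $\frac12\int_0^1 (f'(r))^2\,r\,dr$.
   Context: Ginibre's complex ensemble: $P_N$ is the probability measure on $\mathbb{C}^N$ given by $$dP_N(z_1,\dots,z_N)=\frac1{Z_N}\prod_{1\le \ell<k\le N}|z_\ell-z_k|^2\,\mu_N(dz_1)\cdots\mu_N(dz_N),\qquad \mu_N(dz)=e^{-N|z|^2}\,d\Re(z)\,d\Im(z),$$ with $Z_N$ the normalizing constant. For a function $f$ on $\mathbb{C}$, $X(f)=\sum_{k=1}^N f(z_k)$, and $\mathrm{Cov}_N(X(f),X(g))=\int X(f)X(g)\,dP_N-\int X(f)\,dP_N\int X(g)\,dP_N$. $C^{2,\delta}$ denotes twice differentiable functions whose second derivative is Hölder continuous of order $\delta$ on the stated interval. *)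

(* Defs.v *)
From HB Require Import structures.
From mathcomp Require Import all_boot all_order all_algebra.
From mathcomp Require Import complex.
From mathcomp Require Import all_classical all_reals all_analysis.
From mathcomp Require Import measurable_realfun.

Set Implicit Arguments.
Unset Strict Implicit.
Unset Printing Implicit Defensive.

Import Order.TTheory GRing.Theory Num.Theory.
Import numFieldNormedType.Exports.
Import ComplexField.

Local Open Scope classical_set_scope.
Local Open Scope ring_scope.

Section measurable_complex.
Variable R : realType.
Let re : R[i] -> R := @complex.Re R.
Let im : R[i] -> R := @complex.Im R.

HB.instance Definition _ := isPointed.Build R[i] 0.

Let complex_measurable0 : g_sigma_preimageU re im set0.
Proof. exact: sigma_algebra0. Qed.

Let complex_measurableC A :
  g_sigma_preimageU re im A -> g_sigma_preimageU re im (~` A).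
Proof. exact: sigma_algebraC. Qed.

Let complex_measurable_bigcup (F : (set R[i])^nat) :
  (forall k, g_sigma_preimageU re im (F k)) ->
  g_sigma_preimageU re im (\bigcup_k F k).
Proof. exact: sigma_algebra_bigcup. Qed.

HB.instance Definition _ := @isMeasurable.Build default_measure_display
  R[i] (g_sigma_preimageU re im)
  complex_measurable0 complex_measurableC complex_measurable_bigcup.

Lemma measurable_Re : measurable_fun [set: R[i]] (@complex.Re R).
Proof.
move=> _ Y mY; rewrite setTI; apply: sub_sigma_algebra; left.
by exists Y => //; rewrite setTI.
Qed.

Lemma measurable_Im : measurable_fun [set: R[i]] (@complex.Im R).
Proof.
move=> _ Y mY; rewrite setTI; apply: sub_sigma_algebra; right.
by exists Y => //; rewrite setTI.
Qed.

Lemma measurable_fun_complex d (T : measurableType d) (f : T -> R[i]) :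
  measurable_fun setT (@complex.Re R \o f) ->
  measurable_fun setT (@complex.Im R \o f) -> measurable_fun setT f.
Proof.
move=> mRe mIm _.
suff H : measurable `<=` image_set_system setT f measurable by move=> Y /H.
apply: smallest_sub.
  by apply: sigma_algebra_image; exact: sigma_algebra_measurable.
move=> _ [] [B mB <-]; rewrite /image_set_system/= !setTI.
  by have := mRe measurableT B mB; rewrite setTI.
by have := mIm measurableT B mB; rewrite setTI.
Qed.

Let Rm : measurableType _ := measurableTypeR R.

Lemma measurable_Complex :
  measurable_fun [set: Rm * Rm] (fun p => (p.1 +i* p.2)%C : R[i]).
Proof.
by apply: measurable_fun_complex; [exact: measurable_fst|exact: measurable_snd].
Qed.

Lemma measurable_normc : measurable_fun [set: R[i]] (@Normc.normc R).
Proof.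
rewrite (_ : @Normc.normc R = fun z : R[i] =>
    Num.sqrt (complex.Re z ^+ 2 + complex.Im z ^+ 2)).
  apply: measurableT_comp.
    by apply: continuous_measurable_fun; exact: sqrt_continuous.
  by apply: measurable_funD; apply: measurable_funX;
    [exact: measurable_Re|exact: measurable_Im].
by apply/funext => -[].
Qed.

End measurable_complex.

Section density.
Context d (T : measurableType d) (R : realType).
Local Open Scope ereal_scope.

Definition density (mu : set T -> \bar R) (h : T -> R) : set T -> \bar R :=
  fun A => \int[mu]_(x in A) (h x)%:E.

Context (mu : {measure set T -> \bar R}) (h : T -> R).
Hypotheses (mh : measurable_fun [set: T] h) (h0 : forall x, (0 <= h x)%R).

Lemma density_set0 : density mu h set0 = 0.
Proof. exact: integral_set0. Qed.

Lemma density_ge0 A : 0 <= density mu h A.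
Proof. by apply: integral_ge0 => x _; rewrite lee_fin. Qed.

Lemma density_semi_sigma_additive : semi_sigma_additive (density mu h).
Proof.
move=> F mF tF mUF; rewrite /density ge0_integral_bigcup//=.
- by apply: is_cvg_ereal_nneg_natsum_cond => n _ _; exact: density_ge0.
- by apply/measurable_EFinP; exact: measurable_funTS.
- by move=> x _; rewrite lee_fin.
Qed.

End density.

Lemma density_sigma_finite d (T : measurableType d) (R : realType)
    (mu : {sigma_finite_measure set T -> \bar R}) (h : T -> R) :
  measurable_fun [set: T] h -> (forall x, 0 <= h x) ->
  sigma_finite setT (density mu h).
Proof.
move=> mh h0; have /sigma_finiteP[F [TF ndF Foo]] := sigma_finiteT mu.
have mlt n : measurable (h @^-1` `]-oo, n%:R]).
  by rewrite -[X in measurable X]setTI; exact: mh.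
exists (fun n => F n `&` h @^-1` `]-oo, n%:R]).
  apply/seteqP; split=> // x _.
  have : [set: T] x by [].
  rewrite TF => -[n _ Fnx].
  exists (maxn n (Num.truncn (h x)).+1) => //; split.
    by have /subsetPset := ndF _ _ (leq_maxl n (Num.truncn (h x)).+1); apply.
  rewrite /= in_itv/=; apply/ltW/(lt_le_trans (truncnS_gt _)).
  by rewrite ler_nat leq_maxr.
move=> n; have [mFn Fnoo] := Foo n; split; first exact: measurableI.
apply: (@le_lt_trans _ _ (\int[mu]_(x in F n `&` h @^-1` `]-oo, n%:R]) n%:R%:E)%E).
  apply: ge0_le_integral => //.
  - exact: measurableI.
  - by move=> x _; rewrite lee_fin.
  - by apply/measurable_EFinP; exact: measurable_funTS.
  - by move=> x [_ /=]; rewrite in_itv/= lee_fin.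
rewrite integral_cst; last exact: measurableI.
rewrite lte_mul_pinfty// ?lee_fin//.
by apply: le_lt_trans Fnoo; apply: le_measure; rewrite ?inE//; exact: measurableI.
Qed.

(* The canonical sigma-finite structure that the library attaches to [m1 \x m2]
   only applies to pairs of subprobabilities. *)
Lemma product_measure_sigma_finite d1 d2 (T1 : measurableType d1)
    (T2 : measurableType d2) (R : realType)
    (m1 : {sigma_finite_measure set T1 -> \bar R})
    (m2 : {sigma_finite_measure set T2 -> \bar R}) :
  sigma_finite setT (m1 \x m2)%E.
Proof.
have /sigma_finiteP[F [TF ndF Foo]] := sigma_finiteT m1.
have /sigma_finiteP[G [TG ndG Goo]] := sigma_finiteT m2.
exists (fun n => F n `*` G n).
  rewrite -setXTT TF TG predeqE => -[x y]; split.
    move=> [/= [n _ Fnx] [k _ Gky]]; exists (maxn n k) => //; split.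
    - by move: x Fnx; exact/subsetPset/ndF/leq_maxl.
    - by move: y Gky; exact/subsetPset/ndG/leq_maxr.
  by move=> [n _ []/= ? ?]; split; exists n.
move=> k; have [? ?] := Foo k; have [? ?] := Goo k.
split; first exact: measurableX.
by rewrite product_measure1E// lte_mul_pinfty// ge0_fin_numE.
Qed.

Lemma pushforward_sigma_finite d1 d2 (T1 : measurableType d1)
    (T2 : measurableType d2) (R : realType)
    (mu : set T1 -> \bar R) (f : T1 -> T2) (g : T2 -> T1) :
  measurable_fun [set: T2] g -> cancel f g -> sigma_finite setT mu ->
  sigma_finite setT (pushforward mu f).
Proof.
move=> mg fK [F TF Foo].
exists (fun n => g @^-1` F n) => [|n].
  by rewrite -preimage_bigcup -TF preimage_setT.
have [mFn Fnoo] := Foo n; split.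
  by rewrite -[X in measurable X]setTI; exact: mg.
rewrite /pushforward (_ : f @^-1` _ = F n)//.
by apply/seteqP; split=> x /=; rewrite fK.
Qed.

Section lebesgue_complex.
Variable R : realType.
Local Open Scope ereal_scope.
Let Rm : measurableType _ := measurableTypeR R.

Definition lebesgueC : set R[i] -> \bar R :=
  pushforward (@lebesgue_measure R \x @lebesgue_measure R)
    (fun p => (p.1 +i* p.2)%C).

HB.instance Definition _ := Measure.copy lebesgueC
  (measure_function_pushforward__canonical__measure_function_Measure
    (@lebesgue_measure R \x @lebesgue_measure R) (@measurable_Complex R)).

Let lebesgueC_sigma_finite : sigma_finite setT lebesgueC.
Proof.
apply: (@pushforward_sigma_finite _ _ (Rm * Rm)%type _ _ _ _
  (fun z : R[i] => (complex.Re z, complex.Im z))) => [|[]//|].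
  by apply/measurable_fun_pairP; split;
    [exact: measurable_Re|exact: measurable_Im].
exact: product_measure_sigma_finite.
Qed.

HB.instance Definition _ :=
  Measure_isSigmaFinite.Build _ _ _ lebesgueC lebesgueC_sigma_finite.

End lebesgue_complex.
Arguments lebesgueC {R}.

Section power_measure.
Context d (T : measurableType d) (R : realType).
Variable mu : {sigma_finite_measure set T -> \bar R}.
Local Open Scope ereal_scope.

Section cons_measure.
Context n (nu : {sigma_finite_measure set (n.-tuple T) -> \bar R}).

Let cons (p : T * n.-tuple T) : n.+1.-tuple T := [tuple of p.1 :: p.2].

Definition cons_measure : set (n.+1.-tuple T) -> \bar R :=
  pushforward (mu \x nu) (fun p => [tuple of p.1 :: p.2]).

Let measurable_consT : measurable_fun setT cons.
Proof. by apply: measurable_cons. Qed.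

HB.instance Definition _ := Measure.copy cons_measure
  (measure_function_pushforward__canonical__measure_function_Measure
    (mu \x nu) measurable_consT).

Let cons_measure_sigma_finite : sigma_finite setT cons_measure.
Proof.
apply: (@pushforward_sigma_finite _ _ _ _ _ _ _
  (fun t : n.+1.-tuple T => (thead t, [tuple of behead t]))).
- by apply/measurable_fun_pairP; split;
    [exact: measurable_tnth|exact: measurable_behead].
- by move=> [x t]; congr pair; exact/val_inj.
- exact: product_measure_sigma_finite.
Qed.

HB.instance Definition _ :=
  Measure_isSigmaFinite.Build _ _ _ cons_measure cons_measure_sigma_finite.

End cons_measure.

Fixpoint power_measure n : {sigma_finite_measure set (n.-tuple T) -> \bar R} :=
  match n with
  | 0 => \d_ [tuple]
  | n'.+1 => cons_measure (power_measure n')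
  end.

End power_measure.

Section ginibre.
Variables (R : realType) (N : nat).

Definition gauss_weight (z : R[i]) : R := expR (- (N%:R * Normc.normc z ^+ 2)).

Lemma measurable_gauss_weight : measurable_fun setT gauss_weight.
Proof.
apply: measurableT_comp => //; apply: measurableT_comp => //.
by apply: measurable_funM => //; apply: measurable_funX; exact: measurable_normc.
Qed.

Lemma gauss_weight_ge0 z : 0 <= gauss_weight z.
Proof. exact: expR_ge0. Qed.

Definition gauss_measure : set R[i] -> \bar R := density lebesgueC gauss_weight.

HB.instance Definition _ := isMeasure.Build _ _ _ gauss_measure
  (density_set0 _ _) (density_ge0 _ gauss_weight_ge0)
  (density_semi_sigma_additive measurable_gauss_weight gauss_weight_ge0).

HB.instance Definition _ := Measure_isSigmaFinite.Build _ _ _ gauss_measure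
  (density_sigma_finite _ measurable_gauss_weight gauss_weight_ge0).

Definition sqr_vandermonde (z : N.-tuple R[i]) : R :=
  \prod_(l < N) \prod_(k < N | (l < k)%N)
    Normc.normc (tnth z l - tnth z k) ^+ 2.

Lemma measurable_sqr_vandermonde : measurable_fun setT sqr_vandermonde.
Proof.
apply: measurable_prod => l _.
rewrite (_ : (fun z => _) = fun z : N.-tuple R[i] => \prod_(k < N)
    if (l < k)%N then Normc.normc (tnth z l - tnth z k) ^+ 2 else 1).
  2: by apply/funext => z; rewrite big_mkcond.
apply: measurable_prod => k _; case: (l < k)%N => //.
apply: measurable_funX; apply: (measurableT_comp (@measurable_normc R)).
apply: measurable_fun_complex.
  rewrite (_ : _ \o _ = fun z => complex.Re (tnth z l) - complex.Re (tnth z k)).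
    by apply: measurable_funB; apply: (measurableT_comp (@measurable_Re R));
      exact: measurable_tnth.
  by apply/funext => z /=; move: (tnth z l) (tnth z k) => [? ?] [? ?].
rewrite (_ : _ \o _ = fun z => complex.Im (tnth z l) - complex.Im (tnth z k)).
  by apply: measurable_funB; apply: (measurableT_comp (@measurable_Im R));
    exact: measurable_tnth.
by apply/funext => z /=; move: (tnth z l) (tnth z k) => [? ?] [? ?].
Qed.

Lemma sqr_vandermonde_ge0 z : 0 <= sqr_vandermonde z.
Proof. by do 2!apply: prodr_ge0 => ? _; exact: sqr_ge0. Qed.

Definition ginibre_weight : set (N.-tuple R[i]) -> \bar R :=
  density (power_measure gauss_measure N) sqr_vandermonde.

HB.instance Definition _ := isMeasure.Build _ _ _ ginibre_weight
  (density_set0 _ _) (density_ge0 _ sqr_vandermonde_ge0)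
  (density_semi_sigma_additive measurable_sqr_vandermonde sqr_vandermonde_ge0).

(* The second argument of [mnormalize] only matters for a total mass that is
   zero or infinite, and here 0 < Z_N < +oo. *)
Definition ginibre : probability (N.-tuple R[i]) R :=
  mnormalize ginibre_weight (@dirac _ (N.-tuple R[i]) point R).

End ginibre.

Definition linear_stat (R : realType) (N : nat) (F : R[i] -> R)
    (z : N.-tuple R[i]) : R :=
  \sum_(k < N) F (tnth z k).

Definition holder_on (R : realType) (A : set R) (delta : R) (h : R -> R) :=
  exists C : R, forall x y, A x -> A y ->
    `|h x - h y| <= C * `|x - y| `^ delta.

Definition C2_holder_on (R : realType) (A : set R) (delta : R) (h : R -> R) :=
  [/\ forall x, A x -> derivable h x 1,
      forall x, A x -> derivable h^`()%classic x 1 &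
      holder_on A delta h^`(2)%classic].

(* [normal_prob 0 0] is the uniform law on [0, 1] in the library, so the
   degenerate Gaussian has to be given separately. *)
Definition centered_gaussian (R : realType) (v : R) :
    probability (measurableTypeR R) R :=
  if v == 0 then @dirac _ (measurableTypeR R) 0 R : probability _ R
  else normal_prob 0 (Num.sqrt v) : probability _ R.

(* The n-th variable lives on its own probability space [(T n, P n)]. *)
Definition cvg_in_distribution (R : realType) (d : measure_display)
    (T : nat -> measurableType d) (P : forall n, probability (T n) R)
    (X : forall n, T n -> R) (Q : probability (measurableTypeR R) R) :=
  forall h : R -> R, continuous h -> bounded_fun h ->
    'E_(P n)[h \o X n]%E @[n --> \oo] --> 'E_Q[h]%E.

(* Main.v *)
From HB Require Import structures.
Require Import Defs.
From mathcomp Require Import all_boot all_order all_algebra.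
From mathcomp Require Import perm complex.
From mathcomp Require Import all_classical all_reals all_analysis.
From mathcomp Require Import measurable_realfun ring lra.
Import Order.TTheory GRing.Theory Num.Theory.
Import numFieldNormedType.Exports.
Import ComplexField.
Set Implicit Arguments.
Unset Strict Implicit.
Unset Printing Implicit Defensive.
Local Open Scope classical_set_scope.
Local Open Scope ring_scope.

(** Radial functions of a Ginibre sample only see the moduli of the points.
    Expanding the squared Vandermonde determinant as a double sum over
    permutations and integrating over the angles kills all pairs of different
    permutations, because [z ^ a * conj z ^ b] has zero angular average for
    [a != b]. What remains is Kostlan's theorem [Cint_ginibre]: the moduli, taken
    in random order, are independent, the [k]-th one having a density proportional
    to [|z| ^ (2 k) * exp (- N |z| ^ 2)] in the plane. A radial linear statistic
    is therefore distributed as a sum of [N] independent variables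
    ([Rintegral_stat_mul], [Cint_stat_expi]).

    The square of the [k]-th modulus has a Gamma law of mean
    [a ^ 2 = (k + 1) / N], of variance [a ^ 2 / N], and of fourth central moment
    [O(a ^ 4 / N ^ 2)]. Expanding [f] and [g] in [r ^ 2] around [a ^ 2], the
    covariance of their values at that modulus is [f'(a) * g'(a) / (4 N)] up to
    [O(1 / (N sqrt (k + 1)))] ([radial_law_covariance]). The errors add up to
    [O(1 / sqrt N)], and the main terms form a Riemann sum of half the integral of
    [f' * g' * r] ([radial_riemann_sum]), which gives the limit of the covariance.

    For the central limit theorem, the same expansion bounds the centred third
    absolute moments by [O(N ^ (- 3 / 2))]: each of the [N] characteristic
    functions is within [O(N ^ (- 3 / 2))] of a Gaussian one, and their product is
    within [O(N ^ (- 1 / 2))] of the Gaussian one with the total variance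
    ([radial_law_charfun], [normc_prod_sub_le]), which converges by the first part.
    The Gaussian characteristic function comes from the rotation invariance of the
    plane Gaussian law ([gaussian_charfun]). Finally, convergence of characteristic
    functions with bounded second moments implies convergence in distribution
    ([cvg_in_distribution_of_charfun]): by tightness, a bounded continuous function
    may be replaced by a function that is close to it on a large interval, and a
    polynomial in [sin (omega x)], which is a trigonometric polynomial, can be
    chosen for it ([trigonometric_approximation]). *)

(** * Integration against a density *)

Lemma le_of_eq d (T : porderType d) (x y : T) : x = y -> (x <= y)%O.
Proof. by move=> ->. Qed.

(** The hypothesis [nuE] compares values only, because the measures with a
    density met below carry measure structures of different origins. *)
Section integral_against_density.
Context d (T : measurableType d) (R : realType).
Variables (mu nu : {measure set T -> \bar R}) (h : T -> R).
Hypotheses (mh : measurable_fun [set: T] h) (h0 : forall x, 0 <= h x).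
Hypothesis nuE : forall A, measurable A -> nu A = density mu h A.
Local Open Scope ereal_scope.

Import HBNNSimple.

Let integral_density_indic E : measurable E ->
  \int[nu]_x (\1_E x)%:E = \int[mu]_x ((\1_E x)%:E * (h x)%:E).
Proof.
move=> mE; rewrite integral_indic// setIT nuE// /density.
rewrite integral_mkcond; apply: eq_integral => x _.
by rewrite patchE indicE; case: (x \in E); rewrite ?mul1e ?mul0e.
Qed.

Let integral_density_nnsfun (f : {nnsfun T >-> R}) :
  \int[nu]_x (f x)%:E = \int[mu]_x ((f x)%:E * (h x)%:E).
Proof.
under [LHS]eq_integral do rewrite fimfunE -fsumEFin//.
rewrite [LHS]ge0_integral_fsum//; last 2 first.
  - by move=> r; exact/measurable_EFinP/measurable_funM.
  - by move=> n x _; rewrite EFinM nnfun_muleindic_ge0.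
transitivity (\int[mu]_x (\sum_(y \in range f)
    (y * \1_(f @^-1` [set y]) x)%:E * (h x)%:E)); last first.
  apply: eq_integral => x _; rewrite [in RHS]fimfunE -fsumEFin//.
  by rewrite ge0_mule_fsuml// => y; rewrite EFinM nnfun_muleindic_ge0.
rewrite ge0_integral_fsum//; last 2 first.
  - move=> y; apply: emeasurable_funM; last exact/measurable_EFinP.
    exact/measurable_EFinP/measurable_funM.
  - by move=> y x _; rewrite mule_ge0// ?EFinM ?nnfun_muleindic_ge0 ?lee_fin.
apply: eq_fsbigr => r rf.
rewrite integralZl_indic_nnsfun// integral_density_indic//.
rewrite -ge0_integralZl//.
- by apply: eq_integral => x _; rewrite EFinM muleA.
- by apply: emeasurable_funM; [exact/measurable_EFinP|exact/measurable_EFinP].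
- by move=> x _; rewrite mule_ge0 ?lee_fin.
- by move: rf; rewrite inE => -[t _ <-]; rewrite lee_fin.
Qed.

(** True for indicators by the definition of a density, hence for simple
    functions, hence for all by monotone convergence. *)
Lemma ge0_integral_density (f : T -> \bar R) :
  measurable_fun setT f -> (forall x, 0 <= f x) ->
  \int[nu]_x f x = \int[mu]_x (f x * (h x)%:E).
Proof.
move=> mf f0; pose f_ := nnsfun_approx measurableT mf.
have cf x : (EFin \o f_^~ x) n @[n --> \oo] --> f x by exact: cvg_nnsfun_approx.
transitivity (limn (fun n => \int[nu]_x (f_ n x)%:E)).
  rewrite -monotone_convergence//=.
  - by apply: eq_integral => x _; apply/esym/cvg_lim => //; exact: cf.
  - by move=> n; exact/measurable_EFinP.
  - by move=> n x _; rewrite lee_fin.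
  - by move=> x _ a b ab; rewrite lee_fin//; exact/lefP/nd_nnsfun_approx.
transitivity (limn (fun n => \int[mu]_x ((f_ n x)%:E * (h x)%:E))).
  by congr (limn _); apply/funext => n; exact: integral_density_nnsfun.
rewrite -monotone_convergence//=.
- apply: eq_integral => x _; apply/cvg_lim => //; apply: cvgeZr => //.
  exact: cf.
- by move=> n; apply: emeasurable_funM; apply/measurable_EFinP.
- by move=> n x _; rewrite mule_ge0 ?lee_fin.
- move=> x _ a b ab; rewrite lee_wpmul2r ?lee_fin//.
  exact/lefP/nd_nnsfun_approx.
Qed.

Lemma integrable_density (f : T -> R) : measurable_fun setT f ->
  mu.-integrable setT (EFin \o (fun x => f x * h x)%R) ->
  nu.-integrable setT (EFin \o f).
Proof.
move=> mf /integrableP[_ foo]; apply/integrableP; split.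
  exact/measurable_EFinP.
rewrite ge0_integral_density//=; last first.
  by apply/measurable_EFinP; exact: measurableT_comp.
apply: le_lt_trans foo; apply: le_of_eq.
by apply: eq_integral => x _; rewrite /= normrM (ger0_norm (h0 x)).
Qed.

Lemma Rintegral_density (f : T -> R) : measurable_fun setT f ->
  (\int[nu]_x f x = \int[mu]_x (f x * h x))%R.
Proof.
move=> mf; rewrite /Rintegral [in LHS]integralE [in RHS]integralE; congr (fine (_ - _)).
- rewrite ge0_integral_density//; last exact/measurable_funepos/measurable_EFinP.
  apply: eq_integral => x _; rewrite !funeposE -EFin_max -EFinM maxr_pMl//.
  by rewrite mul0r EFin_max.
- rewrite ge0_integral_density//; last exact/measurable_funeneg/measurable_EFinP.
  apply: eq_integral => x _; rewrite !funenegE -!EFin_max -EFinM maxr_pMl//.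
  by rewrite mul0r mulNr.
Qed.

End integral_against_density.

Lemma mnormalize_density d (T : measurableType d) (R : realType)
    (mu nu : {measure set T -> \bar R}) (P : probability T R) (h : T -> R) c :
  measurable_fun setT h -> (forall x, 0 <= h x) ->
  (forall A, measurable A -> nu A = density mu h A) -> nu setT = c%:E -> 0 < c ->
  forall A, measurable A ->
    mnormalize nu P A = density mu (fun x => h x / c) A.
Proof.
move=> mh h0 nuE nuT c0 A mA; rewrite /mnormalize nuT.
have -> /= : (c%:E == 0%E) || (c%:E == +oo%E) = false.
  by rewrite orbF eqe gt_eqF.
rewrite nuE// /density muleC -ge0_integralZl//.
- by apply: eq_integral => x _; rewrite mulrC EFinM.
- by apply/measurable_EFinP; exact: measurable_funTS.
- by move=> x _; rewrite lee_fin.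
- by rewrite lee_fin invr_ge0 ltW.
Qed.

(** * Complex-valued integrals *)

Section complex_valued.
Variable R : realType.
Implicit Types z w : R[i].
Local Notation Re := (@complex.Re R).
Local Notation Im := (@complex.Im R).
Local Notation normc := (@Normc.normc R).

Lemma ReD (x y : R[i]) : Re (x + y) = Re x + Re y. Proof. by case: x y => a b []. Qed.
Lemma ImD (x y : R[i]) : Im (x + y) = Im x + Im y. Proof. by case: x y => a b []. Qed.
Lemma ReM (x y : R[i]) : Re (x * y) = Re x * Re y - Im x * Im y.
Proof. by case: x y => a b []. Qed.
Lemma ImM (x y : R[i]) : Im (x * y) = Re x * Im y + Im x * Re y.
Proof. by case: x y => a b []. Qed.
Lemma Re_sum I (r : seq I) (P : pred I) (F : I -> R[i]) :
  Re (\sum_(i <- r | P i) F i) = \sum_(i <- r | P i) Re (F i).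
Proof. by apply: (big_morph Re ReD). Qed.
Lemma Im_sum I (r : seq I) (P : pred I) (F : I -> R[i]) :
  Im (\sum_(i <- r | P i) F i) = \sum_(i <- r | P i) Im (F i).
Proof. by apply: (big_morph Im ImD). Qed.

Lemma complex_eqP (x y : R[i]) : Re x = Re y -> Im x = Im y -> x = y.
Proof. by case: x y => a b [c d] /= -> ->. Qed.

Lemma normc_ge0 z : 0 <= normc z.
Proof. by case: z => a b; exact: sqrtr_ge0. Qed.

Lemma normc_sqr z : normc z ^+ 2 = Re z ^+ 2 + Im z ^+ 2.
Proof. by case: z => a b /=; rewrite sqr_sqrtr// addr_ge0// sqr_ge0. Qed.

Lemma normc_realC (x : R) : normc x%:C%C = `|x|.
Proof. by rewrite /= expr0n/= addr0 sqrtr_sqr. Qed.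

Lemma normcX z n : normc (z ^+ n) = normc z ^+ n.
Proof.
elim: n => [|n ih]; first by rewrite !expr0 Normc.normc1.
by rewrite !exprS Normc.normcM ih.
Qed.

Lemma normc_conj z : normc (z^*)%C = normc z.
Proof. by case: z => a b /=; rewrite sqrrN. Qed.

Lemma conjc_mul_normc z : z * (z^*)%C = (normc z ^+ 2)%:C%C.
Proof.
by rewrite normc_sqr; case: z => a b; apply: complex_eqP => /=; ring.
Qed.

Lemma normr_Re_le z : `|Re z| <= normc z.
Proof.
rewrite -(@ler_pXn2r _ 2)// ?nnegrE ?normc_ge0// real_normK ?num_real//.
by rewrite normc_sqr lerDl sqr_ge0.
Qed.

Lemma normr_Im_le z : `|Im z| <= normc z.
Proof.
rewrite -(@ler_pXn2r _ 2)// ?nnegrE ?normc_ge0// real_normK ?num_real//.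
by rewrite normc_sqr lerDr sqr_ge0.
Qed.

Lemma normc_le_ReIm z : normc z <= `|Re z| + `|Im z|.
Proof.
rewrite -(@ler_pXn2r _ 2)// ?nnegrE ?normc_ge0 ?addr_ge0//.
rewrite normc_sqr sqrrD !real_normK ?num_real// addrAC lerDl.
by rewrite mulrn_wge0// mulr_ge0.
Qed.

Lemma normcD_le (x y : R[i]) : normc (x + y) <= normc x + normc y.
Proof. exact: (@le_normcD R). Qed.

Lemma normc_prod I (r : seq I) (P : pred I) (F : I -> R[i]) :
  normc (\prod_(i <- r | P i) F i) = \prod_(i <- r | P i) normc (F i).
Proof. by apply: (big_morph normc (@Normc.normcM R)); exact: Normc.normc1. Qed.

Section measurability.
Context d (T : measurableType d).
Implicit Types F G : T -> R[i].

Lemma measurable_funRe F : measurable_fun setT F -> measurable_fun setT (Re \o F).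
Proof. by apply: measurableT_comp; exact: measurable_Re. Qed.
Lemma measurable_funIm F : measurable_fun setT F -> measurable_fun setT (Im \o F).
Proof. by apply: measurableT_comp; exact: measurable_Im. Qed.
Lemma measurable_funnormc F :
  measurable_fun setT F -> measurable_fun setT (normc \o F).
Proof. by apply: measurableT_comp; exact: measurable_normc. Qed.

Lemma measurable_funCM F G : measurable_fun setT F -> measurable_fun setT G ->
  measurable_fun setT (fun t => F t * G t).
Proof.
move=> mF mG; have [mRF mIF] := (measurable_funRe mF, measurable_funIm mF).
have [mRG mIG] := (measurable_funRe mG, measurable_funIm mG).
apply: measurable_fun_complex.
  rewrite (_ : _ \o _ = fun t => (Re \o F) t * (Re \o G) t - (Im \o F) t * (Im \o G) t).
    by apply: measurable_funB; apply: measurable_funM.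
  by apply/funext => t; exact: ReM.
rewrite (_ : _ \o _ = fun t => (Re \o F) t * (Im \o G) t + (Im \o F) t * (Re \o G) t).
  by apply: measurable_funD; apply: measurable_funM.
by apply/funext => t; exact: ImM.
Qed.

Lemma measurable_funCD F G : measurable_fun setT F -> measurable_fun setT G ->
  measurable_fun setT (fun t => F t + G t).
Proof.
move=> mF mG; apply: measurable_fun_complex.
  rewrite (_ : _ \o _ = fun t => (Re \o F) t + (Re \o G) t).
    by apply: measurable_funD; exact: measurable_funRe.
  by apply/funext => t; exact: ReD.
rewrite (_ : _ \o _ = fun t => (Im \o F) t + (Im \o G) t).
  by apply: measurable_funD; exact: measurable_funIm.
by apply/funext => t; exact: ImD.
Qed.

Lemma measurable_funCprod I (r : seq I) (P : pred I) (F : I -> T -> R[i]) :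
  (forall i, measurable_fun setT (F i)) ->
  measurable_fun setT (fun t => \prod_(i <- r | P i) F i t).
Proof.
move=> mF; elim: r => [|i r ih].
  by under eq_fun do rewrite big_nil; exact: measurable_cst.
under eq_fun do rewrite big_cons; case: (P i) => //.
exact: measurable_funCM.
Qed.

Lemma measurable_funCX F n : measurable_fun setT F ->
  measurable_fun setT (fun t => F t ^+ n).
Proof.
move=> mF; elim: n => [|n ih].
  by under eq_fun do rewrite expr0; exact: measurable_cst.
by under eq_fun do rewrite exprS; exact: measurable_funCM.
Qed.

Lemma measurable_funconjc F : measurable_fun setT F ->
  measurable_fun setT (fun t => (F t)^*%C).
Proof.
move=> mF; apply: measurable_fun_complex.
  rewrite (_ : _ \o _ = Re \o F); first exact: measurable_funRe.
  by apply/funext => t /=; case: (F t).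
rewrite (_ : _ \o _ = fun t => - (Im \o F) t).
  by apply: measurableT_comp => //; exact: measurable_funIm.
by apply/funext => t /=; case: (F t).
Qed.

Lemma measurable_funrealC (f : T -> R) : measurable_fun setT f ->
  measurable_fun setT (fun t => (f t)%:C%C).
Proof. by move=> mf; apply: measurable_fun_complex => //; exact: measurable_cst. Qed.

End measurability.

Lemma Rintegral_cst_probability d (T : measurableType d) (P : probability T R) (c : R) :
  \int[P]_x c = c.
Proof. by rewrite Rintegral_cst//= probability_setT mulr1. Qed.

Section complex_integral.
Context d (T : measurableType d).
Variable mu : {measure set T -> \bar R}.
Implicit Types F G : T -> R[i].

Definition Cint F : R[i] :=
  ((\int[mu]_x Re (F x)) +i* (\int[mu]_x Im (F x)))%C.

(** Integrability is expressed by the modulus alone, which makes it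
    multiplicative for products of functions of independent variables. *)
Definition Cintegrable F :=
  measurable_fun setT F /\ mu.-integrable setT (EFin \o (normc \o F)).

Lemma Cintegrable_le F (g : T -> R) : measurable_fun setT F ->
  mu.-integrable setT (EFin \o g) -> (forall x, normc (F x) <= g x) ->
  Cintegrable F.
Proof.
move=> mF ig Fg; split=> //; apply: le_integrable ig => //.
  by apply/measurable_EFinP; exact: measurable_funnormc.
move=> x _ /=; rewrite lee_fin ger0_norm ?normc_ge0//.
exact: le_trans (Fg x) (ler_norm _).
Qed.

Lemma Cintegrable_Re F : Cintegrable F ->
  mu.-integrable setT (EFin \o (fun x => Re (F x))).
Proof.
move=> [mF iF]; apply: le_integrable iF => //.
  by apply/measurable_EFinP; exact: measurable_funRe.
by move=> x _ /=; rewrite lee_fin (le_trans (normr_Re_le _))// ler_norm.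
Qed.

Lemma Cintegrable_Im F : Cintegrable F ->
  mu.-integrable setT (EFin \o (fun x => Im (F x))).
Proof.
move=> [mF iF]; apply: le_integrable iF => //.
  by apply/measurable_EFinP; exact: measurable_funIm.
by move=> x _ /=; rewrite lee_fin (le_trans (normr_Im_le _))// ler_norm.
Qed.

Lemma CintegrableD F G :
  Cintegrable F -> Cintegrable G -> Cintegrable (fun x => F x + G x).
Proof.
move=> [mF iF] [mG iG].
apply: (@Cintegrable_le _ (fun x => normc (F x) + normc (G x))).
- exact: measurable_funCD.
- exact: (integrableD measurableT iF iG).
- by move=> x; exact: normcD_le.
Qed.

Lemma CintegrableZl (c : R[i]) F : Cintegrable F -> Cintegrable (fun x => c * F x).
Proof.
move=> [mF iF]; apply: (@Cintegrable_le _ (fun x => normc c * normc (F x))).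
- exact: measurable_funCM.
- exact: (integrableZl measurableT (normc c) iF).
- by move=> x; rewrite Normc.normcM.
Qed.

Lemma Cintegrable_sum I (r : seq I) (F : I -> T -> R[i]) :
  (forall i, Cintegrable (F i)) -> Cintegrable (fun x => \sum_(i <- r) F i x).
Proof.
move=> iF; elim: r => [|i r ih].
  rewrite (_ : (fun _ => _) = cst 0); last by apply/funext => x; rewrite big_nil.
  split; first exact: measurable_cst.
  rewrite (_ : _ \o _ = cst 0%E); first exact: integrable0.
  by apply/funext => x; congr EFin; exact: Normc.normc0.
under eq_fun do rewrite big_cons; exact: CintegrableD.
Qed.

Lemma CintZl (c : R[i]) F : Cintegrable F -> Cint (fun x => c * F x) = c * Cint F.
Proof.
move=> iF; have [iR iI] := (Cintegrable_Re iF, Cintegrable_Im iF).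
have iZ (a : R) h : mu.-integrable setT (EFin \o h) ->
    mu.-integrable setT (EFin \o (fun x => a * h x)).
  move=> ih; rewrite (_ : _ \o _ = (fun x => a%:E * (EFin \o h) x)%E)//.
  exact: integrableZl.
apply: complex_eqP; rewrite ?ReM ?ImM /=.
  rewrite -!RintegralZl// -RintegralB//; try exact: iZ.
  by apply: eq_Rintegral => x _; rewrite ReM.
rewrite -!RintegralZl// -RintegralD//; try exact: iZ.
by apply: eq_Rintegral => x _; rewrite ImM.
Qed.

Lemma Rintegral_sum I (r : seq I) (f : I -> T -> R) :
  (forall i, mu.-integrable setT (EFin \o f i)) ->
  \int[mu]_x (\sum_(i <- r) f i x) = \sum_(i <- r) \int[mu]_x f i x.
Proof.
move=> iF; elim: r => [|i r ih].
  by under eq_Rintegral do rewrite big_nil; rewrite big_nil Rintegral_cst// mul0r.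
rewrite big_cons -ih -RintegralD//.
  by under eq_Rintegral do rewrite big_cons.
rewrite (_ : _ \o _ = fun x => (\sum_(j <- r) (EFin \o f j) x)%E).
  exact: integrable_sum.
by apply/funext => x /=; rewrite sumEFin.
Qed.

Lemma Cint_sum I (r : seq I) (F : I -> T -> R[i]) :
  (forall i, Cintegrable (F i)) ->
  Cint (fun x => \sum_(i <- r) F i x) = \sum_(i <- r) Cint (F i).
Proof.
move=> iF; apply: complex_eqP; rewrite ?Re_sum ?Im_sum /= -Rintegral_sum//.
- by apply: eq_Rintegral => x _; rewrite Re_sum.
- by move=> i; exact: Cintegrable_Re.
- by apply: eq_Rintegral => x _; rewrite Im_sum.
- by move=> i; exact: Cintegrable_Im.
Qed.

Lemma eq_Cint F G : F =1 G -> Cint F = Cint G.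
Proof. by move=> /funext ->. Qed.

Lemma Cint_realC (f : T -> R) : Cint (fun x => (f x)%:C%C) = (\int[mu]_x f x)%:C%C.
Proof. by apply: complex_eqP => //=; rewrite Rintegral_cst// mul0r. Qed.

End complex_integral.

Section product.
Context d1 d2 (T1 : measurableType d1) (T2 : measurableType d2).
Variables (m1 : {sigma_finite_measure set T1 -> \bar R})
          (m2 : {sigma_finite_measure set T2 -> \bar R}).

Lemma integrable_prod (u : T1 -> R) (v : T2 -> R) :
  m1.-integrable setT (EFin \o u) -> m2.-integrable setT (EFin \o v) ->
  (m1 \x m2)%E.-integrable setT (EFin \o (fun p => u p.1 * v p.2)).
Proof.
move=> iu iv; have mu := measurable_int _ iu; have mv := measurable_int _ iv.
apply/integrable12ltyP => /=.
  apply/measurable_EFinP; apply: measurable_funM; apply: measurableT_comp => //.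
    exact/measurable_EFinP.
  exact/measurable_EFinP.
have [b bE] : exists b : R, (\int[m2]_y `|v y|%:E)%E = b%:E.
  move/integrableP : iv => [_ iv]; exists (fine (\int[m2]_y `|v y|%:E)%E).
  by rewrite fineK// ge0_fin_numE// integral_ge0.
have b0 : 0 <= b by rewrite -lee_fin -bE integral_ge0.
rewrite (eq_integral (fun x => (b%:E * `|(u x)%:E|)%E)); last first.
  move=> x _; under eq_integral do rewrite normrM EFinM.
  rewrite ge0_integralZl//; first by rewrite bE muleC.
  by apply/measurable_EFinP; apply: measurableT_comp => //; exact/measurable_EFinP.
rewrite ge0_integralZl//; last exact: measurableT_comp.
by move/integrableP : iu => [_ iu]; rewrite lte_mul_pinfty.
Qed.

Lemma Rintegral_prod (u : T1 -> R) (v : T2 -> R) :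
  m1.-integrable setT (EFin \o u) -> m2.-integrable setT (EFin \o v) ->
  \int[(m1 \x m2)%E]_p (u p.1 * v p.2) = (\int[m1]_x u x) * (\int[m2]_y v y).
Proof.
move=> iu iv; rewrite /Rintegral -integral12_prod_meas1; last exact: integrable_prod.
have Ev : (\int[m2]_y (v y)%:E)%E = (\int[m2]_y v y)%:E.
  by rewrite fineK//; exact: (integrable_fin_num measurableT iv).
transitivity (fine (\int[m1]_x ((u x)%:E * (\int[m2]_y v y)%:E)%E)).
  congr fine; apply: eq_integral => x _.
  rewrite /fubini_F/=; under eq_integral do rewrite EFinM.
  by rewrite integralZl// Ev.
by rewrite integralZr// fineM//; exact: (integrable_fin_num measurableT iu).
Qed.

Lemma Cintegrable_prod (F : T1 -> R[i]) (G : T2 -> R[i]) :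
  Cintegrable m1 F -> Cintegrable m2 G ->
  Cintegrable (m1 \x m2)%E (fun p => F p.1 * G p.2).
Proof.
move=> [mF iF] [mG iG]; split.
  by apply: measurable_funCM; apply: measurableT_comp.
rewrite (_ : _ \o _ = EFin \o (fun p => normc (F p.1) * normc (G p.2))).
  exact: (integrable_prod iF iG).
by apply/funext => p /=; rewrite Normc.normcM.
Qed.

Lemma Cint_prod (F : T1 -> R[i]) (G : T2 -> R[i]) :
  Cintegrable m1 F -> Cintegrable m2 G ->
  Cint (m1 \x m2)%E (fun p => F p.1 * G p.2) = Cint m1 F * Cint m2 G.
Proof.
move=> iF iG.
have [iRF iIF] := (Cintegrable_Re iF, Cintegrable_Im iF).
have [iRG iIG] := (Cintegrable_Re iG, Cintegrable_Im iG).
have [i1 i2] := (integrable_prod iRF iRG, integrable_prod iIF iIG).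
have [i3 i4] := (integrable_prod iRF iIG, integrable_prod iIF iRG).
apply: complex_eqP; rewrite ?ReM ?ImM/= -!Rintegral_prod//.
  by rewrite -RintegralB//; apply: eq_Rintegral => p _; rewrite ReM.
by rewrite -RintegralD//; apply: eq_Rintegral => p _; rewrite ImM.
Qed.

End product.

Section image_measure.
Context d1 d2 (T1 : measurableType d1) (T2 : measurableType d2).
Variables (mu : {measure set T1 -> \bar R}) (nu : {measure set T2 -> \bar R}).
Variable phi : T1 -> T2.
Hypothesis mphi : measurable_fun setT phi.
Hypothesis nuE : forall A, measurable A -> nu A = pushforward mu phi A.

Lemma Rintegral_pushforward (f : T2 -> R) : measurable_fun setT f ->
  mu.-integrable setT (EFin \o (fun x => f (phi x))) ->
  nu.-integrable setT (EFin \o f) /\ \int[nu]_y f y = \int[mu]_x f (phi x).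
Proof.
move=> mf if_.
have E (g : T2 -> \bar R) : (\int[nu]_x g x = \int[pushforward mu phi]_x g x)%E.
  by apply: eq_measure_integral => A mA _; exact: nuE.
have mE : measurable_fun setT (EFin \o f) by exact/measurable_EFinP.
split; last by rewrite /Rintegral E integral_pushforward.
apply/integrableP; split => //.
have /integrableP[] := if_; rewrite E ge0_integral_pushforward//.
exact: measurableT_comp.
Qed.

Lemma Cint_pushforward (F : T2 -> R[i]) :
  Cintegrable mu (F \o phi) -> measurable_fun setT F ->
  Cint nu F = Cint mu (F \o phi) /\ Cintegrable nu F.
Proof.
move=> iF mF; split; last first.
  by split=> //; apply: (Rintegral_pushforward (measurable_funnormc mF) _).1; exact: iF.2.
apply: complex_eqP => /=.
  exact: (Rintegral_pushforward (measurable_funRe mF) (Cintegrable_Re iF)).2.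
exact: (Rintegral_pushforward (measurable_funIm mF) (Cintegrable_Im iF)).2.
Qed.

End image_measure.

End complex_valued.

(** * Rotations and homotheties of the plane *)

Section lebesgue_line.
Variable R : realType.
Local Notation Rm := (measurableTypeR R).
Local Notation leb := (@lebesgue_measure R).

(** Lebesgue measure is determined by its values on the intervals [`]a, b]], and
    the image measure has the same ones; likewise for homotheties. *)
Lemma ge0_integral_lebesgue_translation (c : R) (f : Rm -> \bar R) :
  measurable_fun setT f -> (forall x, 0 <= f x)%E ->
  (\int[leb]_x f (x + c)%R = \int[leb]_x f x)%E.
Proof.
move=> mf f0; pose phi : Rm -> Rm := fun x => x + c.
have mphi : measurable_fun setT phi by exact: measurable_funD.
rewrite [RHS](eq_measure_integral (pushforward leb phi)).
  by rewrite ge0_integral_pushforward.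
move=> A mA _; pose nu := measure_function_pushforward__canonical__measure_function_Measure leb mphi.
apply: (@lebesgue_measure_unique _ nu) => // _ [[a b]] _ <-.
rewrite /nu/= /pushforward (_ : phi @^-1` _ = `]a - c, b - c]%classic).
  by rewrite !lebesgue_measure_itv/= !lte_fin ltrD2r -!EFinB (_ : b - c - (a - c) = b - a)//; ring.
by apply/seteqP; split=> x /=; rewrite !in_itv/= ltrBlDr lerBrDr.
Qed.

Lemma ge0_integral_lebesgue_scaling (a : R) (f : Rm -> \bar R) : 0 < a ->
  measurable_fun setT f -> (forall x, 0 <= f x)%E ->
  (\int[leb]_x f (a * x)%R = a^-1%:E * \int[leb]_x f x)%E.
Proof.
move=> a0 mf f0; pose phi : Rm -> Rm := fun x => a * x.
have mphi : measurable_fun setT phi by exact: measurable_funM.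
have a'0 : 0 <= a by exact: ltW.
pose nu := measure_function_pushforward__canonical__measure_function_Measure leb mphi.
rewrite [in RHS](eq_measure_integral (mscale (NngNum a'0) nu)); last first.
  move=> A mA _; apply: lebesgue_measure_unique => // _ [[l u]] _ <-.
  rewrite -[RHS]/(a%:E * leb (phi @^-1` `]l, u]%classic))%E.
  rewrite (_ : phi @^-1` _ = `]l / a, u / a]%classic).
    rewrite !lebesgue_measure_itv/= !lte_fin ltr_pM2r ?invr_gt0//.
    case: ifPn => _; last by rewrite mule0.
    by rewrite -!EFinB -EFinM -mulrBl mulrC divfK ?gt_eqF.
  apply/seteqP; split=> x /=; rewrite !in_itv/= ltr_pdivrMr// ler_pdivlMr//.
    by rewrite mulrC.
  by rewrite (mulrC x).
rewrite ge0_integral_mscale// muleA -EFinM mulVf ?gt_eqF// mul1e.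
by rewrite ge0_integral_pushforward.
Qed.

Lemma integrable_gauss (s : R) : 0 < s ->
  leb.-integrable setT (EFin \o (fun x => expR (- (s * x ^+ 2)))).
Proof.
move=> s0; have mg : measurable_fun setT (fun x : R => expR (- (s * x ^+ 2))).
  by apply: measurableT_comp => //; apply: measurableT_comp => //; exact: measurable_funM.
apply/integrableP; split; first exact/measurable_EFinP.
rewrite [ltLHS](_ : _ = (\int[leb]_x (gauss_fun (Num.sqrt s * x))%:E)%E); last first.
  by apply: eq_integral => x _ /=; rewrite ger0_norm ?expR_ge0// /gauss_fun exprMn sqr_sqrtr ?ltW.
rewrite (@ge0_integral_lebesgue_scaling _ (EFin \o gauss_fun)) ?sqrtr_gt0//.
- by rewrite integralT_gauss -EFinM ltry.
- by apply/measurable_EFinP; exact: measurable_gauss_fun.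
- by move=> x; rewrite lee_fin gauss_fun_ge0.
Qed.

End lebesgue_line.

Section lebesgue_plane.
Variable R : realType.
Local Notation Rm := (measurableTypeR R).
Local Notation leb := (@lebesgue_measure R).
Local Notation leb2 := (@lebesgue_measure R \x @lebesgue_measure R)%E.
Local Notation normc := (@Normc.normc R).

Section ge0.
Variable f : Rm * Rm -> \bar R.
Hypotheses (mf : measurable_fun setT f) (f0 : forall x, (0 <= f x)%E).

Let msec1 (x : Rm) : measurable_fun setT (fun y : Rm => f (x, y)).
Proof. by apply: measurableT_comp => //; exact: pair1_measurable. Qed.

Let msec2 (y : Rm) : measurable_fun setT (fun x : Rm => f (x, y)).
Proof. by apply: measurableT_comp => //; exact: pair2_measurable. Qed.

Let measurable_shear1 p : measurable_fun setT (fun z : Rm * Rm => f (z.1, (z.2 + p * z.1)%R)).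
Proof.
apply: measurableT_comp => //; apply: measurable_fun_pair => //=.
by apply: measurable_funD => //; exact: measurable_funM.
Qed.

Let measurable_shear2 p : measurable_fun setT (fun z : Rm * Rm => f ((z.1 + p * z.2)%R, z.2)).
Proof.
apply: measurableT_comp => //; apply: measurable_fun_pair => //=.
by apply: measurable_funD => //; exact: measurable_funM.
Qed.

Lemma ge0_integral_shear1 p :
  (\int[leb2]_z f (z.1, (z.2 + p * z.1)%R) = \int[leb2]_z f z)%E.
Proof.
rewrite !fubini_tonelli1//=; apply: eq_integral => x _; rewrite /fubini_F/=.
by rewrite (ge0_integral_lebesgue_translation _ (msec1 x)).
Qed.

Lemma ge0_integral_shear2 p :
  (\int[leb2]_z f ((z.1 + p * z.2)%R, z.2) = \int[leb2]_z f z)%E.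
Proof.
rewrite !fubini_tonelli2//=; apply: eq_integral => y _; rewrite /fubini_G/=.
by rewrite (ge0_integral_lebesgue_translation _ (msec2 y)).
Qed.

Lemma ge0_integral_homothety a : 0 < a ->
  (\int[leb2]_z f ((a * z.1)%R, (a * z.2)%R) =
   (a ^+ 2)^-1%:E * \int[leb2]_z f z)%E.
Proof.
move=> a0; have a'0 : 0 <= a^-1 by rewrite invr_ge0 ltW.
rewrite !fubini_tonelli1//=; last first.
  apply: measurableT_comp => //.
  by apply: measurable_fun_pair; apply: measurable_funM.
have mF : measurable_fun setT (fubini_F leb f) by exact: measurable_fun_fubini_tonelli_F.
have F0 x : (0 <= fubini_F leb f x)%E by exact: integral_ge0.
rewrite [LHS](_ : _ = (\int[leb]_x (a^-1%:E * fubini_F leb f (a * x)%R))%E); last first.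
  apply: eq_integral => x _; rewrite /fubini_F/=.
  by rewrite (ge0_integral_lebesgue_scaling a0 (msec1 (a * x)%R)).
have ma : measurable_fun setT (fun x : Rm => (a * x)%R : Rm) by exact: measurable_funM.
have mFa : measurable_fun setT (fun x => fubini_F leb f (a * x)%R).
  exact: (measurableT_comp mF ma).
have a'0E : (0 <= a^-1%:E)%E by rewrite lee_fin.
rewrite (ge0_integralZl leb measurableT mFa (fun x _ => F0 (a * x)%R) a'0E).
by rewrite (ge0_integral_lebesgue_scaling a0 mF F0) muleA -EFinM -invfM -expr2.
Qed.

End ge0.

(** A rotation is the product of three shears, and a shear preserves the area
    because it translates each line of one coordinate direction. *)
Lemma ge0_integral_rotation (c s : R) (f : Rm * Rm -> \bar R) :
  c ^+ 2 + s ^+ 2 = 1 -> c != -1 ->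
  measurable_fun setT f -> (forall x, 0 <= f x)%E ->
  (\int[leb2]_z f ((c * z.1 - s * z.2)%R, (s * z.1 + c * z.2)%R) =
   \int[leb2]_z f z)%E.
Proof.
move=> cs1 cN1 mf f0; have c1 : 1 + c != 0 by rewrite addrC addr_eq0.
(* For an angle [theta] this is [- tan (theta / 2)], which excludes the
   half-turn [c = -1]. *)
pose p := - s / (1 + c).
have mlin (u v : R) : measurable_fun setT (fun z : Rm * Rm => (u * z.1 + v * z.2)%R).
  by apply: measurable_funD; apply: measurable_funM.
pose f1 (z : Rm * Rm) := f ((z.1 + p * z.2)%R, z.2).
have mf1 : measurable_fun setT f1.
  apply: measurableT_comp => //; apply: measurable_fun_pair => //=.
  by apply: measurable_funD => //; exact: measurable_funM.
pose f2 (z : Rm * Rm) := f1 (z.1, (z.2 + s * z.1)%R).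
have mf2 : measurable_fun setT f2.
  apply: measurableT_comp => //; apply: measurable_fun_pair => //=.
  by apply: measurable_funD => //; exact: measurable_funM.
rewrite -(ge0_integral_shear2 mf f0 p) -/f1.
have f10 z : (0 <= f1 z)%E by exact: f0.
have f20 z : (0 <= f2 z)%E by exact: f10.
rewrite -(ge0_integral_shear1 mf1 f10 s) -/f2.
rewrite -(ge0_integral_shear2 mf2 f20 p).
apply: eq_integral => -[x y] _; rewrite /f2 /f1/=.
have s2 : s ^+ 2 = (1 - c) * (1 + c) by lra.
have ps : p * s = c - 1 by rewrite /p mulrAC mulNr -expr2 s2 mulNr mulfK// opprB.
have pc : p * (1 + c) = - s by rewrite /p divfK.
have Ey : s * x + c * y = y + s * (x + p * y).
  by rewrite mulrDr mulrA (mulrC s p) ps; ring.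
congr (f (_, _)) => //; rewrite -Ey.
transitivity (x + p * s * x + p * (1 + c) * y); last by ring.
by rewrite ps pc; ring.
Qed.

End lebesgue_plane.

(** * Rotation invariance and angular orthogonality *)

Section lebesgueC_integral.
Variable R : realType.
Local Notation Rm := (measurableTypeR R).
Local Notation leb := (@lebesgue_measure R).
Local Notation leb2 := (@lebesgue_measure R \x @lebesgue_measure R)%E.
Local Notation normc := (@Normc.normc R).
Local Notation lebC := (@lebesgueC R).
Implicit Types z : R[i].

Lemma ge0_integral_lebesgueC (f : R[i] -> \bar R) :
  measurable_fun setT f -> (forall z, 0 <= f z)%E ->
  (\int[lebC]_z f z = \int[leb2]_p f (p.1 +i* p.2)%C)%E.
Proof.
move=> mf f0.
by rewrite (ge0_integral_pushforward (@measurable_Complex R)).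
Qed.

Lemma ge0_integral_lebesgueC_rotation w (f : R[i] -> \bar R) :
  normc w = 1 -> w != -1 -> measurable_fun setT f -> (forall z, 0 <= f z)%E ->
  (\int[lebC]_z f (w * z)%R = \int[lebC]_z f z)%E.
Proof.
move=> w1 wN1 mf f0.
have mfw : measurable_fun setT (fun z => f (w * z)).
  by apply: measurableT_comp => //; apply: measurable_funCM.
rewrite !ge0_integral_lebesgueC//.
pose g (p : Rm * Rm) := f (p.1 +i* p.2)%C.
have mg : measurable_fun setT g by apply: measurableT_comp => //; exact: measurable_Complex.
have cs : complex.Re w ^+ 2 + complex.Im w ^+ 2 = 1 by rewrite -normc_sqr w1 expr1n.
have c1 : complex.Re w != -1.
  apply: contra_neq wN1 => c1; have Im0 : complex.Im w = 0.
    by apply/eqP; rewrite -sqrf_eq0; apply/eqP; move: cs; rewrite c1; lra.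
  by apply: complex_eqP; rewrite ?c1 ?Im0/= ?oppr0.
have g0 p : (0 <= g p)%E by exact: f0.
rewrite [RHS](_ : _ = \int[leb2]_p g p)%E// -(ge0_integral_rotation cs c1 mg g0).
apply: eq_integral => -[x y] _ /=.
by rewrite /g; congr f; apply: complex_eqP; rewrite ?ReM ?ImM//= addrC.
Qed.

Lemma lebesgueC_rotation w : normc w = 1 -> w != -1 -> forall A, measurable A ->
  lebC A = pushforward lebC (fun z => w * z) A.
Proof.
move=> w1 wN1 A mA; rewrite /pushforward.
have mw : measurable_fun setT (fun z => w * z) by exact: measurable_funCM.
have mwA : measurable ((fun z => w * z) @^-1` A).
  by rewrite -[X in measurable X]setTI; exact: mw.
have E B : measurable B -> lebC B = (\int[lebC]_z (\1_B z)%:E)%E.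
  by move=> mB; rewrite integral_indic// setIT.
rewrite !E//.
rewrite -(@ge0_integral_lebesgueC_rotation w (fun z => (\1_A z)%:E))//.
by apply/measurable_EFinP; exact: measurable_indic.
Qed.

Lemma Cint_lebesgueC_rotation w (F : R[i] -> R[i]) : normc w = 1 -> w != -1 ->
  Cintegrable lebC (fun z => F (w * z)) -> measurable_fun setT F ->
  Cint lebC (fun z => F (w * z)) = Cint lebC F.
Proof.
move=> w1 wN1 iF mF; have mw : measurable_fun setT (fun z => w * z).
  exact: measurable_funCM.
by have [-> _] := Cint_pushforward mw (lebesgueC_rotation w1 wN1) iF mF.
Qed.

Lemma expr_cos_sin (t : R) n :
  ((cos t +i* sin t)%C : R[i]) ^+ n = (cos (t *+ n) +i* sin (t *+ n))%C.
Proof.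
elim: n => [|n ih]; first by rewrite expr0 mulr0n cos0 sin0.
by rewrite exprS ih mulrS cosD sinD; apply: complex_eqP; rewrite ?ReM ?ImM/=; ring.
Qed.

Lemma normc_cos_sin (t : R) : normc (cos t +i* sin t)%C = 1.
Proof. by rewrite /= cos2Dsin2 sqrtr1. Qed.

(** The rotation of angle [pi / (2 (a - b))] multiplies [z ^ a * conj z ^ b]
    by [i]; the integral, being rotation invariant, is [i] times itself. *)
Lemma Cint_angular_orthogonality_lt (phi : R[i] -> R[i]) a b : (b < a)%N ->
  (forall w z, normc w = 1 -> phi (w * z) = phi z) ->
  Cintegrable lebC (fun z => z ^+ a * (z^*)%C ^+ b * phi z) ->
  Cint lebC (fun z => z ^+ a * (z^*)%C ^+ b * phi z) = 0.
Proof.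
move=> ab rphi iF; set F := (X in Cint _ X).
pose t : R := pi / 2 / (a - b)%:R; pose w : R[i] := (cos t +i* sin t)%C.
have w1 : normc w = 1 by exact: normc_cos_sin.
have d0 : (a - b)%:R != 0 :> R by rewrite pnatr_eq0 subn_eq0 -ltnNge.
have wab : w ^+ (a - b) = 'i%C.
  by rewrite expr_cos_sin -mulr_natr divfK// cos_pihalf sin_pihalf.
have wN1 : w != -1.
  apply: contra_eq_neq wab => ->; rewrite -signr_odd; case: odd;
    by rewrite ?expr0 ?expr1 eq_complex/= ?oppr0 [0 == 1]eq_sym oner_eq0 andbF.
have Fw z : F (w * z) = 'i%C * F z.
  rewrite /F rphi// rmorphM !exprMn -wab.
  have -> : w ^+ a = w ^+ (a - b) * w ^+ b by rewrite -exprD subnK// ltnW.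
  have : w ^+ b * (w^*)%C ^+ b = 1.
    by rewrite -exprMn conjc_mul_normc w1 expr1n/= expr1n.
  move=> wb; transitivity (w ^+ (a - b) * (w ^+ b * (w^*)%C ^+ b) * (z ^+ a * (z^*)%C ^+ b * phi z)).
    by ring.
  by rewrite wb mulr1.
have [mF iF'] := iF.
have iFw : Cintegrable lebC (fun z => F (w * z)).
  have mw : measurable_fun setT (fun z => w * z) by exact: measurable_funCM.
  split; first exact: measurableT_comp.
  rewrite (_ : _ \o _ = EFin \o (normc \o F))//; apply/funext => z /=.
  by rewrite Fw Normc.normcM; congr EFin; rewrite /= expr0n expr1n add0r sqrtr1 mul1r.
have := Cint_lebesgueC_rotation w1 wN1 iFw mF.
rewrite (eq_Cint lebC Fw) CintZl// => /eqP; rewrite -subr_eq0 -[X in _ - X]mul1r -mulrBl.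
rewrite mulf_eq0 => /orP[|/eqP//]; rewrite subr_eq0 eq_complex/=.
by rewrite eq_sym oner_eq0.
Qed.

End lebesgueC_integral.

Section angular_orthogonality.
Variable R : realType.
Local Notation normc := (@Normc.normc R).
Local Notation lebC := (@lebesgueC R).

Lemma Cint_conjc d (T : measurableType d) (mu : {measure set T -> \bar R})
    (F : T -> R[i]) : Cintegrable mu F ->
  Cint mu (fun x => (F x)^*%C) = (Cint mu F)^*%C.
Proof.
move=> iF; apply: complex_eqP => /=; first by apply: eq_Rintegral => x _; case: (F x).
rewrite -mulN1r -RintegralZl//; last exact: Cintegrable_Im.
by apply: eq_Rintegral => x _; rewrite mulN1r; case: (F x).
Qed.

(** Complex conjugation exchanges the two exponents. *)
Lemma Cint_angular_orthogonality (phi : R[i] -> R[i]) a b : a != b ->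
  (forall w z, normc w = 1 -> phi (w * z) = phi z) ->
  Cintegrable lebC (fun z => z ^+ a * (z^*)%C ^+ b * phi z) ->
  Cint lebC (fun z => z ^+ a * (z^*)%C ^+ b * phi z) = 0.
Proof.
rewrite neq_ltn => /orP[ab|ba] rphi iF; last exact: Cint_angular_orthogonality_lt.
have E z : z ^+ a * (z^*)%C ^+ b * phi z = (z ^+ b * (z^*)%C ^+ a * (phi z)^*%C)^*%C.
  by rewrite !rmorphM !rmorphXn /= !conjcK; congr (_ * _); rewrite mulrC.
have iG : Cintegrable lebC (fun z => z ^+ b * (z^*)%C ^+ a * (phi z)^*%C).
  have [mF iF'] := iF; split.
    have := measurable_funconjc mF; congr (measurable_fun _ _).
    by apply/funext => z; rewrite E conjcK.
  rewrite (_ : _ \o _ = EFin \o (normc \o (fun z => z ^+ a * (z^*)%C ^+ b * phi z)))//.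
  by apply/funext => z; rewrite /= E normc_conj.
rewrite (eq_Cint lebC E) Cint_conjc// (Cint_angular_orthogonality_lt ab)//.
  by rewrite conjc0.
by move=> w z w1; rewrite rphi.
Qed.

End angular_orthogonality.

(** * Radial Gaussian moments *)
Section radial_moments.
Variable R : realType.
Local Notation Rm := (measurableTypeR R).
Local Notation leb := (@lebesgue_measure R).
Local Notation leb2 := (@lebesgue_measure R \x @lebesgue_measure R)%E.
Local Notation normc := (@Normc.normc R).
Local Notation lebC := (@lebesgueC R).
Implicit Types (s t : R) (m : nat) (z : R[i]).

Definition radial_weight m s z : R :=
  (normc z ^+ 2) ^+ m * expR (- (s * normc z ^+ 2)).

(** This is [pi * m! / s ^ (m + 1)]. *)
Definition radial_moment m s : R := \int[lebC]_z radial_weight m s z.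

Lemma radial_weight_ge0 m s z : 0 <= radial_weight m s z.
Proof. by rewrite mulr_ge0 ?expR_ge0// exprn_ge0// sqr_ge0. Qed.

Lemma measurable_radial_weight m s : measurable_fun setT (radial_weight m s).
Proof.
have mn : measurable_fun setT (fun z => normc z ^+ 2).
  by apply: measurable_funX; exact: measurable_normc.
apply: measurable_funM; first exact: measurable_funX.
by apply: measurableT_comp => //; apply: measurableT_comp => //; exact: measurable_funM.
Qed.

Let ereal_weight_ge0 m s z : (0 <= (radial_weight m s z)%:E)%E.
Proof. by rewrite lee_fin radial_weight_ge0. Qed.

Let measurable_ereal_weight m s : measurable_fun setT (EFin \o radial_weight m s).
Proof. by apply/measurable_EFinP; exact: measurable_radial_weight. Qed.

Lemma integrable_radial_weight m s : 0 < s ->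
  lebC.-integrable setT (EFin \o radial_weight m s).
Proof.
elim: m s => [|m ih] s s0.
  apply/integrableP; split => //.
  rewrite (eq_integral (EFin \o radial_weight 0 s)); last first.
    by move=> z _; rewrite gee0_abs//; exact: ereal_weight_ge0.
  rewrite ge0_integral_lebesgueC//=.
  have := integrable_prod (integrable_gauss s0) (integrable_gauss s0).
  move=> /integrableP[_]; apply: le_lt_trans; apply: le_of_eq; apply: eq_integral => -[x y] _ /=.
  rewrite -expRD ger0_norm ?expR_ge0// /radial_weight expr0 mul1r.
  by rewrite normc_sqr/= mulrDr opprD.
(* By [1 + y <= exp y] at [y = s * x / 2], half of the exponential absorbs one
   power of [x = |z| ^ 2]. *)
have s20 : 0 < s / 2 by rewrite divr_gt0.
have := ih (s / 2) s20 => i2.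
have := integrableZl measurableT (2 / s) i2.
apply: le_integrable => // z _; rewrite /= lee_fin.
rewrite !ger0_norm ?radial_weight_ge0//; last first.
  by rewrite mulr_ge0 ?radial_weight_ge0// divr_ge0// ltW.
rewrite /radial_weight; set x := normc z ^+ 2.
have x0 : 0 <= x by exact: sqr_ge0.
rewrite exprSr -mulrA [leRHS]mulrCA ler_wpM2l ?(exprn_ge0 _ x0)//.
have -> : - (s * x) = - (s / 2 * x) - (s / 2 * x) by field.
rewrite expRD mulrA ler_wpM2r ?expR_ge0// expRN ler_pdivrMr ?expR_gt0//.
apply: (@le_trans _ _ (2 / s * (1 + s / 2 * x))); last first.
  by rewrite ler_wpM2l ?expR_ge1Dx// divr_ge0// ltW.
have -> : 2 / s * (1 + s / 2 * x) = 2 / s + x by field; rewrite gt_eqF.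
by rewrite lerDr divr_ge0// ltW.
Qed.

Lemma radial_momentE m s : 0 < s ->
  (\int[lebC]_z (radial_weight m s z)%:E = (radial_moment m s)%:E)%E.
Proof.
by move=> s0; rewrite fineK//; exact: (integrable_fin_num measurableT (integrable_radial_weight m s0)).
Qed.

Lemma radial_moment_scaling m s : 0 < s ->
  s ^+ m.+1 * radial_moment m s = radial_moment m 1.
Proof.
move=> s0; have r0 : 0 < Num.sqrt s by rewrite sqrtr_gt0.
apply: EFin_inj; rewrite EFinM -!radial_momentE//.
rewrite !ge0_integral_lebesgueC//; try exact: measurable_ereal_weight.
pose f (p : Rm * Rm) := (radial_weight m 1 (p.1 +i* p.2)%C)%:E.
have mf : measurable_fun setT f.
  by apply: (measurableT_comp (measurable_ereal_weight m 1)); exact: measurable_Complex.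
have f0 p : (0 <= f p)%E by exact: ereal_weight_ge0.
rewrite [RHS](_ : _ = \int[leb2]_p f p)%E//.
have := ge0_integral_homothety mf f0 r0; rewrite sqr_sqrtr ?ltW//.
move/(congr1 (fun x => s%:E * x)%E); rewrite muleA -EFinM divff ?gt_eqF// mul1e => <-.
rewrite exprS EFinM -muleA; congr (_ * _)%E.
rewrite -ge0_integralZl//; last 2 first.
- by apply: (measurableT_comp (measurable_ereal_weight m s)); exact: measurable_Complex.
- by rewrite lee_fin exprn_ge0// ltW.
apply: eq_integral => -[x y] _; rewrite /f /radial_weight -EFinM; congr EFin.
rewrite !normc_sqr/= !exprMn sqr_sqrtr ?(ltW s0)// -mulrDr mul1r exprMn.
by rewrite mulrA.
Qed.

(** The integral of the tangent inequality
    [exp (- x) * (1 - (t - 1) * x) <= exp (- t * x)], against [x ^ m] at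
    [x = |z| ^ 2]. *)
Lemma radial_moment_convexity m t : 0 < t ->
  radial_moment m 1 - (t - 1) * radial_moment m.+1 1 <= radial_moment m t.
Proof.
move=> t0; have [i1 i2 it] : [/\ lebC.-integrable setT (EFin \o radial_weight m 1),
    lebC.-integrable setT (EFin \o radial_weight m.+1 1) &
    lebC.-integrable setT (EFin \o radial_weight m t)].
  by split; apply: integrable_radial_weight.
have i2' : lebC.-integrable setT (EFin \o (fun z => (t - 1) * radial_weight m.+1 1 z)).
  exact: (integrableZl measurableT (t - 1) i2).
rewrite -RintegralZl// -RintegralB//; apply: le_Rintegral => //.
  exact: (integrableB measurableT i1 i2').
move=> z _; rewrite /radial_weight; set x := normc z ^+ 2.
have x0 : 0 <= x by exact: sqr_ge0.
have -> : - (t * x) = - (1 * x) + (- ((t - 1) * x)) by ring.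
rewrite expRD [leRHS]mulrA.
have -> : x ^+ m * expR (- (1 * x)) - (t - 1) * (x ^+ m.+1 * expR (- (1 * x))) =
  x ^+ m * expR (- (1 * x)) * (1 - (t - 1) * x) by rewrite exprS; ring.
rewrite ler_wpM2l ?expR_ge1Dx//.
by rewrite mulr_ge0 ?expR_ge0// exprn_ge0.
Qed.

(** By convexity and scaling, [t ^ (m+1) * (M_m - (t - 1) * M_(m+1))], with [M_m]
    the moment of parameter 1, is at most [M_m]; equality holds at [t = 1], so
    the derivative [(m + 1) * M_m - M_(m+1)] vanishes there. *)
Lemma radial_momentS m : radial_moment m.+1 1 = m.+1%:R * radial_moment m 1.
Proof.
set A := radial_moment m 1; set B := radial_moment _ _.
pose p : {poly R} := 'X^(m.+1) * (A%:P - ('X - 1) * B%:P).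
have pE t : p.[t] = t ^+ m.+1 * (A - (t - 1) * B) by rewrite /p !hornerE.
have : is_derive (1 : R) (1 : R) (horner p) 0.
  apply: (@derive1_at_max _ _ 0 2) => //.
    by rewrite in_itv/=; lra.
  move=> t; rewrite in_itv/= => /andP[t0 _]; rewrite !pE expr1n subrr mul0r subr0 mul1r.
  rewrite [leRHS](_ : _ = t ^+ m.+1 * radial_moment m t); last by rewrite radial_moment_scaling.
  by apply: ler_wpM2l; [rewrite exprn_ge0 ?ltW//|exact: radial_moment_convexity].
move=> p1; have := @derive_val _ _ _ _ _ _ _ p1.
have := @derive_val _ _ _ _ _ _ _ (is_derive_poly p 1) => -> .
rewrite /p derivM derivXn derivB derivC derivM derivB derivX !derivC !hornerE.
rewrite hornerMn hornerXn expr1n expr1n subrr; lra.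
Qed.

(** The plane integral is the square of the Gaussian integral. *)
Lemma radial_moment01 : radial_moment 0 1 = pi.
Proof.
rewrite /radial_moment /Rintegral ge0_integral_lebesgueC//; last exact: measurable_ereal_weight.
rewrite (_ : (\int[_]_p _)%E = (pi : R)%:E)//.
rewrite fubini_tonelli1//=; last first.
  by apply: (measurableT_comp (measurable_ereal_weight 0 1)); exact: measurable_Complex.
have mg : measurable_fun [set: Rm] (fun y : Rm => (gauss_fun y)%:E).
  by apply/measurable_EFinP; exact: measurable_gauss_fun.
transitivity (\int[leb]_x ((gauss_fun x)%:E * (Num.sqrt (pi : R))%:E))%E.
  apply: eq_integral => x _; rewrite /fubini_F/=.
  rewrite -integralT_gauss -ge0_integralZl//; last 2 first.
  - by move=> y _; rewrite lee_fin gauss_fun_ge0.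
  - by rewrite lee_fin gauss_fun_ge0.
  apply: eq_integral => y _; rewrite -EFinM /gauss_fun -expRD /radial_weight.
  by rewrite expr0 !mul1r normc_sqr/= opprD.
rewrite ge0_integralZr//; last by move=> y _; rewrite lee_fin gauss_fun_ge0.
by rewrite integralT_gauss -EFinM -expr2 sqr_sqrtr// pi_ge0.
Qed.

Lemma radial_moment_gt0 m s : 0 < s -> 0 < radial_moment m s.
Proof.
move=> s0; rewrite -(pmulr_rgt0 _ (exprn_gt0 m.+1 s0)) radial_moment_scaling//.
elim: m => [|m ih]; first by rewrite radial_moment01 pi_gt0.
by rewrite radial_momentS mulr_gt0.
Qed.

Lemma radial_momentSs m s : 0 < s ->
  radial_moment m.+1 s = m.+1%:R / s * radial_moment m s.
Proof.
move=> s0; apply: (@mulfI _ (s ^+ m.+2)); first by rewrite expf_neq0// gt_eqF.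
rewrite radial_moment_scaling// radial_momentS -(@radial_moment_scaling m s)//.
by rewrite [in RHS]exprS; field; rewrite gt_eqF.
Qed.

End radial_moments.

(** * Product functions and the squared Vandermonde determinant *)

Section complex_density.
Context d (T : measurableType d) (R : realType).
Variables (mu nu : {measure set T -> \bar R}) (h : T -> R).
Hypotheses (mh : measurable_fun [set: T] h) (h0 : forall x, 0 <= h x).
Hypothesis nuE : forall A, measurable A -> nu A = density mu h A.

Lemma Cint_density (F : T -> R[i]) : measurable_fun setT F ->
  Cint nu F = Cint mu (fun x => F x * (h x)%:C%C).
Proof.
move=> mF; apply: complex_eqP => /=.
  rewrite (Rintegral_density mh h0 nuE); last exact: measurable_funRe.
  by apply: eq_Rintegral => x _; rewrite ReM/= mulr0 subr0.
rewrite (Rintegral_density mh h0 nuE); last exact: measurable_funIm.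
by apply: eq_Rintegral => x _; rewrite ImM/= mulr0 add0r.
Qed.

Lemma Cintegrable_density (F : T -> R[i]) : measurable_fun setT F ->
  Cintegrable mu (fun x => F x * (h x)%:C%C) -> Cintegrable nu F.
Proof.
move=> mF [_ iF]; split=> //; apply: (integrable_density mh h0 nuE).
  exact: measurable_funnormc.
move: iF; congr (mu.-integrable _ _); apply/funext => x /=.
by rewrite Normc.normcM normc_realC ger0_norm.
Qed.

End complex_density.

Section product_functions.
Context d (T : measurableType d) (R : realType).
Variable mu : {sigma_finite_measure set T -> \bar R}.

(** Integrability is proved together with the value, as the induction on [n]
    applies Fubini's theorem to the last [n] variables. *)
Lemma Cint_power_measure n (F : 'I_n -> T -> R[i]) :
  (forall k, Cintegrable mu (F k)) ->
  Cint (power_measure mu n) (fun z => \prod_(k < n) F k (tnth z k)) =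
    \prod_(k < n) Cint mu (F k) /\
  Cintegrable (power_measure mu n) (fun z => \prod_(k < n) F k (tnth z k)).
Proof.
elim: n F => [|n ih] F iF.
  have E (z : 0.-tuple T) : \prod_(k < 0) F k (tnth z k) = 1 by rewrite big_ord0.
  rewrite (eq_Cint _ E) big_ord0; split.
    have T1 : (power_measure mu 0) setT = 1%E by rewrite -[LHS]/(\d_ _ setT) diracT.
    have C (r : R) : \int[power_measure mu 0]_x r = r.
      rewrite (Rintegral_cst (power_measure mu 0))// [X in fine X](_ : _ = 1%E)//.
      by rewrite mulr1.
    by apply: complex_eqP; exact: C.
  rewrite (funext E); split; first exact: measurable_cst.
  rewrite (_ : _ \o _ = cst 1%:E); last first.
    by apply/funext => z; congr EFin; exact: Normc.normc1.
  exact: (@finite_measure_integrable_cst _ _ _ (\d_ ([tuple] : 0.-tuple T)) setT 1).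
have [ihE ihI] := ih (fun k => F (lift ord0 k)) (fun k => iF _).
pose G (p : T * n.-tuple T) :=
  F ord0 p.1 * \prod_(k < n) F (lift ord0 k) (tnth p.2 k).
pose cons (p : T * n.-tuple T) : n.+1.-tuple T := [tuple of p.1 :: p.2].
have FG : (fun z : n.+1.-tuple T => \prod_(k < n.+1) F k (tnth z k)) \o cons = G.
  apply/funext => -[x t]; rewrite /G /=big_ord_recl; congr (_ * _).
  by apply: eq_bigr => k _; rewrite tnthS.
have iG : Cintegrable (mu \x power_measure mu n)%E G by exact: (Cintegrable_prod (iF ord0) ihI).
have mF : measurable_fun setT (fun z : n.+1.-tuple T => \prod_(k < n.+1) F k (tnth z k)).
  apply: measurable_funCprod => k; have [mFk _] := iF k.
  by apply: (measurableT_comp mFk); exact: measurable_tnth.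
have mcons : measurable_fun setT cons by apply: measurable_cons.
have := @Cint_pushforward R _ _ _ _ (mu \x power_measure mu n)%E
  (power_measure mu n.+1) cons mcons (fun A _ => erefl) _ _ mF.
rewrite FG => /(_ iG)[-> ?]; split=> //.
by rewrite big_ord_recl (Cint_prod (iF ord0) ihI) ihE.
Qed.

End product_functions.

Section vandermonde.
Variable R : realType.

(** The squared modulus of the determinant is its product with its conjugate;
    both are expanded by the Leibniz formula. *)
Lemma sqr_vandermondeE N (z : N.-tuple R[i]) :
  (sqr_vandermonde z)%:C%C =
  \sum_(st : 'S_N * 'S_N) (-1) ^+ st.1 * (-1) ^+ st.2 *
    \prod_(k < N) (tnth z k ^+ st.1 k * ((tnth z k)^*)%C ^+ st.2 k).
Proof.
pose a : 'rV[R[i]]_N := \row_k tnth z k.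
have detE : \det (Vandermonde N a) =
    \sum_(s : 'S_N) (-1) ^+ s * \prod_(k < N) tnth z k ^+ s k.
  rewrite -det_tr; apply: eq_bigr => s _; congr (_ * _).
  by apply: eq_bigr => k _; rewrite !mxE.
have -> : (sqr_vandermonde z)%:C%C =
    \det (Vandermonde N a) * (\det (Vandermonde N a))^*%C.
  rewrite conjc_mul_normc det_Vandermonde normc_prod -prodrXl; congr (_%:C)%C.
  apply: eq_bigr => l _; rewrite normc_prod -prodrXl.
  by apply: eq_bigr => k _; rewrite !mxE -normcN opprB.
rewrite detE rmorph_sum /= big_distrlr /= pair_big /=.
apply: eq_bigr => -[s t] _ /=; rewrite rmorphM rmorph_prod rmorphXn rmorphN1.
rewrite mulrACA -big_split/=; congr (_ * _).
by apply: eq_bigr => k _; rewrite rmorphXn.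
Qed.

End vandermonde.

(** * Independence of the moduli *)

Section radial_laws.
Variable R : realType.
Local Notation normc := (@Normc.normc R).
Local Notation lebC := (@lebesgueC R).
Implicit Types (k : nat) (s : R) (z : R[i]).

Definition bounded_radial (phi : R[i] -> R[i]) :=
  [/\ measurable_fun setT phi, exists B, forall z, normc (phi z) <= B &
      forall w z, normc w = 1 -> phi (w * z) = phi z].

Definition radial_measure (k : nat) (s : R) : set R[i] -> \bar R :=
  density lebC (radial_weight k s).

HB.instance Definition _ k s := isMeasure.Build _ _ _ (radial_measure k s)
  (density_set0 _ _) (density_ge0 _ (radial_weight_ge0 k s))
  (density_semi_sigma_additive (measurable_radial_weight k s) (radial_weight_ge0 k s)).

(** Under this law, of density proportional to [|z| ^ (2 k) * exp (- s |z| ^ 2)],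
    the squared modulus has the Gamma law of shape [k + 1] and rate [s]. *)
Definition radial_law (k : nat) (s : R) : probability R[i] R :=
  mnormalize (radial_measure k s) (@dirac _ R[i] point R).

Lemma radial_lawE k s : 0 < s -> forall A, measurable A ->
  radial_law k s A = density lebC (fun z => radial_weight k s z / radial_moment k s) A.
Proof.
move=> s0 A mA; apply: (@mnormalize_density _ _ _ lebC (radial_measure k s)) => //.
- exact: measurable_radial_weight.
- exact: radial_weight_ge0.
- by rewrite -radial_momentE.
- exact: radial_moment_gt0.
Qed.

Lemma radial_density_ge0 k s z : 0 < s ->
  0 <= radial_weight k s z / radial_moment k s.
Proof. by move=> s0; rewrite divr_ge0 ?radial_weight_ge0// ltW// radial_moment_gt0. Qed.

Lemma measurable_radial_density k (s : R) :
  measurable_fun setT (fun z => radial_weight k s z / radial_moment k s).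
Proof. by apply: measurable_funM => //; exact: measurable_radial_weight. Qed.

Lemma Rintegral_radial_law k s (f : R[i] -> R) : 0 < s -> measurable_fun setT f ->
  \int[radial_law k s]_z f z =
  (\int[lebC]_z (f z * (radial_weight k s z / radial_moment k s))).
Proof.
move=> s0 mf; apply: (Rintegral_density (measurable_radial_density k s)) => //.
  by move=> z; exact: radial_density_ge0.
exact: radial_lawE.
Qed.

Section gauss.
Variable N : nat.
Hypothesis N0 : (0 < N)%N.
Let s : R := N%:R.
Let s0 : 0 < s. Proof. by rewrite ltr0n. Qed.

Lemma Cintegrable_monomial (phi : R[i] -> R[i]) B a b :
  measurable_fun setT phi -> (forall z, normc (phi z) <= B) ->
  Cintegrable lebC (fun z => phi z * (z ^+ a * (z^*)%C ^+ b) * (gauss_weight N z)%:C%C).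
Proof.
move=> mphi phiB.
apply: (@Cintegrable_le _ _ _ _ _ (fun z => B * (radial_weight a s z + radial_weight b s z))).
- apply: measurable_funCM; last first.
    by apply: measurable_funrealC; exact: measurable_gauss_weight.
  apply: measurable_funCM => //.
  by apply: measurable_funCM; apply: measurable_funCX => //; exact: measurable_funconjc.
- have i k := integrable_radial_weight k s0.
  exact: (integrableZl measurableT B (integrableD measurableT (i a) (i b))).
- move=> z; rewrite !Normc.normcM !normcX normc_conj normc_realC ger0_norm ?gauss_weight_ge0//.
  rewrite /radial_weight -mulrDl -/(gauss_weight N z) [leRHS]mulrA.
  rewrite ler_wpM2r ?gauss_weight_ge0//.
  apply: ler_pM; rewrite ?normc_ge0 ?mulr_ge0 ?exprn_ge0 ?normc_ge0//.
  rewrite -!exprM ![(2 * _)%N]mulnC !exprM.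
  (* [|z| ^ (a + b)] is at most [|z| ^ (2 a) + |z| ^ (2 b)]. *)
  set x := _ ^+ a; set y := _ ^+ b.
  have : 0 <= (x - y) ^+ 2 by exact: sqr_ge0.
  have : 0 <= (x + y) ^+ 2 by exact: sqr_ge0.
  by nra.
Qed.

Lemma Cintegrable_gauss_monomial (phi : R[i] -> R[i]) (a b : nat) :
  bounded_radial phi ->
  Cintegrable (@gauss_measure R N) (fun z => phi z * (z ^+ a * (z^*)%C ^+ b)).
Proof.
move=> [mphi [B phiB] _].
apply: (@Cintegrable_density _ _ _ lebC _ (gauss_weight N)) => //.
- exact: measurable_gauss_weight.
- exact: gauss_weight_ge0.
- apply: measurable_funCM => //.
  by apply: measurable_funCM; apply: measurable_funCX => //; exact: measurable_funconjc.
- exact: Cintegrable_monomial phiB.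
Qed.

(** For [a != b] the angular average vanishes; for [a = b] the monomial is
    [|z| ^ (2 a)], which turns the Gaussian weight into a radial law. *)
Lemma Cint_gauss_monomial (phi : R[i] -> R[i]) (a b : nat) : bounded_radial phi ->
  Cint (@gauss_measure R N) (fun z => phi z * (z ^+ a * (z^*)%C ^+ b)) =
  if a == b then (radial_moment a s)%:C%C * Cint (radial_law a s) phi else 0.
Proof.
move=> [mphi [B phiB] rphi].
have mM : measurable_fun setT (fun z => phi z * (z ^+ a * (z^*)%C ^+ b)).
  apply: measurable_funCM => //.
  by apply: measurable_funCM; apply: measurable_funCX => //; exact: measurable_funconjc.
rewrite (@Cint_density _ _ _ lebC _ (gauss_weight N))//; last 2 first.
- exact: measurable_gauss_weight.
- exact: gauss_weight_ge0.
have iM := Cintegrable_monomial a b mphi phiB.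
have [ab|ab] := eqVneq a b; last first.
  have E z : phi z * (z ^+ a * (z^*)%C ^+ b) * (gauss_weight N z)%:C%C =
      z ^+ a * (z^*)%C ^+ b * (phi z * (gauss_weight N z)%:C%C) by ring.
  rewrite (eq_Cint _ E); apply: Cint_angular_orthogonality => //.
    by move=> w z w1; rewrite rphi// /gauss_weight Normc.normcM w1 mul1r.
  by move: iM; rewrite (funext E).
rewrite (@Cint_density _ _ _ lebC (radial_law a s)
  (fun z => radial_weight a s z / radial_moment a s))//; last 3 first.
- exact: measurable_radial_density.
- by move=> z; exact: radial_density_ge0.
- exact: radial_lawE.
have E z : phi z * (radial_weight a s z / radial_moment a s)%:C%C =
   ((radial_moment a s)^-1)%:C%C *
     (phi z * (z ^+ a * (z^*)%C ^+ b) * (gauss_weight N z)%:C%C).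
  rewrite -ab -exprMn conjc_mul_normc rmorphM /radial_weight rmorphM rmorphXn/=.
  by rewrite -/(gauss_weight N z); ring.
rewrite (eq_Cint _ E) CintZl// mulrA -rmorphM mulfV ?rmorph1 ?mul1r//.
by rewrite gt_eqF// radial_moment_gt0.
Qed.

End gauss.
End radial_laws.

Section kostlan.
Variables (R : realType) (N : nat).
Hypothesis N0 : (0 < N)%N.
Local Notation normc := (@Normc.normc R).
Local Notation pm := (power_measure (@gauss_measure R N) N).
Let s : R := N%:R.
Let s0 : 0 < s. Proof. by rewrite ltr0n. Qed.

(** In the double sum over permutations, two different permutations take
    different values at some [k], and the factor of index [k] then vanishes by
    angular orthogonality: only the diagonal survives. *)
Lemma Cint_sqr_vandermonde (phi : 'I_N -> R[i] -> R[i]) :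
  (forall k, bounded_radial (phi k)) ->
  Cint pm (fun z => \prod_(k < N) phi k (tnth z k) * (sqr_vandermonde z)%:C%C) =
    \sum_(t : 'S_N) \prod_(k < N)
      ((radial_moment (t k) s)%:C%C * Cint (radial_law (t k) s) (phi k)) /\
  Cintegrable pm (fun z => \prod_(k < N) phi k (tnth z k) * (sqr_vandermonde z)%:C%C).
Proof.
move=> rphi.
pose G (st : 'S_N * 'S_N) (k : 'I_N) (z : R[i]) := phi k z * (z ^+ st.1 k * (z^*)%C ^+ st.2 k).
have iG st k : Cintegrable (@gauss_measure R N) (G st k).
  exact: Cintegrable_gauss_monomial.
have E (z : N.-tuple R[i]) : \prod_(k < N) phi k (tnth z k) * (sqr_vandermonde z)%:C%C =
    \sum_(st : 'S_N * 'S_N) (-1) ^+ st.1 * (-1) ^+ st.2 *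
      \prod_(k < N) G st k (tnth z k).
  rewrite sqr_vandermondeE big_distrr/=; apply: eq_bigr => st _.
  by rewrite mulrCA; congr (_ * _); rewrite -big_split.
have iGp st : Cintegrable pm (fun z => \prod_(k < N) G st k (tnth z k)).
  exact: (Cint_power_measure (iG st)).2.
have iGs (st : 'S_N * 'S_N) : Cintegrable pm (fun z => (-1) ^+ st.1 * (-1) ^+ st.2 *
      \prod_(k < N) G st k (tnth z k)) by exact: CintegrableZl.
rewrite (eq_Cint pm E) (funext E) Cint_sum//; split; last exact: Cintegrable_sum.
rewrite (eq_bigr (fun st : 'S_N * 'S_N => (-1) ^+ st.1 * (-1) ^+ st.2 *
    \prod_(k < N) Cint (@gauss_measure R N) (G st k))); last first.
  by move=> st _; rewrite CintZl// (Cint_power_measure (iG st)).1.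
rewrite -(pair_bigA _ (fun t u : 'S_N => (-1) ^+ t * (-1) ^+ u *
    \prod_(k < N) Cint (@gauss_measure R N) (G (t, u) k)))/=.
apply: eq_bigr => t _; rewrite (bigD1 t)//= [X in _ + X]big1 ?addr0; last first.
  move=> u ut; have [k tuk] : exists k, u k != t k.
    apply/existsP; apply: contraR ut => /existsPn tu.
    by apply/eqP/permP => k; apply/eqP; move: (tu k); rewrite negbK.
  rewrite (bigD1 k)//= Cint_gauss_monomial//=.
  by rewrite [_ == _]eq_sym (inj_eq val_inj) (negbTE tuk) mul0r mulr0.
rewrite -expr2 sqrr_sign mul1r; apply: eq_bigr => k _.
by rewrite Cint_gauss_monomial// eqxx.
Qed.

(** The normalising constant [Z_N]. *)
Definition ginibre_mass : R := N`!%:R * \prod_(k < N) radial_moment k s.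

Lemma ginibre_mass_gt0 : 0 < ginibre_mass.
Proof.
rewrite /ginibre_mass mulr_gt0 ?ltr0n ?fact_gt0//.
by apply: prodr_gt0 => k _; exact: radial_moment_gt0.
Qed.

Lemma bounded_radial_cst (c : R[i]) : bounded_radial (fun=> c).
Proof. by split=> //; exists (normc c). Qed.

Lemma Cint_cst_prob d (T : measurableType d) (P : probability T R) (c : R[i]) :
  Cint P (fun=> c) = c.
Proof.
have C (r : R) : \int[P]_x r = r by exact: Rintegral_cst_probability.
by apply: complex_eqP; exact: C.
Qed.

Lemma prod_perm (F : 'I_N -> R[i]) (t : 'S_N) :
  \prod_(k < N) F (t k) = \prod_(k < N) F k.
Proof. by rewrite [RHS](reindex_inj (@perm_inj _ t)). Qed.

Lemma ginibre_weight_setT : @ginibre_weight R N setT = ginibre_mass%:E.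
Proof.
have [E [m1 i1]] := Cint_sqr_vandermonde (fun=> bounded_radial_cst 1).
have iV : pm.-integrable setT (EFin \o (@sqr_vandermonde R N)).
  move: i1; congr (pm.-integrable _ _); apply/funext => z /=.
  by rewrite big1_eq mul1r normc_realC ger0_norm// sqr_vandermonde_ge0.
rewrite -[LHS]/(\int[pm]_z (sqr_vandermonde z)%:E)%E.
rewrite -[LHS]fineK; last exact: (integrable_fin_num measurableT iV).
congr EFin; apply: (@complexI R); rewrite -[LHS]/((\int[pm]_z sqr_vandermonde z)%:C)%C.
rewrite -Cint_realC; transitivity (\sum_(t : 'S_N) \prod_(k < N) (radial_moment k s)%:C%C).
  rewrite -[LHS](eq_Cint pm (F := fun z => \prod_(k < N) 1 * (sqr_vandermonde z)%:C%C)).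
    rewrite E; apply: eq_bigr => t _; rewrite -[RHS](prod_perm _ t).
    by apply: eq_bigr => k _; rewrite Cint_cst_prob mulr1.
  by move=> z; rewrite big1_eq mul1r.
rewrite sumr_const card_Sn /ginibre_mass rmorphM rmorph_prod rmorph_nat.
by rewrite mulr_natl.
Qed.

Lemma ginibreE A : measurable A ->
  ginibre R N A = density pm (fun z => sqr_vandermonde z / ginibre_mass) A.
Proof.
move=> mA; apply: (@mnormalize_density _ _ _ pm (@ginibre_weight R N)) => //.
- exact: measurable_sqr_vandermonde.
- exact: sqr_vandermonde_ge0.
- exact: ginibre_weight_setT.
- exact: ginibre_mass_gt0.
Qed.

(** The moduli of a Ginibre sample, taken in random order, are independent
    with the laws [radial_law k N], [k < N]: the right-hand side is the
    average over all orderings. *)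
Lemma Cint_ginibre (phi : 'I_N -> R[i] -> R[i]) :
  (forall k, bounded_radial (phi k)) ->
  Cint (ginibre R N) (fun z => \prod_(k < N) phi k (tnth z k)) =
  (N`!%:R)^-1 * \sum_(t : 'S_N) \prod_(k < N) Cint (radial_law (t k) s) (phi k).
Proof.
move=> rphi; have M0 := ginibre_mass_gt0.
have [E iF] := Cint_sqr_vandermonde rphi.
rewrite (@Cint_density _ _ _ pm (ginibre R N) (fun z => sqr_vandermonde z / ginibre_mass)).
- pose F (z : N.-tuple R[i]) := \prod_(k < N) phi k (tnth z k) * (sqr_vandermonde z)%:C%C.
  rewrite (eq_Cint pm (G := fun z => (ginibre_mass^-1)%:C%C * F z)); last first.
    by move=> z; rewrite rmorphM mulrA mulrC.
  rewrite CintZl// E !mulr_sumr; apply: eq_bigr => t _; rewrite big_split/=.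
  rewrite (prod_perm (fun k => (radial_moment k s)%:C%C)) mulrA; congr (_ * _).
  rewrite /ginibre_mass invfM rmorphM -mulrA -rmorph_prod -rmorphM mulVf ?mulr1.
    by rewrite fmorphV rmorph_nat.
  by rewrite gt_eqF//; apply: prodr_gt0 => k _; exact: radial_moment_gt0.
- by apply: measurable_funM => //; exact: measurable_sqr_vandermonde.
- by move=> z; rewrite divr_ge0 ?sqr_vandermonde_ge0// ltW.
- exact: ginibreE.
- apply: measurable_funCprod => k; have [mphi _ _] := rphi k.
  by apply: (measurableT_comp mphi); exact: measurable_tnth.
Qed.

End kostlan.

(** * Bounds on integrals, products and trigonometric functions *)

Section integral_bounds.
Context d (T : measurableType d) (R : realType).
Variable mu : {measure set T -> \bar R}.
Implicit Types f g : T -> R.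

Lemma integrable_bound f g : measurable_fun setT f ->
  mu.-integrable setT (EFin \o g) -> (forall x, `|f x| <= g x) ->
  mu.-integrable setT (EFin \o f).
Proof.
move=> mf ig fg; apply: le_integrable ig => //; first exact/measurable_EFinP.
by move=> x _ /=; rewrite lee_fin (le_trans (fg x))// ler_norm.
Qed.

Lemma normr_Rintegral_bound f g : measurable_fun setT f ->
  mu.-integrable setT (EFin \o g) -> (forall x, `|f x| <= g x) ->
  `|\int[mu]_x f x| <= \int[mu]_x g x.
Proof.
move=> mf ig fg; have if_ := integrable_bound mf ig fg.
apply: (le_trans (le_normr_Rintegral _ if_)) => //.
by apply: le_Rintegral => //; exact: integrable_norm.
Qed.

(** The modulus of a complex integral is the real part of the integral of the
    function rotated onto the positive axis. *)
Lemma normc_Cint_le (F : T -> R[i]) : Cintegrable mu F ->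
  Normc.normc (Cint mu F) <= \int[mu]_x Normc.normc (F x).
Proof.
move=> iF; have [mF iN] := iF.
set c := Cint mu F; have [c0|c0] := eqVneq (Normc.normc c) 0.
  by rewrite c0 Rintegral_ge0// => x _; exact: normc_ge0.
pose u : R[i] := (Normc.normc c)^-1%:C%C * (c^*)%C.
have u1 : Normc.normc u = 1.
  by rewrite Normc.normcM normc_conj normc_realC ger0_norm ?mulVf// invr_ge0 normc_ge0.
have -> : Normc.normc c = complex.Re (Cint mu (fun x => u * F x)).
  rewrite CintZl// -/c /u -mulrA [_ * c]mulrC conjc_mul_normc -rmorphM/=.
  by rewrite expr2 mulrA mulVf// mul1r.
apply: le_trans (ler_norm _) _; apply: normr_Rintegral_bound => //.
  by apply: measurable_funRe; exact: measurable_funCM.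
by move=> x; rewrite (le_trans (normr_Re_le _))// Normc.normcM u1 mul1r.
Qed.

End integral_bounds.

Section prod_comparison.
Variable R : realType.
Local Notation normc := (@Normc.normc R).

(** The factors are exchanged one at a time, the others staying in the unit
    disc. *)
Lemma normc_prod_sub_le n (a b : 'I_n -> R[i]) :
  (forall k, normc (a k) <= 1) -> (forall k, normc (b k) <= 1) ->
  normc (\prod_(k < n) a k - \prod_(k < n) b k) <= \sum_(k < n) normc (a k - b k).
Proof.
elim: n a b => [|n ih] a b a1 b1.
  by rewrite !big_ord0 subrr Normc.normc0.
rewrite !big_ord_recl.
set A := \prod_(k < n) _; set B := \prod_(k < n) _.
have -> : a ord0 * A - b ord0 * B = (a ord0 - b ord0) * A + b ord0 * (A - B) by ring.
apply: (le_trans (normcD_le _ _)); rewrite !Normc.normcM; apply: lerD.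
  rewrite ler_piMr ?normc_ge0// /A normc_prod.
  by apply: prodr_ile1 => k _; rewrite normc_ge0 a1.
apply: le_trans (ih _ _ (fun k => a1 _) (fun k => b1 _)).
by rewrite ler_piMl ?normc_ge0.
Qed.

End prod_comparison.

Section taylor.
Variable R : realType.
Implicit Types x y : R.

Lemma normr_sin_le x : `|sin x| <= `|x|.
Proof.
wlog x0 : x / 0 <= x => [hw|].
  by have [/hw//|/ltW x0] := leP 0 x; rewrite -normrN -sinN -[leRHS]normrN hw// oppr_ge0.
move: x0; rewrite le_eqVlt => /predU1P[<-|x0]; first by rewrite sin0 !normr0.
have [c _] := @MVT _ sin cos 0 x x0 (fun x _ => is_derive_sin x)
  (continuous_subspaceT (@continuous_sin R)).
by rewrite sin0 !subr0 => ->; rewrite normrM ler_piMl// cos_max.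
Qed.

Lemma one_minus_cos_bound x : 0 <= 1 - cos x <= x ^+ 2 / 2.
Proof.
rewrite subr_ge0 cos_le1/=.
have -> : 1 - cos x = 2 * sin (x / 2) ^+ 2.
  rewrite {1}(_ : x = (x / 2) *+ 2); last by rewrite -mulr_natr divfK.
  by rewrite cos_mulr2n; have := cos2Dsin2 (x / 2); lra.
have := normr_sin_le (x / 2); rewrite -(@ler_pXn2r _ 2)// ?nnegrE//.
by rewrite !real_normK ?num_real//; lra.
Qed.

Lemma sub_sin_bound x : `|sin x - x| <= `|x| ^+ 3 / 2.
Proof.
wlog x0 : x / 0 <= x => [hw|].
  have [/hw//|/ltW x0] := leP 0 x.
  have := hw (- x); rewrite oppr_ge0 sinN opprK normrN => /(_ x0).
  by rewrite (_ : - sin x + x = - (sin x - x)) ?normrN// opprB addrC.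
move: x0; rewrite le_eqVlt => /predU1P[<-|x0].
  by rewrite sin0 subrr !normr0 expr0n/= mul0r.
have ds y : y \in `]0, x[ -> is_derive y 1 (fun y => sin y - y) (cos y - 1).
  by move=> _; exact: (is_deriveB (is_derive_sin y) (is_derive_id y 1)).
have cs : {within `[0, x], continuous (fun y => sin y - y)}.
  apply: continuous_subspaceT => y.
  by apply: cvgB; [exact: continuous_sin|exact: cvg_id].
have [c] := MVT x0 ds cs.
rewrite in_itv/= => /andP[c0 cx]; rewrite sin0 !subr0 => ->.
rewrite normrM (ger0_norm (ltW x0)) exprSr -mulrAC ler_wpM2r ?(ltW x0)//.
have /andP[h1 h2] := one_minus_cos_bound c; rewrite ler0_norm; last by lra.
rewrite opprB (le_trans h2)// ler_wpM2r// ler_pXn2r// ?nnegrE ltW//.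
Qed.

Lemma cos_taylor2_bound x : `|cos x - 1 + x ^+ 2 / 2| <= `|x| ^+ 3.
Proof.
pose h := x / 2; have xh : x = h *+ 2 by rewrite -mulr_natr divfK.
(* The half-angle formula turns the remainder into a difference of squares. *)
have -> : cos x - 1 + x ^+ 2 / 2 = 2 * ((h - sin h) * (h + sin h)).
  by rewrite xh cos_mulr2n; have := cos2Dsin2 h; lra.
(* Weaker than the cubic bound for [|h| <= 4], and than [2 |h|] beyond. *)
have hs : `|h - sin h| <= 2 * `|h| ^+ 2.
  have [h4|h4] := leP `|h| 4.
    rewrite distrC (le_trans (sub_sin_bound h))// exprS.
    rewrite ler_pdivrMr// mulrAC ler_wpM2r ?sqr_ge0//; lra.
  have : `|h - sin h| <= `|h| + `|h|.
    by rewrite (le_trans (ler_normB _ _))// lerD2l normr_sin_le.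
  by move/le_trans; apply; nra.
have hs' : `|h + sin h| <= 2 * `|h|.
  by rewrite (le_trans (ler_normD _ _))// mulr_natl mulr2n lerD2l normr_sin_le.
rewrite !normrM normr_nat xh normrMn.
apply: (@le_trans _ _ (2 * (2 * `|h| ^+ 2 * (2 * `|h|)))).
  by rewrite ler_wpM2l// ler_pM.
by apply: le_of_eq; ring.
Qed.

End taylor.

(** * Statistics of a concentrated variable *)

(** [G] stands for the fluctuation of a squared modulus around its mean [a ^ 2]:
    its standard deviation is [a / b], with [b = sqrt N], and its fourth moment
    is comparable with the square of its variance. The statistics of interest
    are functions of [G] that are Lipschitz at [0] with constant [c / a]. *)
Section concentrated_variable.
Context d (T : measurableType d) (R : realType).
Variables (P : probability T R) (G : T -> R) (a b c : R).
Hypotheses (a0 : 0 < a) (b0 : 0 < b) (c0 : 0 <= c) (ab1 : 1 <= a * b).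
Hypotheses (mG : measurable_fun setT G)
  (iG4 : P.-integrable setT (EFin \o (fun x => G x ^+ 4)))
  (EG1 : \int[P]_x G x = 0) (EG2 : \int[P]_x (G x ^+ 2) = a ^+ 2 / b ^+ 2)
  (EG4 : \int[P]_x (G x ^+ 4) <= 9 * a ^+ 4 / b ^+ 4).

Let intD (u v : T -> R) : P.-integrable setT (EFin \o u) ->
  P.-integrable setT (EFin \o v) -> P.-integrable setT (EFin \o (fun x => u x + v x)).
Proof. by move=> iu iv; exact: (integrableD measurableT iu iv). Qed.

Let intZ (k : R) (u : T -> R) : P.-integrable setT (EFin \o u) ->
  P.-integrable setT (EFin \o (fun x => k * u x)).
Proof. by move=> iu; exact: (integrableZl measurableT k iu). Qed.

Let intC (k : R) : P.-integrable setT (EFin \o (fun=> k)).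
Proof. exact: finite_measure_integrable_cst. Qed.

Let Ecst (k : R) : \int[P]_x k = k.
Proof. exact: Rintegral_cst_probability. Qed.

Let iG2 : P.-integrable setT (EFin \o (fun x => G x ^+ 2)).
Proof.
apply: (@integrable_bound _ _ _ _ _ (fun x => 1 + G x ^+ 4)).
- exact: measurable_funX.
- exact: intD.
- move=> x; rewrite ger0_norm ?sqr_ge0//.
  by have := sqr_ge0 (G x ^+ 2 - 1); nra.
Qed.

Let iG1 : P.-integrable setT (EFin \o G).
Proof.
apply: (@integrable_bound _ _ _ _ _ (fun x => 1 + G x ^+ 2)) => //.
- exact: intD.
- by move=> x; rewrite ler_norml; apply/andP; split; nra.
Qed.

Let majorant (u v w : R) := fun x => u + (v * G x ^+ 2 + w * G x ^+ 4).

Let imaj u v w : P.-integrable setT (EFin \o majorant u v w).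
Proof. by apply: intD => //; apply: intD; exact: intZ. Qed.

Let Emaj u v w : 0 <= w ->
  \int[P]_x majorant u v w x <= u + (v * (a ^+ 2 / b ^+ 2) + w * (9 * a ^+ 4 / b ^+ 4)).
Proof.
move=> w0; rewrite /majorant RintegralD//; last by apply: intD; exact: intZ.
rewrite Ecst RintegralD ?RintegralZl// ?EG2; last 2 first.
- exact: intZ.
- exact: intZ.
by rewrite !lerD2l ler_wpM2l.
Qed.

Let Ebound (f : T -> R) u v w : 0 <= w -> measurable_fun setT f ->
  (forall x, `|f x| <= majorant u v w x) ->
  P.-integrable setT (EFin \o f) /\
  `|\int[P]_x f x| <= u + (v * (a ^+ 2 / b ^+ 2) + w * (9 * a ^+ 4 / b ^+ 4)).
Proof.
move=> w0 mf fm; split; first exact: (integrable_bound mf (imaj u v w)).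
exact: (le_trans (normr_Rintegral_bound mf (imaj u v w) fm)) (Emaj _ _ w0).
Qed.

(* Weighted arithmetic-geometric bounds, balanced at [`|G| = a / b]. *)
Let cube_bound x : `|G x| ^+ 3 <= a / b * G x ^+ 2 + b / a * G x ^+ 4.
Proof.
have l0 : 0 < a / b by rewrite divr_gt0.
rewrite -[G x ^+ 2]real_normK ?num_real// -[G x ^+ 4](_ : (`|G x| ^+ 2) ^+ 2 = _); last first.
  by rewrite real_normK ?num_real// -exprM.
have -> : b / a = (a / b)^-1 by rewrite invf_div.
set l := a / b; set y := `|G x|; have y0 : 0 <= y by exact: normr_ge0.
have : 0 <= (l - y) ^+ 2 by exact: sqr_ge0.
move=> ly; rewrite -(ler_pM2l l0) -/l.
have -> : l * (l * y ^+ 2 + l^-1 * (y ^+ 2) ^+ 2) = (l * l + y ^+ 2) * y ^+ 2.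
  by field; rewrite gt_eqF.
have -> : l * y ^+ 3 = (l * y) * y ^+ 2 by ring.
by apply: ler_wpM2r; [exact: sqr_ge0|nra].
Qed.

Let abs_bound x : `|G x| <= a / b + b / a * G x ^+ 2.
Proof.
have l0 : 0 < a / b by rewrite divr_gt0.
rewrite -[G x ^+ 2]real_normK ?num_real//.
have -> : b / a = (a / b)^-1 by rewrite invf_div.
set l := a / b; set y := `|G x|; have y0 : 0 <= y by exact: normr_ge0.
have : 0 <= (l - y) ^+ 2 by exact: sqr_ge0.
move=> ly; rewrite -(ler_pM2l l0) -/l.
have -> : l * (l + l^-1 * y ^+ 2) = l * l + y ^+ 2 by field; rewrite gt_eqF.
by nra.
Qed.

Section first_order.
Variables (X : T -> R) (x0 : R).
Hypotheses (mX : measurable_fun setT X)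
  (X1 : forall x, `|X x - x0| <= c / a * `|G x|).

Let mX1 : measurable_fun setT (fun x => X x - x0).
Proof. exact: measurable_funB. Qed.

Let ca0 : 0 <= c / a. Proof. by rewrite divr_ge0// ltW. Qed.

Let EX1 : P.-integrable setT (EFin \o (fun x => X x - x0)) /\
  `|\int[P]_x (X x - x0)| <= 2 * c / b.
Proof.
have [//|] := @Ebound (fun x => X x - x0) (c / b) (c * b / a ^+ 2) 0 (lexx _) mX1.
  move=> x; rewrite /majorant mul0r addr0 (le_trans (X1 x))//.
  apply: (le_trans (ler_wpM2l ca0 (abs_bound x))).
  by apply: le_of_eq; field; rewrite !gt_eqF.
move=> i /le_trans h; split=> //; apply: h.
by apply: le_of_eq; field; rewrite !gt_eqF.
Qed.

Lemma integrable_concentrated : P.-integrable setT (EFin \o X).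
Proof.
have := intD EX1.1 (intC x0); congr (P.-integrable _ _).
by apply/funext => x /=; rewrite subrK.
Qed.

Let Esub : \int[P]_x (X x - x0) = \int[P]_x X x - x0.
Proof. by rewrite RintegralB// ?Ecst//; exact: integrable_concentrated. Qed.

(** With [m] the mean, [|X - m| ^ 3] is at most four times the sum of the cubes
    of [|X - x0|] and [|m - x0|], whose contributions are [10] and [2 ^ 3] times
    [c ^ 3 / b ^ 3]. *)
Lemma concentrated_third_moment :
  P.-integrable setT (EFin \o (fun x => `|X x - \int[P]_y X y| ^+ 3)) /\
  \int[P]_x (`|X x - \int[P]_y X y| ^+ 3) <= 72 * c ^+ 3 / b ^+ 3.
Proof.
set m := \int[P]_y X y; have mx0 : `|m - x0| <= 2 * c / b by rewrite -Esub; exact: EX1.2.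
have ca30 : 0 <= (c / a) ^+ 3 by rewrite exprn_ge0.
have m3 : measurable_fun setT (fun x => `|X x - m| ^+ 3).
  by apply: measurable_funX; apply: measurableT_comp => //; exact: measurable_funB.
have [||i h] := @Ebound (fun x => `|X x - m| ^+ 3) (4 * (2 * c / b) ^+ 3)
  (4 * (c / a) ^+ 3 * (a / b)) (4 * (c / a) ^+ 3 * (b / a)) _ m3.
- by rewrite !mulr_ge0 ?invr_ge0 ?(ltW a0) ?(ltW b0)// exprn_ge0.
- move=> x; rewrite ger0_norm ?exprn_ge0// /majorant.
  set p := `|X x - x0|; set q := `|m - x0|.
  have p0 : 0 <= p by exact: normr_ge0.
  have q0 : 0 <= q by exact: normr_ge0.
  have pq : `|X x - m| <= p + q.
    by rewrite (_ : X x - m = (X x - x0) - (m - x0)) ?ler_normB//; ring.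
  have p3 : p ^+ 3 <= (c / a) ^+ 3 * (a / b * G x ^+ 2 + b / a * G x ^+ 4).
    apply: (@le_trans _ _ ((c / a) ^+ 3 * `|G x| ^+ 3)); last exact: ler_wpM2l.
    by rewrite -exprMn; apply: lerXn2r; rewrite ?nnegrE ?(mulr_ge0 ca0)//; exact: X1.
  have q3 : q ^+ 3 <= (2 * c / b) ^+ 3.
    by rewrite ler_pXn2r ?nnegrE// (le_trans _ mx0).
  apply: (@le_trans _ _ ((p + q) ^+ 3)).
    by rewrite ler_pXn2r ?nnegrE ?addr_ge0.
  apply: (@le_trans _ _ (4 * q ^+ 3 + 4 * p ^+ 3)).
    have : 0 <= (p + q) * (p - q) ^+ 2 by rewrite mulr_ge0 ?addr_ge0 ?sqr_ge0.
    by nra.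
  apply: lerD; first by rewrite ler_wpM2l.
  have := ler_wpM2l (ler0n R 4) p3; move=> /le_trans; apply.
  by apply: le_of_eq; ring.
split=> //; apply: le_trans (ler_norm _) (le_trans h _).
by apply: le_of_eq; field; rewrite !gt_eqF.
Qed.

Lemma concentrated_variance_le :
  P.-integrable setT (EFin \o (fun x => (X x - \int[P]_y X y) ^+ 2)) /\
  \int[P]_x ((X x - \int[P]_y X y) ^+ 2) <= 10 * c ^+ 2 / b ^+ 2.
Proof.
set m := \int[P]_y X y; have mx0 : `|m - x0| <= 2 * c / b by rewrite -Esub; exact: EX1.2.
have m2 : measurable_fun setT (fun x => (X x - m) ^+ 2).
  by apply: measurable_funX; exact: measurable_funB.
have [||i h] := @Ebound (fun x => (X x - m) ^+ 2) (2 * (2 * c / b) ^+ 2)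
  (2 * (c / a) ^+ 2) 0 _ m2; first by [].
  move=> x; rewrite ger0_norm ?sqr_ge0// /majorant mul0r addr0.
  have p2 : (X x - x0) ^+ 2 <= (c / a) ^+ 2 * G x ^+ 2.
    rewrite -[_ ^+ 2]real_normK ?num_real// -[G x ^+ 2]real_normK ?num_real//.
    by rewrite -exprMn; apply: lerXn2r; rewrite ?nnegrE ?(mulr_ge0 ca0)//; exact: X1.
  have q2 : (m - x0) ^+ 2 <= (2 * c / b) ^+ 2.
    rewrite -[_ ^+ 2]real_normK ?num_real// ler_pXn2r ?nnegrE//.
    by rewrite (le_trans _ mx0).
  apply: (@le_trans _ _ (2 * (m - x0) ^+ 2 + 2 * (X x - x0) ^+ 2)).
    by have := sqr_ge0 ((X x - x0) + (m - x0)); nra.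
  by apply: lerD; [rewrite ler_wpM2l|rewrite -mulrA ler_wpM2l].
split=> //; apply: le_trans (ler_norm _) (le_trans h _).
by apply: le_of_eq; field; rewrite !gt_eqF.
Qed.

End first_order.

(** Each statistic is affine in [G] up to a quadratic error; in the product, the
    cross terms are of order three and four in [G], hence small with its fourth
    moment. *)
Lemma concentrated_covariance (X Y : T -> R) (x0 y0 alpha beta : R) :
  measurable_fun setT X -> measurable_fun setT Y ->
  `|alpha| <= c / a -> `|beta| <= c / a ->
  (forall x, `|X x - x0| <= c / a * `|G x|) ->
  (forall x, `|Y x - y0| <= c / a * `|G x|) ->
  (forall x, `|X x - x0 - alpha * G x| <= c / a ^+ 3 * G x ^+ 2) ->
  (forall x, `|Y x - y0 - beta * G x| <= c / a ^+ 3 * G x ^+ 2) ->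
  P.-integrable setT (EFin \o (fun x => X x * Y x)) /\
  `|\int[P]_x (X x * Y x) - (\int[P]_x X x) * (\int[P]_x Y x)
     - alpha * beta * (a ^+ 2 / b ^+ 2)| <= 30 * c ^+ 2 / (a * b ^+ 3).
Proof.
move=> mX mY alphac betac X1 Y1 X2 Y2.
have [iX iY] := (integrable_concentrated mX X1, integrable_concentrated mY Y1).
have ca0 : 0 <= c / a by rewrite divr_ge0// ltW.
have ca30 : 0 <= c / a ^+ 3 by rewrite divr_ge0// exprn_ge0// ltW.
pose U x := X x - x0 - alpha * G x; pose V x := Y x - y0 - beta * G x.
have mU : measurable_fun setT U.
  by apply: measurable_funB; [exact: measurable_funB|exact: measurable_funM].
have mV : measurable_fun setT V.
  by apply: measurable_funB; [exact: measurable_funB|exact: measurable_funM].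
have EU (W : T -> R) : measurable_fun setT W -> (forall x, `|W x| <= c / a ^+ 3 * G x ^+ 2) ->
    P.-integrable setT (EFin \o W) /\ `|\int[P]_x W x| <= c / (a * b ^+ 2).
  move=> mW W2; have [|i h] := @Ebound W 0 (c / a ^+ 3) 0 (lexx _) mW.
    by move=> x; rewrite /majorant add0r mul0r addr0.
  split=> //; apply: le_trans h _; apply: le_of_eq.
  by field; rewrite !gt_eqF.
have [iU EU2] := EU U mU X2; have [iV EV2] := EU V mV Y2.
pose W x := alpha * (G x * V x) + beta * (G x * U x) + U x * V x.
have mW : measurable_fun setT W.
  apply: measurable_funD; last exact: measurable_funM.
  by apply: measurable_funD; apply: measurable_funM => //; exact: measurable_funM.
have [||iW EW] := @Ebound W 0 (2 * c ^+ 2 / (a ^+ 3 * b))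
  (2 * c ^+ 2 * b / a ^+ 5 + c ^+ 2 / a ^+ 6) _ mW.
- have c20 : 0 <= c ^+ 2 by exact: sqr_ge0.
  have h p : 0 <= (a ^+ p)^-1 by rewrite invr_ge0 exprn_ge0// ltW.
  apply: addr_ge0; apply: mulr_ge0 => //; apply: mulr_ge0; last exact: ltW.
  exact: mulr_ge0.
- move=> x; have X2x := X2 x; have Y2x := Y2 x; rewrite -/(U x) in X2x; rewrite -/(V x) in Y2x.
  have cross (al w : R) : `|al| <= c / a -> `|w| <= c / a ^+ 3 * G x ^+ 2 ->
      `|al * (G x * w)| <= c ^+ 2 / a ^+ 4 * `|G x| ^+ 3.
    move=> alc wc; rewrite !normrM.
    apply: (@le_trans _ _ (c / a * (`|G x| * (c / a ^+ 3 * G x ^+ 2)))).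
      by apply: ler_pM; rewrite ?mulr_ge0//; exact: ler_wpM2l.
    rewrite -[G x ^+ 2]real_normK ?num_real//.
    by apply: le_of_eq; field; rewrite gt_eqF.
  have h1 := cross _ _ alphac Y2x; have h2 := cross _ _ betac X2x.
  have h3 : `|U x * V x| <= c ^+ 2 / a ^+ 6 * G x ^+ 4.
    rewrite normrM; apply: le_trans (ler_pM _ _ X2x Y2x) _ => //.
    by apply: le_of_eq; field; rewrite gt_eqF.
  apply: (le_trans (ler_normD _ _)); apply: (le_trans (lerD (ler_normD _ _) (lexx _))).
  apply: (le_trans (lerD (lerD h1 h2) h3)).
  have c2a : 0 <= c ^+ 2 / a ^+ 4 by rewrite divr_ge0 ?exprn_ge0// ltW.
  have := ler_wpM2l c2a (cube_bound x) => h4.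
  apply: (le_trans (lerD (lerD h4 h4) (lexx _))).
  by rewrite /majorant; apply: le_of_eq; field; rewrite !gt_eqF.
(* [W] collects the terms of order at least three in [G]. *)
have XYE x : X x * Y x = alpha * beta * G x ^+ 2 + W x + (x0 * Y x + (y0 * X x + - (x0 * y0))).
  by rewrite /W /U /V; ring.
have i1 : P.-integrable setT (EFin \o (fun x => x0 * Y x + (y0 * X x + - (x0 * y0)))).
  by apply: intD; [exact: intZ|apply: intD => //; exact: intZ].
have i2 : P.-integrable setT (EFin \o (fun x => alpha * beta * G x ^+ 2 + W x)).
  by apply: intD => //; exact: intZ.
split.
  by rewrite (funext XYE); exact: intD.
have EXU : \int[P]_x U x = \int[P]_x X x - x0.
  rewrite /U RintegralB//; last exact: intZ.
    by rewrite RintegralZl// EG1 mulr0 subr0 RintegralB// Ecst.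
  exact: (intD iX (intC (- x0))).
have EYV : \int[P]_x V x = \int[P]_x Y x - y0.
  rewrite /V RintegralB//; last exact: intZ.
    by rewrite RintegralZl// EG1 mulr0 subr0 RintegralB// Ecst.
  exact: (intD iY (intC (- y0))).
have i3 : P.-integrable setT (EFin \o (fun x => y0 * X x + - (x0 * y0))).
  by apply: intD => //; exact: intZ.
have -> : \int[P]_x (X x * Y x) = alpha * beta * (a ^+ 2 / b ^+ 2) + \int[P]_x W x +
    (x0 * \int[P]_x Y x + (y0 * \int[P]_x X x + - (x0 * y0))).
  rewrite (funext XYE) RintegralD// RintegralD//; last exact: intZ.
  rewrite RintegralZl// EG2; congr (_ + _).
  rewrite RintegralD//; last exact: intZ.
  rewrite RintegralZl//; congr (_ + _).
  by rewrite RintegralD//; [rewrite RintegralZl// Ecst|exact: intZ].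
set A := _ * _ * _; set w := \int[P]_x W x; set ex := \int[P]_x X x; set ey := \int[P]_x Y x.
have -> : A + w + (x0 * ey + (y0 * ex - x0 * y0)) - ex * ey - A =
   w - (ex - x0) * (ey - y0) by ring.
rewrite -EXU -EYV; apply: (le_trans (ler_normB _ _)).
apply: (@le_trans _ _ (20 * c ^+ 2 / (a * b ^+ 3) + 10 * c ^+ 2 / (a ^+ 2 * b ^+ 4))).
  have : `|(\int[P]_x U x) * (\int[P]_x V x)| <= c ^+ 2 / (a ^+ 2 * b ^+ 4).
    rewrite normrM; apply: (le_trans (ler_pM _ _ EU2 EV2)) => //.
    by apply: le_of_eq; field; rewrite !gt_eqF.
  move=> h; apply: (le_trans (lerD EW h)).
  by apply: le_of_eq; field; rewrite !gt_eqF.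
have -> : 10 * c ^+ 2 / (a ^+ 2 * b ^+ 4) = 10 * c ^+ 2 / (a * b ^+ 3) * (a * b)^-1.
  by field; rewrite !gt_eqF.
have ab3 : 0 <= 10 * c ^+ 2 / (a * b ^+ 3).
  apply: divr_ge0; apply: mulr_ge0 => //; [exact: sqr_ge0|exact: ltW|].
  by rewrite exprn_ge0// ltW.
have : 10 * c ^+ 2 / (a * b ^+ 3) * (a * b)^-1 <= 10 * c ^+ 2 / (a * b ^+ 3).
  by rewrite ler_piMr// invf_le1// (lt_le_trans ltr01).
by lra.
Qed.

End concentrated_variable.

(** * Characteristic functions *)

Section characteristic_function.
Variable R : realType.
Local Notation normc := (@Normc.normc R).

Definition expi (x : R) : R[i] := (cos x +i* sin x)%C.

Lemma expiD (x y : R) : expi (x + y) = expi x * expi y.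
Proof. by rewrite /expi cosD sinD; apply: complex_eqP; rewrite ?ReM ?ImM//= addrC. Qed.

Lemma normc_expi (x : R) : normc (expi x) = 1.
Proof. exact: normc_cos_sin. Qed.

Lemma measurable_expi : measurable_fun [set: R] expi.
Proof.
apply: measurable_fun_complex; apply: continuous_measurable_fun.
  exact: continuous_cos.
exact: continuous_sin.
Qed.

Section one_variable.
Context d (T : measurableType d) (P : probability T R).
Variable X : T -> R.
Hypothesis mX : measurable_fun setT X.

Lemma measurable_expi_comp (t : R) : measurable_fun setT (fun x => expi (t * X x)).
Proof. by apply: (measurableT_comp measurable_expi); exact: measurable_funM. Qed.

Lemma Cintegrable_expi (t : R) : Cintegrable P (fun x => expi (t * X x)).
Proof.
apply: (@Cintegrable_le _ _ _ P _ (fun=> 1)).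
- exact: measurable_expi_comp.
- exact: finite_measure_integrable_cst.
- by move=> x; rewrite normc_expi.
Qed.

Lemma normc_charfun_le1 (t : R) : normc (Cint P (fun x => expi (t * X x))) <= 1.
Proof.
apply: (le_trans (normc_Cint_le (Cintegrable_expi t))).
rewrite (@eq_Rintegral _ _ _ _ _ (fun=> 1)).
  by rewrite Rintegral_cst_probability.
by move=> x _; rewrite normc_expi.
Qed.

Lemma expRN_taylor_bound (y : R) : 0 <= y -> `|expR (- y) - (1 - y)| <= y ^+ 2.
Proof.
move=> y0; have h1 : 1 - y <= expR (- y) by have := expR_ge1Dx (- y).
rewrite ger0_norm ?subr_ge0//.
have y1 : 0 < 1 + y by rewrite ltr_wpDr.
have h2 : expR (- y) <= (1 + y)^-1.
  by rewrite expRN lef_pV2 ?posrE ?expR_gt0// expR_ge1Dx.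
have h3 : (1 + y)^-1 <= 1 - y + y ^+ 2.
  rewrite -(ler_pM2l y1) mulfV ?gt_eqF//.
  have : 0 <= y ^+ 3 by rewrite exprn_ge0.
  by nra.
by lra.
Qed.

(** Both sides are expanded to [1 - t ^ 2 * v / 2], with a third moment as the
    error on the first one and the square of the variance on the second. *)
Lemma charfun_gauss_bound (t v : R) :
  P.-integrable setT (EFin \o X) ->
  P.-integrable setT (EFin \o (fun x => X x ^+ 2)) ->
  P.-integrable setT (EFin \o (fun x => `|X x| ^+ 3)) ->
  \int[P]_x X x = 0 ->
  \int[P]_x (X x ^+ 2) = v ->
  normc (Cint P (fun x => expi (t * X x)) - (expR (- (t ^+ 2 * v / 2)))%:C%C) <=
  2 * `|t| ^+ 3 * \int[P]_x (`|X x| ^+ 3) + t ^+ 4 * v ^+ 2.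
Proof.
move=> i1 i2 i3 EX EX2.
have Ecst (k : R) : \int[P]_x k = k.
  exact: Rintegral_cst_probability.
have iC (k : R) : P.-integrable setT (EFin \o (fun=> k)).
  exact: finite_measure_integrable_cst.
have iZ (k : R) u : P.-integrable setT (EFin \o u) ->
    P.-integrable setT (EFin \o (fun x => k * u x)).
  by move=> iu; exact: (integrableZl measurableT k iu).
have iCos := Cintegrable_Re (Cintegrable_expi t); rewrite /= in iCos.
have iSin := Cintegrable_Im (Cintegrable_expi t); rewrite /= in iSin.
have mtX : measurable_fun setT (fun x => t * X x) by exact: measurable_funM.
have mcos : measurable_fun setT (fun x => cos (t * X x)).
  exact: (measurable_funRe (measurable_expi_comp t)).
have msin : measurable_fun setT (fun x => sin (t * X x)).
  exact: (measurable_funIm (measurable_expi_comp t)).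
have v0 : 0 <= v by rewrite -EX2; apply: Rintegral_ge0 => x _; exact: sqr_ge0.
set M3 := \int[P]_x (`|X x| ^+ 3).
have B3 : \int[P]_x (`|t| ^+ 3 * `|X x| ^+ 3) = `|t| ^+ 3 * M3 by rewrite RintegralZl.
have hcos : `|\int[P]_x cos (t * X x) - (1 - t ^+ 2 * v / 2)| <= `|t| ^+ 3 * M3.
  have i2' := iZ (t ^+ 2 / 2) _ i2.
  rewrite (_ : _ - _ = \int[P]_x (cos (t * X x) - 1 + t ^+ 2 / 2 * X x ^+ 2)).
    rewrite -B3; apply: normr_Rintegral_bound.
    - apply: measurable_funD; first exact: measurable_funB.
      by apply: measurable_funM => //; exact: measurable_funX.
    - exact: iZ.
    - move=> x; have := cos_taylor2_bound (t * X x).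
      by rewrite normrM !exprMn mulrAC.
  rewrite RintegralD//; last exact: (integrableB measurableT iCos (iC 1)).
  rewrite RintegralB// Ecst RintegralZl// EX2; ring.
have hsin : `|\int[P]_x sin (t * X x)| <= `|t| ^+ 3 * M3.
  rewrite (_ : \int[P]_x _ = \int[P]_x (sin (t * X x) - t * X x)); last first.
    by rewrite RintegralB// ?RintegralZl// ?EX ?mulr0 ?subr0//; exact: iZ.
  rewrite -B3; apply: normr_Rintegral_bound.
  - exact: measurable_funB.
  - exact: iZ.
  - move=> x; apply: (le_trans (sub_sin_bound _)); rewrite normrM exprMn.
    by rewrite ler_pdivrMr// ler_peMr ?mulr_ge0 ?exprn_ge0// ler1n.
have y0 : 0 <= t ^+ 2 * v / 2 by rewrite divr_ge0// mulr_ge0// sqr_ge0.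
have hexp := expRN_taylor_bound y0.
apply: (le_trans (normc_le_ReIm _)).
rewrite ReD ImD /= oppr0 addr0.
have -> : 2 * `|t| ^+ 3 * M3 + t ^+ 4 * v ^+ 2 =
  (`|t| ^+ 3 * M3 + t ^+ 4 * v ^+ 2) + `|t| ^+ 3 * M3 by ring.
apply: lerD => //.
rewrite (_ : _ - _ = (\int[P]_x cos (t * X x) - (1 - t ^+ 2 * v / 2)) -
  (expR (- (t ^+ 2 * v / 2)) - (1 - t ^+ 2 * v / 2))); last by ring.
apply: (le_trans (ler_normB _ _)); apply: lerD => //.
apply: (le_trans hexp); rewrite (_ : _ ^+ 2 = t ^+ 4 * v ^+ 2 / 4); last by field.
rewrite ler_pdivrMr// ler_peMr ?ler1n// mulr_ge0 ?sqr_ge0//.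
by rewrite (_ : t ^+ 4 = (t ^+ 2) ^+ 2) ?sqr_ge0// -exprM.
Qed.

End one_variable.
End characteristic_function.

(** * Gaussian laws *)

Section gaussian.
Variable R : realType.
Local Notation Rm := (measurableTypeR R).
Local Notation leb := (@lebesgue_measure R).
Local Notation leb2 := (@lebesgue_measure R \x @lebesgue_measure R)%E.
Local Notation normc := (@Normc.normc R).
Local Notation lebC := (@lebesgueC R).
Variable sigma : R.
Hypothesis sigma0 : 0 < sigma.
Let s : R := (2 * sigma ^+ 2)^-1.
Let s0 : 0 < s. Proof. by rewrite invr_gt0 mulr_gt0// exprn_gt0. Qed.
Local Notation Q := (normal_prob 0 sigma : probability Rm R).
Local Notation rad := (radial_law 0 s).
Let CC (p : Rm * Rm) : R[i] := (p.1 +i* p.2)%C.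

Let mCC : measurable_fun setT CC. Proof. exact: measurable_Complex. Qed.

Let pdfM (x y : R) : normal_pdf 0 sigma x * normal_pdf 0 sigma y =
  radial_weight 0 s (x +i* y)%C / radial_moment 0 s.
Proof.
have sne : sigma != 0 by rewrite gt_eqF.
have -> : radial_moment 0 s = pi / s.
  apply: (@mulfI _ (s ^+ 1)); first by rewrite expr1 gt_eqF.
  by rewrite radial_moment_scaling// radial_moment01 expr1 mulrC divfK// gt_eqF.
rewrite !normal_pdfE// /normal_fun /normal_peak /radial_weight normc_sqr/= expr0 mul1r !subr0.
rewrite mulrACA -expRD -expr2 exprVn sqr_sqrtr; last first.
  by rewrite mulrn_wge0// mulr_ge0 ?sqr_ge0// pi_ge0.
rewrite mulrC; congr (expR _ * _).
  by rewrite /s -[sigma ^+ 2 *+ 2]mulr_natl; field.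
rewrite /s invf_div -[_ *+ 2]mulr_natl; have := pi_gt0 R; move: (pi : R) => p p0.
by field; rewrite sne gt_eqF.
Qed.

Let mpdf : measurable_fun setT (normal_pdf 0 sigma : Rm -> R).
Proof. exact: measurable_normal_pdf. Qed.

Let pdf0 x : 0 <= normal_pdf 0 sigma x. Proof. exact: normal_pdf_ge0. Qed.

Let QE A : measurable A -> Q A = density leb (normal_pdf 0 sigma) A.
Proof. by []. Qed.

(** Two independent Gaussian coordinates form a rotation invariant law of the
    plane, the radial law of index [0]: this is what the characteristic function
    and the moments are deduced from. *)
Lemma ge0_integral_gaussian_plane (f : R[i] -> \bar R) :
  measurable_fun setT f -> (forall z, 0 <= f z)%E ->
  (\int[rad]_z f z = \int[(Q \x Q)%E]_p f (p.1 +i* p.2)%C)%E.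
Proof.
move=> mf f0.
have mfC : measurable_fun setT (fun p : Rm * Rm => f (CC p)) by exact: measurableT_comp.
rewrite (ge0_integral_density (measurable_radial_density 0 s) _ (radial_lawE 0 s0))//; last first.
  by move=> z; exact: radial_density_ge0.
have mg : measurable_fun setT (fun z => f z * (radial_weight 0 s z / radial_moment 0 s)%:E)%E.
  by apply: emeasurable_funM => //; apply/measurable_EFinP; exact: measurable_radial_density.
rewrite ge0_integral_lebesgueC//; last first.
  by move=> z; rewrite mule_ge0// lee_fin radial_density_ge0.
rewrite fubini_tonelli1//=; last 2 first.
- exact: (measurableT_comp mg mCC).
- by move=> p; rewrite mule_ge0// lee_fin radial_density_ge0.
rewrite (@fubini_tonelli1 _ _ _ _ _ Q Q (fun p => f (CC p)))//.
have mF : measurable_fun setT (fubini_F Q (fun p => f (CC p))).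
  exact: measurable_fun_fubini_tonelli_F.
rewrite (ge0_integral_density mpdf pdf0 QE)//; last by move=> x; exact: integral_ge0.
apply: eq_integral => x _; rewrite /fubini_F/=.
have mfx : measurable_fun setT (fun y : Rm => f (x +i* y)%C).
  exact: (measurableT_comp mfC (pair1_measurable x)).
rewrite (ge0_integral_density mpdf pdf0 QE)//.
rewrite muleC -ge0_integralZl//; last 3 first.
- by apply: emeasurable_funM => //; exact/measurable_EFinP.
- by move=> y _; rewrite mule_ge0// lee_fin.
- by rewrite lee_fin.
by apply: eq_integral => y _; rewrite -pdfM EFinM muleCA.
Qed.

Lemma radial_law_gaussian_plane A : measurable A -> rad A = pushforward (Q \x Q)%E CC A.
Proof.
move=> mA; have mCA : measurable (CC @^-1` A) by rewrite -[X in measurable X]setTI; exact: mCC.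
rewrite -[LHS](_ : (\int[rad]_z (\1_A z)%:E)%E = _); last by rewrite integral_indic// setIT.
rewrite ge0_integral_gaussian_plane//; last first.
  by apply/measurable_EFinP; exact: measurable_indic.
transitivity (\int[(Q \x Q)%E]_p (\1_(CC @^-1` A) p)%:E)%E; first by apply: eq_integral.
by rewrite (integral_indic _ measurableT mCA) setIT.
Qed.

Lemma gaussian_marginal A : measurable A -> Q A = pushforward rad (@complex.Re R) A.
Proof.
move=> mA; have mRA : measurable ((@complex.Re R) @^-1` A).
  by rewrite -[X in measurable X]setTI; exact: measurable_Re.
rewrite [RHS]/pushforward radial_law_gaussian_plane// /pushforward.
rewrite (_ : CC @^-1` _ = A `*` setT); last by apply/seteqP; split=> -[x y] //= [].
by rewrite product_measure1E//= probability_setT mule1.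
Qed.

Lemma radial_law_rotation w : normc w = 1 -> w != -1 ->
  forall A, measurable A -> rad A = pushforward rad (fun z => w * z) A.
Proof.
move=> w1 wN1 A mA; rewrite /pushforward.
have mw : measurable_fun setT (fun z => w * z) by exact: measurable_funCM.
have mwA : measurable ((fun z => w * z) @^-1` A).
  by rewrite -[X in measurable X]setTI; exact: mw.
have E B : measurable B -> rad B =
    (\int[lebC]_z ((\1_B z)%:E * (radial_weight 0 s z / radial_moment 0 s)%:E))%E.
  move=> mB; transitivity (\int[rad]_z (\1_B z)%:E)%E.
    by rewrite integral_indic// setIT.
  apply: (ge0_integral_density (measurable_radial_density 0 s) _ (radial_lawE 0 s0)) => //.
    by move=> z; exact: radial_density_ge0.
  by apply/measurable_EFinP; exact: measurable_indic.
rewrite (E _ mA) (E _ mwA) -(@ge0_integral_lebesgueC_rotation _ w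
  (fun z => (\1_A z)%:E * (radial_weight 0 s z / radial_moment 0 s)%:E)%E w1 wN1).
- apply: eq_integral => z _; congr (_ * _)%E.
  by rewrite /radial_weight Normc.normcM w1 mul1r.
- apply: emeasurable_funM; apply/measurable_EFinP; first exact: measurable_indic.
  exact: measurable_radial_density.
- by move=> z; rewrite mule_ge0 ?lee_fin ?radial_density_ge0.
Qed.

Let charfun (t : R) : R[i] := Cint Q (fun x => expi (t * x)).

Let mRe : measurable_fun setT (@complex.Re R). Proof. exact: measurable_Re. Qed.
Let mIm : measurable_fun setT (@complex.Im R). Proof. exact: measurable_Im. Qed.
Let mid : measurable_fun setT (fun x : Rm => x : R). Proof. exact: measurable_id. Qed.

(** The rotation by [- pi / 4] turns [sqrt 2 * Re z] into [Re z + Im z], whose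
    terms are independent with the same law. *)
Lemma gaussian_charfun_doubling t : charfun (Num.sqrt 2 * t) = charfun t ^+ 2.
Proof.
pose r : R := (Num.sqrt 2)^-1; pose w : R[i] := (r -i* r)%C.
have r2 : Num.sqrt 2 * r = 1 by rewrite mulfV// gt_eqF// sqrtr_gt0.
have rr : r ^+ 2 = 2^-1 by rewrite exprVn sqr_sqrtr.
have w1 : normc w = 1 by rewrite /= sqrrN rr (_ : 2^-1 + 2^-1 = 1) ?sqrtr1//; lra.
have wN1 : w != -1.
  rewrite eq_complex/= negb_and orbC oppr0 eqr_oppLR oppr0.
  by rewrite gt_eqF// invr_gt0 sqrtr_gt0.
have mF (t' : R) : measurable_fun setT (fun z => expi (t' * complex.Re z)).
  exact: measurable_expi_comp.
have iF (t' : R) : Cintegrable rad (fun z => expi (t' * complex.Re z)).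
  exact: Cintegrable_expi.
have [E1 _] := @Cint_pushforward R _ _ _ Rm rad Q (@complex.Re R) mRe
  gaussian_marginal (fun x : Rm => expi (Num.sqrt 2 * t * x)) (iF (Num.sqrt 2 * t))
  (measurable_expi_comp mid (Num.sqrt 2 * t)).
rewrite /charfun E1.
have mw : measurable_fun setT (fun z => w * z) by exact: measurable_funCM.
have iFw : Cintegrable rad ((fun z => expi (Num.sqrt 2 * t * complex.Re z)) \o (fun z => w * z)).
  exact: (Cintegrable_expi _ (measurableT_comp mRe mw)).
have [E2 _] := Cint_pushforward mw (radial_law_rotation w1 wN1) iFw (mF (Num.sqrt 2 * t)).
rewrite [LHS]E2.
pose F (z : R[i]) := expi (t * complex.Re z) * expi (t * complex.Im z).
rewrite (eq_Cint rad (G := F)); last first.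
  move=> z; rewrite /F -expiD /= ReM /=; congr expi.
  transitivity (Num.sqrt 2 * r * t * (complex.Re z + complex.Im z)); first by ring.
  by rewrite r2; ring.
have mF' : measurable_fun setT F.
  by apply: measurable_funCM; apply: measurable_expi_comp.
have iQ := Cintegrable_expi Q mid t.
have iQQ := Cintegrable_prod iQ iQ.
have [E3 _] := Cint_pushforward mCC radial_law_gaussian_plane iQQ mF'.
by rewrite E3 expr2 -(Cint_prod iQ iQ).
Qed.

(** Multiplication by [i] maps the coordinates [(Re z, Im z)] to
    [(- Im z, Re z)]: the mean of each is its own opposite, and the second moment
    is half of that of [|z|]. *)
Lemma gaussian_moments :
  [/\ Q.-integrable setT (EFin \o (fun x => x : R)),
      Q.-integrable setT (EFin \o (fun x : R => x ^+ 2)),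
      Q.-integrable setT (EFin \o (fun x : R => `|x| ^+ 3)),
      \int[Q]_x (x : R) = 0 & \int[Q]_x (x ^+ 2 : R) = sigma ^+ 2].
Proof.
have ipoly (f : R[i] -> R) : measurable_fun setT f ->
    (forall z, `|f z| <= 1 + (normc z ^+ 2) ^+ 2) -> rad.-integrable setT (EFin \o f).
  move=> mf fz; apply: (integrable_density (measurable_radial_density 0 s) _ (radial_lawE 0 s0)) => //.
    by move=> z; exact: radial_density_ge0.
  have i0 := integrableZl measurableT (radial_moment 0 s)^-1 (integrable_radial_weight 0 s0).
  have i2 := integrableZl measurableT (radial_moment 0 s)^-1 (integrable_radial_weight 2 s0).
  apply: (integrable_bound _ (integrableD measurableT i0 i2)).
    by apply: measurable_funM => //; exact: measurable_radial_density.
  move=> z; rewrite normrM (ger0_norm (radial_density_ge0 0 z s0)).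
  apply: (le_trans (ler_wpM2r (radial_density_ge0 0 z s0) (fz z))).
  by rewrite /radial_weight expr0; apply: le_of_eq; ring.
have transfer (f : R -> R) : measurable_fun setT (f : Rm -> R) ->
    (forall x, `|f x| <= 1 + (x ^+ 2) ^+ 2) ->
    Q.-integrable setT (EFin \o f) /\ \int[Q]_x f x = \int[rad]_z f (complex.Re z).
  move=> mf fx.
  have mfR : measurable_fun setT (fun z => f (complex.Re z)).
    exact: (measurableT_comp (mf : measurable_fun setT (f : Rm -> R)) mRe).
  have ifR : rad.-integrable setT (EFin \o (fun z => f (complex.Re z))).
    apply: ipoly => // z; apply: (le_trans (fx _)); rewrite lerD2l.
    rewrite lerXn2r ?nnegrE ?sqr_ge0// normc_sqr lerDl sqr_ge0//.
  exact: (@Rintegral_pushforward R _ _ _ Rm rad Q (@complex.Re R) mRe gaussian_marginal f mf ifR).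
have b2 (x : R) : `|x ^+ 2| <= 1 + (x ^+ 2) ^+ 2.
  by rewrite ger0_norm ?sqr_ge0//; have := sqr_ge0 (x ^+ 2 - 1); nra.
have b1 (x : R) : `|x| <= 1 + (x ^+ 2) ^+ 2.
  have := b2 x; rewrite ger0_norm ?sqr_ge0// => h.
  by rewrite ler_norml; apply/andP; split; nra.
have b3 (x : R) : `| `|x| ^+ 3 | <= 1 + (x ^+ 2) ^+ 2.
  rewrite ger0_norm ?exprn_ge0// -[x ^+ 2]real_normK ?num_real//.
  set y := `|x|; have y0 : 0 <= y by exact: normr_ge0.
  have := sqr_ge0 (y - 1); have := sqr_ge0 (y ^+ 2 - y); have := sqr_ge0 (y ^+ 2 - 1).
  by have : 0 <= y ^+ 3; [rewrite exprn_ge0|nra].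
have m1 : measurable_fun setT (fun x : Rm => x : R) by [].
have m2 : measurable_fun setT (fun x : Rm => (x : R) ^+ 2) by exact: measurable_funX.
have m3 : measurable_fun setT (fun x : Rm => `|x : R| ^+ 3).
  by apply: (@measurable_funX _ _ _ _ (fun x : R => `|x|) 3); exact: normr_measurable.
have [i1 E1] := transfer _ m1 b1; have [i2 E2] := transfer _ m2 b2.
have [i3 _] := transfer _ m3 b3.
have rotI (f : R[i] -> R) : measurable_fun setT f ->
    (forall z, `|f z| <= 1 + (normc z ^+ 2) ^+ 2) ->
    \int[rad]_z f z = \int[rad]_z f ('i%C * z).
  move=> mf fz; have w1 : normc 'i%C = 1 by rewrite /= expr0n expr1n add0r sqrtr1.
  have wN1 : 'i%C != -1 :> R[i] by rewrite eq_complex/= [0 == _]eq_sym oppr_eq0 oner_eq0.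
  have mw : measurable_fun setT (fun z : R[i] => 'i%C * z) by exact: measurable_funCM.
  have iw : rad.-integrable setT (EFin \o (fun z => f ('i%C * z))).
    apply: ipoly; first exact: (measurableT_comp mf mw).
    by move=> z; rewrite (le_trans (fz _))// Normc.normcM w1 mul1r.
  exact: (Rintegral_pushforward mw (radial_law_rotation w1 wN1) mf iw).2.
have bRe (z : R[i]) : `|complex.Re z| <= 1 + (normc z ^+ 2) ^+ 2.
  by rewrite (le_trans (normr_Re_le z))// (le_trans _ (b1 _))// ler_norm.
have bIm (z : R[i]) : `|complex.Im z| <= 1 + (normc z ^+ 2) ^+ 2.
  by rewrite (le_trans (normr_Im_le z))// (le_trans _ (b1 _))// ler_norm.
split=> //.
- rewrite E1; have EN : \int[rad]_z complex.Im z = \int[rad]_z complex.Re z.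
    rewrite (rotI _ mIm bIm); apply: eq_Rintegral => z _.
    by rewrite ImM/= mul0r add0r mul1r.
  have : \int[rad]_z complex.Re z = - \int[rad]_z complex.Im z.
    rewrite (rotI _ mRe bRe) -[RHS]mulN1r -RintegralZl//; last exact: ipoly.
    by apply: eq_Rintegral => z _; rewrite ReM/= mul0r mul1r sub0r mulN1r.
  by rewrite EN => h; lra.
- rewrite E2; have nR2 (z : R[i]) : `|complex.Re z ^+ 2| <= 1 + (normc z ^+ 2) ^+ 2.
    apply: le_trans (b2 (normc z)); rewrite normc_sqr !ger0_norm ?addr_ge0 ?sqr_ge0//.
    by rewrite lerDl sqr_ge0.
  have nI2 (z : R[i]) : `|complex.Im z ^+ 2| <= 1 + (normc z ^+ 2) ^+ 2.
    apply: le_trans (b2 (normc z)); rewrite normc_sqr !ger0_norm ?addr_ge0 ?sqr_ge0//.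
    by rewrite lerDr sqr_ge0.
  have mR2 : measurable_fun setT (fun z : R[i] => complex.Re z ^+ 2) by exact: measurable_funX.
  have mI2 : measurable_fun setT (fun z : R[i] => complex.Im z ^+ 2) by exact: measurable_funX.
  have EI : \int[rad]_z (complex.Im z ^+ 2) = \int[rad]_z (complex.Re z ^+ 2).
    rewrite (rotI _ mI2 nI2); apply: eq_Rintegral => z _.
    by rewrite ImM/= mul0r add0r mul1r.
  have : \int[rad]_z (complex.Re z ^+ 2 + complex.Im z ^+ 2) = 2 * sigma ^+ 2.
    rewrite Rintegral_radial_law//; last exact: measurable_funD.
    transitivity ((radial_moment 0 s)^-1 * radial_moment 1 s).
      rewrite /radial_moment -RintegralZl//; last exact: integrable_radial_weight.
      by apply: eq_Rintegral => z _; rewrite /radial_weight -normc_sqr; ring.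
    rewrite radial_momentSs// div1r mulrCA mulVf ?mulr1 /s ?invrK//.
    by rewrite gt_eqF// radial_moment_gt0.
  by rewrite RintegralD ?EI; [lra|by []|exact: ipoly|exact: ipoly].
Qed.

End gaussian.

Section gaussian_charfun.
Variable R : realType.
Local Notation Rm := (measurableTypeR R).
Local Notation normc := (@Normc.normc R).

(** Both sides satisfy [u (sqrt 2 * t) = u t ^ 2] and differ by [O(t ^ 3)] at the
    origin. Iterating [n] times doubles the difference [n] times, while the
    argument is divided by [2 ^ (n / 2)]. *)
Lemma gaussian_charfun (sigma t : R) : 0 < sigma ->
  Cint (normal_prob 0 sigma : probability Rm R) (fun x : Rm => expi (t * x)) =
  (expR (- (t ^+ 2 * sigma ^+ 2 / 2)))%:C%C.
Proof.
move=> s0; set Q := (normal_prob 0 sigma : probability Rm R).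
pose psi (t : R) := Cint Q (fun x : Rm => expi (t * x)).
pose g (t : R) : R[i] := (expR (- (t ^+ 2 * sigma ^+ 2 / 2)))%:C%C.
pose D (t : R) := normc (psi t - g t).
rewrite -[LHS]/(psi t) -[RHS]/(g t).
have mid : measurable_fun setT (fun x : Rm => x : R) by [].
have psi1 u : normc (psi u) <= 1 by exact: normc_charfun_le1.
have g1 u : normc (g u) <= 1.
  rewrite normc_realC ger0_norm ?expR_ge0// -expR0 ler_expR oppr_le0.
  by rewrite divr_ge0// mulr_ge0// sqr_ge0.
have gD u : g (Num.sqrt 2 * u) = g u ^+ 2.
  rewrite /g -rmorphXn/= -expRM_natl; congr (expR _)%:C%C.
  by rewrite exprMn sqr_sqrtr// mulr_natl; field.
have DD u : D (Num.sqrt 2 * u) <= 2 * D u.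
  rewrite /D /psi (gaussian_charfun_doubling s0) gD -/(psi u) subr_sqr Normc.normcM.
  rewrite mulrC ler_wpM2r ?normc_ge0// (le_trans (normcD_le _ _))//.
  by rewrite -[leRHS]/(1 + 1); apply: lerD.
pose r : R := (Num.sqrt 2)^-1.
have r2 : 2 * r ^+ 2 = 1 by rewrite exprVn sqr_sqrtr// mulfV.
have r0 : 0 < r by rewrite invr_gt0 sqrtr_gt0.
have r1 : r < 1 by have : r ^+ 2 < 1; [lra|rewrite expr_lt1// ltW].
have Dn n : D t <= 2 ^+ n * D (r ^+ n * t).
  elim: n => [|n ih]; first by rewrite !expr0 !mul1r.
  apply: (le_trans ih); rewrite exprSr -mulrA ler_wpM2l ?exprn_ge0//.
  by apply: le_trans (DD _); rewrite exprS !mulrA divff ?mul1r.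
have [i1 i2 i3 E1 E2] := gaussian_moments s0.
set M := \int[Q]_x (`|x : R| ^+ 3).
pose C := 2 * `|t| ^+ 3 * M + t ^+ 4 * (sigma ^+ 2) ^+ 2.
have M0 : 0 <= M by apply: Rintegral_ge0 => x _; rewrite exprn_ge0.
have Dr n : D t <= C * r ^+ n.
  apply: (le_trans (Dn n)).
  have := charfun_gauss_bound mid (r ^+ n * t) i1 i2 i3 E1 E2; rewrite -/M => h.
  have p2 : 0 <= (2 : R) ^+ n by rewrite exprn_ge0.
  apply: (le_trans (ler_wpM2l p2 h)).
  have rn0 : 0 < r ^+ n by rewrite exprn_gt0.
  have rn1 : r ^+ n <= 1 by rewrite exprn_ile1// ltW.
  have rn2 : 2 ^+ n * (r ^+ n) ^+ 2 = 1.
    by rewrite -exprM mulnC exprM -exprMn r2 expr1n.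
  rewrite normrM (ger0_norm (ltW rn0)) !exprMn /C; set p := r ^+ n.
  have -> : 2 ^+ n * (2 * (p ^+ 3 * `|t| ^+ 3) * M + p ^+ 4 * t ^+ 4 * (sigma ^+ 2) ^+ 2) =
    (2 ^+ n * p ^+ 2) * (2 * `|t| ^+ 3 * M * p + t ^+ 4 * (sigma ^+ 2) ^+ 2 * p ^+ 2) by ring.
  rewrite rn2 mul1r [leRHS]mulrDl lerD2l ler_wpM2l//.
    by rewrite mulr_ge0 ?sqr_ge0// (_ : t ^+ 4 = (t ^+ 2) ^+ 2) ?sqr_ge0// -exprM.
  by rewrite expr2 ler_piMl// ltW.
have cC : C * r ^+ n @[n --> \oo] --> 0.
  rewrite -[0 in X in _ --> X](mulr0 C); apply: cvgMr.
  by apply: cvg_expr; rewrite ger0_norm// ltW.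
have D0 : D t <= 0.
  rewrite -(cvg_lim _ cC)//; apply: limr_ge; first by apply/cvg_ex; exists 0.
  by near=> n; exact: Dr.
apply/eqP; rewrite -subr_eq0; apply/eqP/Normc.eq0_normc.
by apply/eqP; rewrite eq_le D0 normc_ge0.
Unshelve. all: by end_near. Qed.

Local Notation Qv v := (centered_gaussian v : probability Rm R).

Lemma Rintegral_dirac0 (f : Rm -> R) : measurable_fun setT f ->
  Qv 0 setT = 1%E /\ (Qv 0).-integrable setT (EFin \o f) /\ \int[Qv 0]_x f x = f 0.
Proof.
move=> mf; rewrite /centered_gaussian eqxx; split; first exact: probability_setT.
have mEf : measurable_fun setT (EFin \o f) by exact/measurable_EFinP.
split.
  apply/integrableP; split => //.
  rewrite (@integral_dirac _ _ (0 : Rm) R setT measurableT (fun x => `|(f x)%:E|)%E)//.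
    by rewrite diracT mul1e ltry.
  exact: measurableT_comp.
rewrite /Rintegral (@integral_dirac _ _ (0 : Rm) R setT measurableT (EFin \o f))//.
by rewrite diracT mul1e.
Qed.

Lemma centered_gaussian_charfun (v t : R) : 0 <= v ->
  Cint (Qv v) (fun x : Rm => expi (t * x)) = (expR (- (t ^+ 2 * v / 2)))%:C%C.
Proof.
rewrite le_eqVlt => /predU1P[<-|v0].
  have mid : measurable_fun setT (fun x : Rm => x : R) by [].
  have me := measurable_expi_comp mid t.
  apply: complex_eqP; rewrite /=.
    rewrite (Rintegral_dirac0 (measurable_funRe me)).2.2/= mulr0 cos0.
    by rewrite mulr0 mul0r oppr0 expR0.
  by rewrite (Rintegral_dirac0 (measurable_funIm me)).2.2/= mulr0 sin0.
rewrite /centered_gaussian gt_eqF// gaussian_charfun ?sqrtr_gt0//.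
by rewrite sqr_sqrtr// ltW.
Qed.

Lemma centered_gaussian_variance (v : R) : 0 <= v ->
  (Qv v).-integrable setT (EFin \o (fun x : R => x ^+ 2)) /\
  \int[Qv v]_x (x ^+ 2 : R) = v.
Proof.
rewrite le_eqVlt => /predU1P[<-|v0].
  have m2 : measurable_fun setT (fun x : Rm => (x : R) ^+ 2) by exact: measurable_funX.
  by have [_ [i E]] := Rintegral_dirac0 m2; rewrite E expr0n.
rewrite /centered_gaussian gt_eqF//.
have sv : 0 < Num.sqrt v by rewrite sqrtr_gt0.
by have [_ i2 _ _ ->] := gaussian_moments sv; rewrite sqr_sqrtr// ltW.
Qed.

End gaussian_charfun.

(** * Polynomial and trigonometric approximation *)

Section weierstrass.
Variable R : realType.
Implicit Types (F : R -> R) (x : R).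

Lemma bolzano_weierstrass01 (u : nat -> R) : (forall n, 0 <= u n <= 1) ->
  exists (f : nat -> nat) (l : R), increasing_seq f /\ u \o f @ \oo --> l.
Proof.
move=> u01; have [|f fi cf] := @bolzano_weierstrass R u.
  exists 1; split; rewrite ?num_real// => y y1 n _ /=.
  by have /andP[u0 u1] := u01 n; rewrite ger0_norm// (le_trans u1)// ltW.
by exists f, (limn (u \o f)).
Qed.

Lemma uniform_continuity01 F (eta : R) : continuous F -> 0 < eta ->
  exists2 delta, 0 < delta & forall x y, 0 <= x <= 1 -> 0 <= y <= 1 ->
    `|x - y| < delta -> `|F x - F y| < eta.
Proof.
move=> cF eta0; apply: contrapT => noD.
have bad (n : nat) : exists p : R * R, [/\ 0 <= p.1 <= 1, 0 <= p.2 <= 1,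
    `|p.1 - p.2| < n.+1%:R^-1 & eta <= `|F p.1 - F p.2| ].
  apply: contrapT => nop; apply: noD; exists n.+1%:R^-1; first by rewrite invr_gt0.
  move=> x y x01 y01 xy; rewrite ltNge; apply/negP => Fxy.
  by apply: nop; exists (x, y).
have {bad} [p hp] := choice bad.
have [|f [l [fi cl]]] := @bolzano_weierstrass01 (fun n => (p n).1).
  by move=> n; have [] := hp n.
have fn n : (n <= f n)%N.
  elim: n => // n ih; apply: (leq_ltn_trans ih).
  by have := leW_mono fi n n.+1; rewrite !ltEnat/= ltnSn.
have cd : (p (f n)).1 - (p (f n)).2 @[n --> \oo] --> 0.
  apply/norm_cvg0P; apply: (@squeeze_cvgr _ _ _ _ (cst 0) (fun n : nat => n.+1%:R^-1)).
  - near=> n; rewrite normr_ge0/=; have [_ _ h _] := hp (f n).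
    apply: (le_trans (ltW h)); rewrite lef_pV2 ?posrE// ler_nat ltnS; exact: fn.
  - exact: cvg_cst.
  - exact: cvg_harmonic.
have cl2 : (p (f n)).2 @[n --> \oo] --> l.
  rewrite (_ : (fun n => _) = (fun n => (p (f n)).1 - ((p (f n)).1 - (p (f n)).2))).
    by rewrite -[l in X in _ --> X]subr0; exact: cvgB.
  by apply/funext => n; rewrite opprB addrC subrK.
have cF0 : F (p (f n)).1 - F (p (f n)).2 @[n --> \oo] --> F l - F l.
  by apply: cvgB; [apply: (cvg_comp _ _ cl (cF l))|apply: (cvg_comp _ _ cl2 (cF l))].
rewrite subrr in cF0; move/cvgr0_norm_lt : cF0 => /(_ _ eta0).
move=> [n _ /(_ n (leqnn n))] /= h.
by have [_ _ _] := hp (f n); rewrite leNgt h.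
Unshelve. all: by end_near. Qed.

(** [walk n f j] is the polynomial in [x] giving the expectation of [f] at the
    position reached from [j] after [n] independent steps, each of them [+1]
    with probability [x] and [0] otherwise; for [j = 0] it is the Bernstein
    polynomial. *)
Fixpoint walk (n : nat) (f : nat -> R) (j : nat) : {poly R} :=
  if n is n'.+1 then 'X * walk n' f j.+1 + (1 - 'X) * walk n' f j else (f j)%:P.

Lemma walk_horner n (f : nat -> R) j x :
  (walk n.+1 f j).[x] = x * (walk n f j.+1).[x] + (1 - x) * (walk n f j).[x].
Proof. by rewrite /= !hornerE. Qed.

Lemma walk_le n (f g : nat -> R) j x : 0 <= x <= 1 ->
  (forall k, f k <= g k) -> (walk n f j).[x] <= (walk n g j).[x].
Proof.
move=> /andP[x0 x1] fg; elim: n j => [|n ih] j; first by rewrite /= !hornerC.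
by rewrite !walk_horner lerD// ler_wpM2l// subr_ge0.
Qed.

Lemma walk_affine n (f : nat -> R) (c e : R) j x :
  (walk n (fun k => c + e * f k) j).[x] = c + e * (walk n f j).[x].
Proof.
elim: n j => [|n ih] j; first by rewrite /= !hornerC.
by rewrite !walk_horner !ih; ring.
Qed.

(** Squared bias plus the variance [n * x * (1 - x)] of the number of steps. *)
Lemma walk_sqr n (a : R) j x :
  (walk n (fun k => (k%:R - a) ^+ 2) j).[x] =
  (j%:R + n%:R * x - a) ^+ 2 + n%:R * x * (1 - x).
Proof.
elim: n j => [|n ih] j; first by rewrite /= hornerC; ring.
by rewrite walk_horner !ih -!natr1; ring.
Qed.

(** Bernstein's proof: [|F x - F y| <= eta / 2 + C * (x - y) ^ 2] for a large [C]
    by uniform continuity, and the average of the right-hand side over a walk of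
    [n] steps is at most [eta / 2 + C / n]. *)
Lemma weierstrass01 F (eta : R) : continuous F -> 0 < eta ->
  exists p : {poly R}, forall x, 0 <= x <= 1 -> `|F x - p.[x]| <= eta.
Proof.
move=> cF eta0; have eta20 : 0 < eta / 2 by rewrite divr_gt0.
have [delta d0 hd] := uniform_continuity01 cF eta20.
have [|B0 _ hB0] := @EVT_max R F 0 1 ler01; first exact: continuous_subspaceT.
have [|B1 _ hB1] := @EVT_min R F 0 1 ler01; first exact: continuous_subspaceT.
pose B := F B0 - F B1.
have FB x y : 0 <= x <= 1 -> 0 <= y <= 1 -> `|F x - F y| <= B.
  move=> x01 y01; rewrite /B ler_norml.
  have h0 := hB0 x; have h1 := hB0 y; have h2 := hB1 x; have h3 := hB1 y.
  rewrite !in_itv/= in h0 h1 h2 h3.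
  have := (h0 x01); have := (h1 y01); have := (h2 x01); have := (h3 y01).
  by move=> *; apply/andP; split; lra.
have B_ge0 : 0 <= B.
  by apply: le_trans (FB 0 0 _ _); rewrite ?lexx ?ler01.
pose C := B / delta ^+ 2.
have C0 : 0 <= C by rewrite divr_ge0// exprn_ge0// ltW.
have modulus x y : 0 <= x <= 1 -> 0 <= y <= 1 ->
    `|F x - F y| <= eta / 2 + C * (x - y) ^+ 2.
  move=> x01 y01; have [xy|xy] := ltP `|x - y| delta.
    by rewrite (le_trans (ltW (hd _ _ x01 y01 xy)))// lerDl mulr_ge0// sqr_ge0.
  apply: (le_trans (FB _ _ x01 y01)); rewrite /C.
  have : B <= B / delta ^+ 2 * (x - y) ^+ 2.
    rewrite mulrAC ler_pdivlMr ?exprn_gt0// ler_wpM2l//.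
    by rewrite -[leRHS]real_normK ?num_real// lerXn2r ?nnegrE// ltW.
  by move=> h; lra.
have [n nC] : exists n : nat, C / n.+1%:R <= eta / 2.
  exists (Num.truncn (C / (eta / 2))); rewrite ler_pdivrMr// mulrC -ler_pdivrMr//.
  exact: ltW (truncnS_gt _).
pose N : R := n.+1%:R; have N0 : 0 < N by rewrite ltr0n.
(* Frequencies of the walk stay in [[0, 1]]; clamping makes this visible. *)
pose cl y : R := Num.min 1 y.
pose f k := F (cl (k%:R / N)).
exists (walk n.+1 f 0) => x x01; have /andP[x0 x1] := x01.
have cl01 k : 0 <= cl (k%:R / N) <= 1.
  by rewrite /cl ge_min lexx/= le_min ler01/= divr_ge0// ltW.
have dist k : (x - cl (k%:R / N)) ^+ 2 <= N ^- 2 * (k%:R - N * x) ^+ 2.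
  have -> : N ^- 2 * (k%:R - N * x) ^+ 2 = (x - k%:R / N) ^+ 2 by field; rewrite gt_eqF.
  rewrite /cl; set y := k%:R / N; have [y1|y1] := leP 1 y; last by [].
  have : 0 <= (y - 1) * (y + 1 - 2 * x) by apply: mulr_ge0; lra.
  by lra.
have b (k : nat) : `|F x - f k| <= eta / 2 + C * N ^- 2 * (k%:R - N * x) ^+ 2.
  apply: (le_trans (modulus _ _ x01 (cl01 k))); rewrite lerD2l -mulrA ler_wpM2l//.
have W : (walk n.+1 (fun k => eta / 2 + C * N ^- 2 * (k%:R - N * x) ^+ 2) 0).[x] <= eta.
  rewrite walk_affine walk_sqr -/N add0r subrr expr0n add0r.
  have -> : C * N ^- 2 * (N * x * (1 - x)) = C / N * (x * (1 - x)).
    by field; rewrite gt_eqF.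
  have : C / N * (x * (1 - x)) <= eta / 2.
    have CN0 : 0 <= C / N by rewrite divr_ge0// ltW.
    by apply: le_trans nC; apply: ler_piMr => //; nra.
  by move=> h; rewrite [leRHS](splitr eta) lerD2l.
rewrite ler_norml; apply/andP; split.
- have h k : f k <= F x + 1 * (eta / 2 + C * N ^- 2 * (k%:R - N * x) ^+ 2).
    rewrite mul1r; move: (b k); rewrite ler_norml; move: (eta / 2 + _) => E /andP[+ _]; lra.
  have := walk_le n.+1 0 x01 h; rewrite walk_affine mul1r.
  by move: W; move: (walk _ _ _).[x] (walk _ f _).[x] => u w; lra.
- have h k : F x + (-1) * (eta / 2 + C * N ^- 2 * (k%:R - N * x) ^+ 2) <= f k.
    rewrite mulN1r; move: (b k); rewrite ler_norml; move: (eta / 2 + _) => E /andP[_]; lra.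
  have := walk_le n.+1 0 x01 h; rewrite walk_affine mulN1r.
  by move: W; move: (walk _ _ _).[x] (walk _ f _).[x] => u w; lra.
Qed.

(** A bounded continuous function is approximated on a compact interval by a
    polynomial in [sin (omega x)], which is bounded on the whole line. *)
Lemma trigonometric_approximation (h : R -> R) (B L eta : R) :
  continuous h -> (forall x, `|h x| <= B) -> 0 < L -> 0 < eta ->
  exists (p : {poly R}) (omega : R),
    (forall x, `|x| <= L -> `|h x - p.[sin (omega * x)]| <= eta) /\
    (forall x, `|p.[sin (omega * x)]| <= B + eta).
Proof.
move=> ch hB L0 eta0; pose c : R := pi / 4; pose s1 : R := sin c.
have c0 : 0 < c by rewrite divr_gt0// pi_gt0.
have pi2 : c < pi / 2 by rewrite ltr_pM2l ?pi_gt0// ltf_pV2 ?posrE// ltr_nat.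
have s11 : s1 < 1.
  rewrite /s1 -sin_pihalf ltr_sin// in_itv/=; apply/andP; split; lra.
have s10 : 0 < s1 by apply: sin_gt0_pihalf; lra.
(* For [|x| <= L], the angle [omega * x] stays in [[- c, c]] where the sine is
   inverted by the arcsine; clamping extends the inverse continuously. *)
pose cl u : R := Num.max (- s1) (Num.min s1 u).
have clb u : - s1 <= cl u <= s1.
  by rewrite /cl le_max lexx/= ge_max ge_min lexx/= andbT; lra.
have clE u : - s1 <= u <= s1 -> cl u = u.
  move=> /andP[h1 h2]; rewrite /cl; have -> : Num.min s1 u = u by apply/min_idPr.
  exact/max_idPr.
have ccl : continuous cl.
  move=> u; apply: (@continuous_max R R (cst (- s1)) (fun u => Num.min s1 u)).
    exact: cvg_cst.
  by apply: (@continuous_min R R (cst s1) id); [exact: cvg_cst|exact: cvg_id].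
pose F u := h (L / c * asin (cl (2 * u - 1))).
have cF : continuous F.
  move=> u; apply: (@cvg_comp _ _ _ (fun u => L / c * asin (cl (2 * u - 1))) h _ _ _ _ (ch _)).
  apply: cvgMr.
  have ca : {for cl (2 * u - 1), continuous (@asin R)}.
    by apply: continuous_asin; have := clb (2 * u - 1); lra.
  apply: (@cvg_comp _ _ _ (fun u => cl (2 * u - 1)) (@asin R) _ _ _ _ ca).
  apply: (@cvg_comp _ _ _ (fun u => 2 * u - 1) cl _ _ _ _ (ccl _)).
  by apply: cvgB; [apply: cvgMr; exact: cvg_id|exact: cvg_cst].
have [q hq] := weierstrass01 cF eta0.
exists (q \Po (2^-1 *: ('X + 1%:P))), (c / L).
have qE x : (q \Po (2^-1 *: ('X + 1%:P))).[sin (c / L * x)] = q.[(sin (c / L * x) + 1) / 2].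
  by rewrite horner_comp !hornerE mulrC.
have s01 x : 0 <= (sin (c / L * x) + 1) / 2 <= 1.
  by have := sin_geN1 (c / L * x); have := sin_le1 (c / L * x); lra.
split=> x; rewrite qE.
  move=> xL; have := hq _ (s01 x); rewrite /F.
  have -> : 2 * ((sin (c / L * x) + 1) / 2) - 1 = sin (c / L * x) by field.
  have /andP[yl yr] : - c <= c / L * x <= c.
    have cL : 0 <= c / L by apply: divr_ge0; exact: ltW.
    rewrite -ler_norml normrM ger0_norm// mulrAC ler_pdivrMr//.
    by apply: ler_wpM2l => //; exact: ltW.
  have yI : c / L * x \in `[- (pi / 2), pi / 2].
    by rewrite in_itv/= (le_trans _ yl) ?(le_trans yr) ?lerN2 ?(ltW pi2).
  have Nc : - (pi / 2) <= - c by rewrite lerN2 ltW.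
  have cNc : - c <= c by rewrite (le_trans _ (ltW c0))// oppr_le0 ltW.
  have I1 : c \in `[- (pi / 2), pi / 2] by rewrite in_itv/= (ltW pi2) (le_trans Nc).
  have IN1 : - c \in `[- (pi / 2), pi / 2].
    by rewrite in_itv/= Nc (le_trans cNc)// ltW.
  rewrite clE; last first.
    by rewrite /s1 -sinN !leNgt !ltr_sin// -!leNgt yl yr.
  rewrite sinK// (_ : L / c * (c / L * x) = x)//.
  by field; rewrite !gt_eqF.
have := hq _ (s01 x); set a := q.[_]; set b := F _.
have : `|b| <= B by exact: hB.
rewrite !ler_norml; lra.
Qed.

End weierstrass.

(** * Convergence in distribution from characteristic functions *)

Section convergence_from_characteristic_functions.
Variables (R : realType) (d : measure_display) (T : nat -> measurableType d).
Variables (P : forall n, probability (T n) R) (X : forall n, T n -> R).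
Local Notation Rm := (measurableTypeR R).
Arguments X : clear implicits.
Variable Q : probability Rm R.
Hypothesis mX : forall n, measurable_fun setT (X n).
Arguments mX : clear implicits.

(** Boundedness and measurability are part of the predicate so that it is stable
    under linear combinations. *)
Definition test_function_cvg (phi : R -> R) :=
  [/\ measurable_fun setT phi, (exists B, forall x, `|phi x| <= B) &
    \int[P n]_x phi (X n x) @[n --> \oo] --> \int[Q]_(x in setT) phi x].

Let integrable_bounded d' (T' : measurableType d') (mu : probability T' R)
    (f : T' -> R) B : measurable_fun setT f -> (forall x, `|f x| <= B) ->
  mu.-integrable setT (EFin \o f).
Proof.
move=> mf fB; apply: (integrable_bound mf _ fB).
exact: finite_measure_integrable_cst.
Qed.

Let mphiX phi n : measurable_fun setT (phi : R -> R) ->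
  measurable_fun setT (fun x => phi (X n x)).
Proof. by move=> mphi; exact: (measurableT_comp mphi (mX n)). Qed.

Lemma test_function_cvg_lin (a b : R) phi psi :
  test_function_cvg phi -> test_function_cvg psi ->
  test_function_cvg (fun x => a * phi x + b * psi x).
Proof.
move=> [mp [B pB] cp] [mq [C qC] cq].
have ip n := integrable_bounded (P n) (mphiX (n:=n) mp) (fun x => pB (X n x)).
have iq n := integrable_bounded (P n) (mphiX (n:=n) mq) (fun x => qC (X n x)).
have ip' := integrable_bounded Q (mp : measurable_fun setT (phi : Rm -> R)) pB.
have iq' := integrable_bounded Q (mq : measurable_fun setT (psi : Rm -> R)) qC.
split.
- by apply: measurable_funD; exact: measurable_funM.
- exists (`|a| * B + `|b| * C) => x; rewrite (le_trans (ler_normD _ _))// !normrM.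
  by rewrite lerD// ler_wpM2l.
rewrite (_ : \int[Q]_(x in setT) _ =
    a * \int[Q]_(x in setT) phi x + b * \int[Q]_(x in setT) psi x); last first.
  rewrite RintegralD ?RintegralZl//.
    exact: (integrableZl measurableT a ip').
  exact: (integrableZl measurableT b iq').
rewrite (_ : (fun n => _) = fun n => a * \int[P n]_x phi (X n x) + b * \int[P n]_x psi (X n x)).
  by apply: cvgD; apply: cvgMr.
apply/funext => n; rewrite RintegralD ?RintegralZl//.
  exact: (integrableZl measurableT a (ip n)).
exact: (integrableZl measurableT b (iq n)).
Qed.

Lemma eq_test_function_cvg phi psi : phi =1 psi ->
  test_function_cvg phi -> test_function_cvg psi.
Proof. by move=> /funext ->. Qed.

Hypothesis cosP : forall t, \int[P n]_x cos (t * X n x) @[n --> \oo] -->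
  \int[Q]_(x in setT) cos (t * x).
Hypothesis sinP : forall t, \int[P n]_x sin (t * X n x) @[n --> \oo] -->
  \int[Q]_(x in setT) sin (t * x).

(** The product-to-sum formulas lower the exponent [m] by one and shift the
    frequency [t] by [omega]. *)
Lemma test_function_cvg_trigX (omega : R) m t :
  test_function_cvg (fun x => cos (t * x) * sin (omega * x) ^+ m) /\
  test_function_cvg (fun x => sin (t * x) * sin (omega * x) ^+ m).
Proof.
have mt (u : R) : measurable_fun setT (fun x : R => u * x) by exact: measurable_funM.
elim: m t => [|m ih] t.
  split.
    apply: (@eq_test_function_cvg (fun x => cos (t * x))) => [x|]; first by rewrite expr0 mulr1.
    split; last exact: cosP.
      by apply: measurableT_comp => //; apply: continuous_measurable_fun; exact: continuous_cos.
    by exists 1 => x; exact: cos_max.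
  apply: (@eq_test_function_cvg (fun x => sin (t * x))) => [x|]; first by rewrite expr0 mulr1.
  split; last exact: sinP.
    by apply: measurableT_comp => //; apply: continuous_measurable_fun; exact: continuous_sin.
  by exists 1 => x; exact: sin_max.
have [cp sp] := ih (t + omega); have [cm sm] := ih (t - omega).
split.
  apply: eq_test_function_cvg (test_function_cvg_lin (2^-1) (- 2^-1) sp sm) => x /=.
  by rewrite [(t + omega) * x]mulrDl [(t - omega) * x]mulrBl sinD sinB exprS; field.
apply: eq_test_function_cvg (test_function_cvg_lin (2^-1) (- 2^-1) cm cp) => x /=.
by rewrite [(t + omega) * x]mulrDl [(t - omega) * x]mulrBl cosB cosD exprS; field.
Qed.

Lemma test_function_cvg_poly_sin (omega : R) (p : {poly R}) :
  test_function_cvg (fun x => p.[sin (omega * x)]).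
Proof.
have S m : test_function_cvg (fun x => sin (omega * x) ^+ m).
  have [+ _] := test_function_cvg_trigX omega m 0; apply: eq_test_function_cvg => x.
  by rewrite mul0r cos0 mul1r.
elim/poly_ind: p => [|p c ih].
  apply: eq_test_function_cvg (test_function_cvg_lin 0 0 (S 0) (S 0)) => x.
  by rewrite horner0 !mul0r addr0.
suff H (m : nat) : test_function_cvg (fun x => p.[sin (omega * x)] * sin (omega * x) ^+ m).
  apply: eq_test_function_cvg (test_function_cvg_lin 1 c (H 1%N) (S 0%N)) => x.
  by rewrite hornerMXaddC expr1 expr0 mul1r mulr1.
elim/poly_ind: p m {ih c} => [|p c ih] m.
  apply: eq_test_function_cvg (test_function_cvg_lin 0 0 (S 0) (S 0)) => x.
  by rewrite horner0 !mul0r addr0.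
apply: eq_test_function_cvg (test_function_cvg_lin 1 c (ih m.+1) (S m)) => x.
by rewrite hornerMXaddC exprS; ring.
Qed.

Variable V : R.
Hypothesis PV : \forall n \near \oo, (P n).-integrable setT (EFin \o (fun x => X n x ^+ 2)) /\
  \int[P n]_x (X n x ^+ 2) <= V.
Hypothesis QV : Q.-integrable setT (EFin \o (fun x : Rm => (x : R) ^+ 2)) /\
  \int[Q]_(x in setT) (x ^+ 2) <= V.

(** Second moments make the laws tight, so that a bounded continuous function
    may be replaced by its trigonometric approximation on a large interval. *)
Lemma cvg_in_distribution_of_charfun : cvg_in_distribution P X Q.
Proof.
move=> h ch [B0 [_ hB0]]; pose B := `|B0| + 1.
have hB x : `|h x| <= B by apply: hB0 => //; rewrite /B (le_lt_trans (ler_norm _))// ltrDl.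
have B_ge0 : 0 <= B by rewrite addr_ge0.
have mh : measurable_fun setT h by exact: continuous_measurable_fun.
have ihP n := integrable_bounded (P n) (mphiX (n:=n) mh) (fun x => hB (X n x)).
have ihQ := integrable_bounded Q (mh : measurable_fun setT (h : Rm -> R)) hB.
rewrite unlock.
rewrite (_ : (fun n => _) = (fun n => (\int[P n]_x h (X n x))%:E)); last first.
  by apply/funext => n; rewrite fineK//; exact: (integrable_fin_num measurableT (ihP n)).
rewrite (_ : (\int[Q]_w (h w)%:E)%E = (\int[Q]_(x in setT) h x)%:E); last first.
  by rewrite fineK//; exact: (integrable_fin_num measurableT ihQ).
apply: cvg_EFin; first exact: nearW.
apply/cvgrPdist_le => eps eps0.
have [iQ2 EQ2] := QV.
have V0 : 0 <= V by apply: le_trans EQ2; apply: Rintegral_ge0 => x _; exact: sqr_ge0.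
pose eta := eps / 5; have eta0 : 0 < eta by rewrite divr_gt0.
pose K := 2 * B + eta; have K0 : 0 < K by rewrite ltr_wpDl// mulr_ge0.
pose L2 := K * (V + 1) / eta; have L20 : 0 < L2.
  by rewrite divr_gt0// mulr_gt0// ltr_wpDl.
pose L := Num.sqrt L2; have L0 : 0 < L by rewrite sqrtr_gt0.
have LL : L ^+ 2 = L2 by rewrite sqr_sqrtr// ltW.
have [p [omega [hp1 hp2]]] := trigonometric_approximation ch hB L0 eta0.
pose T1 x := p.[sin (omega * x)].
have [mT1 _ cT1] := test_function_cvg_poly_sin omega p.
have pw x : `|h x - T1 x| <= eta + K / L2 * x ^+ 2.
  have [xL|xL] := leP `|x| L.
    by rewrite (le_trans (hp1 _ xL))// lerDl mulr_ge0 ?sqr_ge0// divr_ge0// ltW.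
  have : K <= K / L2 * x ^+ 2.
    rewrite mulrAC ler_pdivlMr// ler_wpM2l ?(ltW K0)// -LL -[leRHS]real_normK ?num_real//.
    by rewrite lerXn2r ?nnegrE// ltW.
  have : `|h x - T1 x| <= K.
    rewrite (le_trans (ler_normB _ _))// /K mulr_natl mulr2n -addrA.
    by apply: lerD => //; exact: hp2.
  by move=> h1 h2; rewrite (le_trans h1)// (le_trans h2)// lerDr ltW.
have gap d' (T' : measurableType d') (mu : probability T' R) (Y : T' -> R) :
    measurable_fun setT Y -> mu.-integrable setT (EFin \o (fun x => Y x ^+ 2)) ->
    \int[mu]_x (Y x ^+ 2) <= V ->
    `|\int[mu]_x h (Y x) - \int[mu]_x T1 (Y x)| <= 2 * eta.
  move=> mY iY2 EY2.
  have mhY : measurable_fun setT (fun x => h (Y x)) by exact: (measurableT_comp mh mY).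
  have mTY : measurable_fun setT (fun x => T1 (Y x)) by exact: (measurableT_comp mT1 mY).
  have ihY := integrable_bounded mu mhY (fun x => hB (Y x)).
  have iTY := integrable_bounded mu mTY (fun x => hp2 (Y x)).
  have iK : mu.-integrable setT (EFin \o (fun x => K / L2 * Y x ^+ 2)).
    exact: (integrableZl measurableT (K / L2) iY2).
  have ie : mu.-integrable setT (EFin \o (fun=> eta)).
    exact: finite_measure_integrable_cst.
  rewrite -RintegralB//.
  apply: (le_trans (normr_Rintegral_bound _ (integrableD measurableT ie iK) (fun x => pw (Y x)))).
    exact: measurable_funB.
  have Ecst : \int[mu]_(x in setT) eta = eta.
    exact: Rintegral_cst_probability.
  rewrite RintegralD// Ecst RintegralZl//.
  rewrite [leRHS]mulr_natl mulr2n lerD2l.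
  apply: (@le_trans _ _ (K / L2 * V)); first by rewrite ler_wpM2l// divr_ge0// ltW.
  have V1 : 0 < V + 1 by rewrite ltr_wpDl.
  have -> : K / L2 * V = eta * (V / (V + 1)) by rewrite /L2; field; rewrite !gt_eqF.
  by rewrite ler_piMr ?(ltW eta0)// ler_pdivrMr// mul1r lerDl.
move/cvgrPdist_le : cT1 => /(_ _ eta0) cT1.
have gQ := gap _ _ Q (fun x : Rm => x : R) (@measurable_id _ _ _) iQ2 EQ2.
near=> n.
have [iPn EPn] : (P n).-integrable setT (EFin \o (fun x => X n x ^+ 2)) /\
  \int[P n]_x (X n x ^+ 2) <= V by near: n; exact: PV.
have gP := gap _ _ (P n) _ (mX n) iPn EPn.
have gT : `|\int[Q]_(x in setT) T1 x - \int[P n]_x T1 (X n x)| <= eta.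
  by near: n; exact: cT1.
move: gQ gP gT.
set qh := \int[Q]_x h x; set qt := \int[Q]_x T1 x.
set ph := \int[P n]_x h (X n x); set pt := \int[P n]_x T1 (X n x) => gQ gP gT.
have -> : qh - ph = (qh - qt) + (qt - pt) - (ph - pt) by ring.
apply: (le_trans (ler_normB _ _)).
apply: (le_trans (lerD (le_trans (ler_normD _ _) (lerD gQ gT)) gP)).
by rewrite /eta; lra.
Unshelve. all: by end_near. Qed.

End convergence_from_characteristic_functions.

(** * Radial profiles *)

Section twice_differentiable_function.
Variable R : realType.
Implicit Types x y z r a b c u e : R.

Lemma mean_value_on (F : R -> R) (b : R) :
  (forall x, `]0, b[%classic x -> derivable F x 1) ->
  forall x y, `]0, b[%classic x -> `]0, b[%classic y ->
  exists z, [/\ `]0, b[%classic z, `|z - y| <= `|x - y| &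
    F x - F y = F^`()%classic z * (x - y)].
Proof.
move=> dF.
have mvt x y : `]0, b[%classic x -> `]0, b[%classic y -> x < y ->
    exists z, [/\ `]0, b[%classic z, x < z < y & F y - F x = F^`()%classic z * (y - x)].
  rewrite /= !in_itv/= => /andP[x0 xb] /andP[y0 yb] xy.
  have Ixy z : x <= z <= y -> `]0, b[%classic z.
    by move=> /andP[h1 h2]; rewrite /= in_itv/=; apply/andP; split;
      [exact: lt_le_trans h1|exact: le_lt_trans yb].
  have [z zxy E] : exists2 z, z \in `]x, y[%R & F y - F x = F^`()%classic z * (y - x).
    apply: (@MVT _ F (F^`()%classic)) => //.
      move=> z; rewrite in_itv/= => /andP[h1 h2].
      have dz : derivable F z 1 by apply/dF/Ixy; rewrite !ltW.
      by apply: DeriveDef => //; rewrite derive1E.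
    apply: derivable_within_continuous => z; rewrite in_itv/= => zxy.
    exact/dF/Ixy.
  move: zxy; rewrite in_itv/= => zxy; exists z; split => //.
  by move: zxy => /andP[h1 h2]; have := Ixy z; rewrite !ltW// /= in_itv; apply.
move=> x y Ix Iy; have [xy|yx|->] := ltgtP x y.
- have [z [Iz /andP[h1 h2] E]] := mvt _ _ Ix Iy xy; exists z; split => //.
    by rewrite ltr0_norm ?subr_lt0// ltr0_norm ?subr_lt0// lerN2 lerD2r ltW.
  by rewrite -opprB E; ring.
- have [z [Iz /andP[h1 h2] E]] := mvt _ _ Iy Ix yx; exists z; split => //.
  by rewrite gtr0_norm ?subr_gt0// gtr0_norm ?subr_gt0// lerD2r ltW.
- by exists y; rewrite !subrr mulr0.
Qed.

Lemma lipschitz_of_derivative (F : R -> R) (b K : R) :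
  (forall x, `]0, b[%classic x -> derivable F x 1) ->
  (forall x, `]0, b[%classic x -> `|F^`()%classic x| <= K) ->
  forall x y, `]0, b[%classic x -> `]0, b[%classic y ->
  `|F x - F y| <= K * `|x - y|.
Proof.
move=> dF FK x y Ix Iy; have [z [Iz _ ->]] := mean_value_on dF Ix Iy.
by rewrite normrM ler_wpM2r// FK.
Qed.

(** Taylor expansion of a profile at radius [a], in the variable [r ^ 2] in which
    the radial laws have explicit moments. There [D a / (2 * a)] is the first
    derivative, and [c / a] and [c / a ^ 3] are the sizes that the first two
    derivatives of a [C^2] function of [r] have near the origin. *)
Definition radial_expansion (c : R) (f D : R -> R) := forall a : R, 0 < a <= 1 ->
  `|D a / (2 * a)| <= c / a /\ forall r : R, 0 < r ->
  `|f r - f a| <= c / a * `|r ^+ 2 - a ^+ 2| /\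
  `|f r - f a - D a / (2 * a) * (r ^+ 2 - a ^+ 2)| <=
    c / a ^+ 3 * (r ^+ 2 - a ^+ 2) ^+ 2.

Variables (f : R -> R) (delta eps : R).
Hypotheses (delta0 : 0 < delta) (eps0 : 0 < eps).
Hypothesis f_C2 : C2_holder_on `]0, 1 + eps[ delta f.
Hypothesis f_bnd : [bounded f r | r in `[0, +oo[ `\` `]0, 1 + eps[].
Let I : set R := `]0, 1 + eps[%classic.

Let I1 x : 0 < x <= 1 -> I x.
Proof. by move=> /andP[x0 x1]; rewrite /I/= in_itv/= x0 (le_lt_trans x1)// ltrDl. Qed.

Let D := f^`()%classic.

(** On a bounded interval a Hoelder continuous second derivative is bounded, by
    comparison with its value at [1]; integrating twice bounds [f'] and [f]. *)
Lemma C2_holder_lipschitz : exists2 c, 0 <= c &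
  [/\ forall x, I x -> `|D x| <= c,
      forall x y, I x -> I y -> `|D x - D y| <= c * `|x - y| &
      forall x, 0 <= x -> `|f x| <= c].
Proof.
have [df dD [C hC]] := f_C2.
have one : I 1 by apply: I1; rewrite ltr01 lexx.
have Idist x : I x -> `|x - 1| <= 1 + eps.
  have key (u e : R) : 0 < u -> u < 1 + e -> 0 < e -> `|u - 1| <= 1 + e.
    by move=> *; rewrite ler_norml; apply/andP; split; lra.
  by rewrite /I/= in_itv/= => /andP[? ?]; exact: key.
pose E := D^`()%classic.
pose M := `|E 1| + `|C| * (1 + eps) `^ delta.
have M0 : 0 <= M by rewrite addr_ge0// mulr_ge0// powR_ge0.
have EM x : I x -> `|E x| <= M.
  move=> Ix; have := hC x 1 Ix one.
  have -> : f^`(2)%classic = E by [].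
  move=> h; rewrite -(subrK (E 1) (E x)) (le_trans (ler_normD _ _))// addrC lerD2l.
  apply: (le_trans h); apply: (@le_trans _ _ (`|C| * `|x - 1| `^ delta)).
    by rewrite ler_wpM2r ?powR_ge0// ler_norm.
  rewrite ler_wpM2l// ge0_ler_powR ?nnegrE ?(ltW delta0)//; last exact: Idist.
  by rewrite addr_ge0// ltW.
have DL x y : I x -> I y -> `|D x - D y| <= M * `|x - y|.
  exact: (lipschitz_of_derivative dD EM).
pose L := `|D 1| + M * (1 + eps).
have L0 : 0 <= L by rewrite addr_ge0// mulr_ge0// addr_ge0// ltW.
have DB x : I x -> `|D x| <= L.
  move=> Ix; rewrite -(subrK (D 1) (D x)) (le_trans (ler_normD _ _))// addrC lerD2l.
  by rewrite (le_trans (DL _ _ Ix one))// ler_wpM2l// Idist.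
have fL x y : I x -> I y -> `|f x - f y| <= L * `|x - y|.
  exact: (lipschitz_of_derivative df DB).
have [B0 [_ hB0]] := f_bnd.
pose B := `|B0| + 1 + `|f 1| + L * (1 + eps).
have Le0 : 0 <= L * (1 + eps) by rewrite mulr_ge0// addr_ge0// ltW.
have B_ge0 : 0 <= B by rewrite /B addr_ge0// addr_ge0// addr_ge0.
have fB x : 0 <= x -> `|f x| <= B.
  move=> x0; have [Ix|nIx] := pselect (I x).
    rewrite -(subrK (f 1) (f x)) (le_trans (ler_normD _ _))//.
    have := fL _ _ Ix one; have : L * `|x - 1| <= L * (1 + eps) by rewrite ler_wpM2l// Idist.
    have : 0 <= `|B0| by [].
    by rewrite /B; lra.
  apply: (@le_trans _ _ (`|B0| + 1)).
    apply: hB0; first by rewrite (le_lt_trans (ler_norm _))// ltrDl.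
    by split; rewrite /= ?in_itv/= ?x0.
  by rewrite /B -[leRHS]addrA lerDl addr_ge0.
exists (M + L + B); first exact: (addr_ge0 (addr_ge0 M0 L0) B_ge0).
split.
- by move=> x Ix; rewrite (le_trans (DB x Ix))//; lra.
- move=> x y Ix Iy; rewrite (le_trans (DL x y Ix Iy))// ler_wpM2r//; lra.
- by move=> x x0; rewrite (le_trans (fB x x0))//; lra.
Qed.

(** Up to [1 + eps] this is the mean value theorem, with a Lipschitz derivative;
    beyond, where [f] is only bounded, [r - a] is at least [eps]. The passage
    from [r - a] to [r ^ 2 - a ^ 2] uses [r + a >= a]. *)
Lemma C2_holder_expansion : exists2 c, 0 <= c & radial_expansion c f D.
Proof.
have [c c0 [Dc DL fc]] := C2_holder_lipschitz.
have [df _ _] := f_C2.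
have fL x y : I x -> I y -> `|f x - f y| <= c * `|x - y|.
  exact: (lipschitz_of_derivative df Dc).
pose e := eps^-1; have e0 : 0 <= e by rewrite invr_ge0 ltW.
have ee : eps * e = 1 by rewrite mulfV// gt_eqF.
pose K := c * (1 + 2 * e + 2 * e ^+ 2 + e).
have K0 : 0 <= K by rewrite mulr_ge0// !addr_ge0// mulr_ge0// exprn_ge0.
have cK : c <= K.
  by rewrite /K ler_peMr// -!addrA lerDl !addr_ge0// mulr_ge0// exprn_ge0.
have step a r : 0 < a <= 1 -> 0 < r ->
    `|f r - f a| <= K * `|r - a| /\ `|f r - f a - D a * (r - a)| <= K * (r - a) ^+ 2.
  move=> a01 r0; have Ia := I1 a01; have /andP[a0 a1] := a01.
  have [rb|br] := ltP r (1 + eps).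
    have Ir : I r by rewrite /I/= in_itv/= r0.
    split; first by rewrite (le_trans (fL _ _ Ir Ia))// ler_wpM2r.
    have [z [zI zra E]] := mean_value_on df Ir Ia.
    rewrite E -mulrBl normrM.
    apply: (@le_trans _ _ (c * `|r - a| * `|r - a|)).
      by rewrite ler_wpM2r// (le_trans (DL _ _ zI Ia))// ler_wpM2l.
    by rewrite -mulrA -expr2 real_normK ?num_real// ler_wpM2r ?sqr_ge0.
  have rae : eps <= r - a by rewrite lerBrDr (le_trans _ br)// addrC lerD2r.
  have ra0 : 0 <= r - a by rewrite (le_trans _ rae)// ltW.
  have fr := fc r (ltW r0); have fa := fc a (ltW a0).
  have fra : `|f r - f a| <= 2 * c by rewrite (le_trans (ler_normB _ _))// mulr_natl mulr2n lerD.
  have y1 : 1 <= (r - a) * e by rewrite -ee ler_wpM2r.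
  have y2 : 1 <= ((r - a) * e) ^+ 2 by rewrite exprn_ege1.
  have g1 : 0 <= c * (r - a) by rewrite mulr_ge0.
  rewrite (ger0_norm ra0); split.
    apply: (le_trans fra); apply: (@le_trans _ _ (2 * c * ((r - a) * e))).
      by rewrite ler_peMr// mulr_ge0.
    have -> : K * (r - a) = 2 * c * ((r - a) * e) + c * (r - a) * (1 + 2 * e ^+ 2 + e).
      by rewrite /K; ring.
    by rewrite lerDl mulr_ge0// !addr_ge0// mulr_ge0// exprn_ge0.
  apply: (le_trans (ler_normB _ _)).
  have h : `|D a * (r - a)| <= c * (r - a).
    by rewrite normrM (ger0_norm ra0) ler_wpM2r// Dc.
  apply: (le_trans (lerD fra h)).
  have h1 : 2 * c <= 2 * c * ((r - a) * e) ^+ 2 by rewrite ler_peMr// mulr_ge0.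
  have h2 : c * (r - a) <= c * (r - a) * ((r - a) * e) by rewrite ler_peMr.
  apply: (le_trans (lerD h1 h2)).
  have -> : K * (r - a) ^+ 2 = 2 * c * ((r - a) * e) ^+ 2 + c * (r - a) * ((r - a) * e)
     + c * (r - a) ^+ 2 * (1 + 2 * e) by rewrite /K; ring.
  rewrite lerDl; apply: mulr_ge0; first by apply: mulr_ge0 => //; exact: sqr_ge0.
  by apply: addr_ge0 => //; exact: mulr_ge0.
exists (2 * K); first by rewrite mulr_ge0.
move=> a a01; have /andP[a0 a1] := a01; have Ia := I1 a01.
have DK : `|D a| <= K by rewrite (le_trans (Dc a Ia)).
split.
  rewrite normrM normfV (ger0_norm (_ : 0 <= 2 * a)) ?mulr_ge0 ?(ltW a0)//.
  rewrite ler_pdivrMr ?mulr_gt0// (_ : 2 * K / a * (2 * a) = 4 * K).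
    by rewrite (le_trans DK)// ler_peMl// ler1n.
  by field; rewrite gt_eqF.
move=> r r0; have [s1 s2] := step a r a01 r0.
have raG : `|r - a| <= `|r ^+ 2 - a ^+ 2| / a.
  rewrite ler_pdivlMr// subr_sqr normrM ler_wpM2l// ger0_norm; first by lra.
  by rewrite addr_ge0// ltW.
have raG2 : (r - a) ^+ 2 <= (r ^+ 2 - a ^+ 2) ^+ 2 / a ^+ 2.
  rewrite -[_ ^+ 2 in leLHS]real_normK ?num_real//.
  rewrite -[X in X / _]real_normK ?num_real// -expr_div_n lerXn2r ?nnegrE//.
  by rewrite divr_ge0// ltW.
split.
  apply: (le_trans s1); apply: (le_trans (ler_wpM2l K0 raG)).
  set w := `|_|; have -> : 2 * K / a * w = K * (w / a) + K * (w / a) by ring.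
  have w0 : 0 <= w by exact: normr_ge0.
  by rewrite lerDl; apply: mulr_ge0 => //; apply: divr_ge0 => //; exact: ltW.
have -> : f r - f a - D a / (2 * a) * (r ^+ 2 - a ^+ 2) =
   (f r - f a - D a * (r - a)) - D a * ((r - a) ^+ 2 / (2 * a)).
  by field; rewrite gt_eqF.
set W := (r ^+ 2 - a ^+ 2) ^+ 2; rewrite -/W in raG2.
have W0 : 0 <= W by exact: sqr_ge0.
have ia1 : 1 <= a^-1 by rewrite invf_ge1.
apply: (le_trans (ler_normB _ _)).
have h1 : `|D a * ((r - a) ^+ 2 / (2 * a))| <= K * (W / a ^+ 2 * a^-1).
  rewrite normrM ler_pM// ger0_norm.
    rewrite invfM mulrA ler_pM ?invr_ge0 ?(ltW a0) ?divr_ge0 ?sqr_ge0//.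
    by rewrite (le_trans _ raG2)// ler_piMr ?sqr_ge0// invf_le1// ler1n.
  by rewrite divr_ge0 ?sqr_ge0// mulr_ge0// ltW.
have h2 : K * (r - a) ^+ 2 <= K * (W / a ^+ 2 * a^-1).
  rewrite ler_wpM2l// (le_trans raG2)// ler_peMr// divr_ge0// sqr_ge0//.
apply: (le_trans (lerD (le_trans s2 h2) h1)).
by apply: le_of_eq; field; rewrite gt_eqF.
Qed.

End twice_differentiable_function.

(** * A Riemann sum with nodes sqrt (k / N) *)

Section riemann_sum.
Variable R : realType.
Local Notation mu := (@lebesgue_measure R).
Implicit Types x y z r c B : R.
Variables (h : R -> R) (K : R).
Hypothesis K0 : 0 <= K.
Hypothesis mh : measurable_fun (`]0, 1] : set R) h.
Hypothesis hK : forall x y, 0 < x <= 1 -> 0 < y <= 1 -> `|h x - h y| <= K * `|x - y|.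

Let one01 : 0 < (1 : R) <= 1. Proof. by rewrite ltr01 lexx. Qed.

Let integrable_bounded01 (u : R -> R) B : measurable_fun (`]0, 1] : set R) u ->
  (forall x, 0 < x <= 1 -> `|u x| <= B) -> mu.-integrable `]0, 1] (EFin \o u).
Proof.
move=> mu_ uB; apply: measurable_bounded_integrable => //.
  have m1 : (lebesgue_measure (`]0%R, 1%R] : set R) = 1%:E)%E.
    by rewrite lebesgue_measure_itv/= lte_fin ltr01 oppr0 adde0.
  by rewrite [X in (X < _)%E](_ : _ = 1%:E)%E ?ltry.
exists B; split; rewrite ?num_real// => y By x /=; rewrite in_itv/= => x01.
by rewrite (le_trans (uB _ x01))// ltW.
Qed.

Let mH : measurable_fun (`]0, 1] : set R) (fun r => h r * r).
Proof. exact: measurable_funM. Qed.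

Let iH : mu.-integrable `]0, 1] (EFin \o (fun r => h r * r)).
Proof.
apply: (@integrable_bounded01 _ (`|h 1| + K)) => // x x01.
have /andP[x0 x1] := x01.
have hx : `|h x| <= `|h 1| + K.
  rewrite -(subrK (h 1) (h x)) (le_trans (ler_normD _ _))// addrC lerD2l.
  rewrite (le_trans (hK x01 one01))// ler_piMr// ler_norml; apply/andP; split; lra.
by rewrite normrM (gtr0_norm x0) (le_trans _ hx)// ler_piMr.
Qed.

Let sub01 x y : 0 <= x -> y <= 1 -> `]x, y]%classic `<=` `]0, 1]%classic.
Proof.
move=> x0 y1 z; rewrite /= !in_itv/= => /andP[xz zy].
by rewrite (le_lt_trans x0 xz) (le_trans zy y1).
Qed.

Let integral_id x y : 0 <= x -> x < y ->
  \int[mu]_(r in `]x, y]) r = (y ^+ 2 - x ^+ 2) / 2 /\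
  mu.-integrable `]x, y] (EFin \o (fun r : R => r)).
Proof.
move=> x0 xy.
have ci : {within `[x, y], continuous (fun r : R => r)}.
  by apply: continuous_subspaceT => z; exact: cvg_id.
have i : mu.-integrable `[x, y] (EFin \o (fun r : R => r)).
  by apply: continuous_compact_integrable => //; exact: segment_compact.
have i' : mu.-integrable `]x, y] (EFin \o (fun r : R => r)).
  apply: integrableS i => //; by apply: subset_itvr; rewrite bnd_simp.
split => //; rewrite Rintegral_itv_obnd_cbnd// /Rintegral.
pose F (r : R) := 2^-1 * r ^+ 2.
have dF (r : R) : is_derive r 1 F r.
  have -> : F = 2^-1 \*: (id ^+ 2) by apply/funext => z.
  by apply: is_derive_eq; rewrite /= expr1 scaler1 -[_ *: _]/(_ * _); field.
have cF : continuous F.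
  by move=> r; apply/differentiable_continuous/derivable1_diffP; have [] := dF r.
rewrite (@continuous_FTC2 R (fun r => r) F x y xy ci).
- by rewrite -EFinB /= /F; field.
- split.
  + by move=> r _; have [] := dF r.
  + by apply: cvg_at_right_filter; exact: cF.
  + by apply: cvg_at_left_filter; exact: cF.
- by move=> r _; rewrite derive1E; exact: (@derive_val _ _ _ _ _ _ _ (dF r)).
Qed.

Let piece x y : 0 <= x -> x < y -> y <= 1 ->
  `|\int[mu]_(r in `]x, y]) (h r * r) - h y * ((y ^+ 2 - x ^+ 2) / 2)| <=
  K * (y - x) * ((y ^+ 2 - x ^+ 2) / 2).
Proof.
move=> x0 xy y1; have [E i] := integral_id x0 xy.
have iHxy : mu.-integrable `]x, y] (EFin \o (fun r => h r * r)).
  by apply: integrableS iH => //; exact: sub01.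
have iZ c : mu.-integrable `]x, y] (EFin \o (fun r => c * r)).
  exact: (integrableZl _ c i).
rewrite -E -!RintegralZl// -RintegralB//.
have iB : mu.-integrable `]x, y] (EFin \o (fun r => h r * r - h y * r)).
  exact: (integrableB _ iHxy (iZ (h y))).
apply: (le_trans (le_normr_Rintegral _ iB)) => //.
apply: le_Rintegral => //; first exact: integrable_norm.
move=> r; rewrite /= in_itv/= => /andP[xr ry].
have r0 : 0 < r by exact: le_lt_trans xr.
have r01 : 0 < r <= 1 by rewrite r0 (le_trans ry).
have y01 : 0 < y <= 1 by rewrite y1 (lt_le_trans r0).
rewrite -mulrBl normrM (gtr0_norm r0) ler_wpM2r ?(ltW r0)//.
rewrite (le_trans (hK r01 y01))// ler_wpM2l// ler0_norm ?subr_le0// opprB.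
by rewrite lerD2l lerN2 ltW.
Qed.

Section partition.
Variable N : nat.
Hypothesis N0 : (0 < N)%N.
Let b k : R := Num.sqrt (k%:R / N%:R).
Let NR : 0 < N%:R :> R. Proof. by rewrite ltr0n. Qed.

Let b_sqr k : b k ^+ 2 = k%:R / N%:R.
Proof. by rewrite sqr_sqrtr// divr_ge0// ltW. Qed.

Let b_ge0 k : 0 <= b k. Proof. exact: sqrtr_ge0. Qed.

Let b_lt k : b k < b k.+1.
Proof. by rewrite ltr_sqrt ?divr_gt0// ltr_pM2r ?invr_gt0// ltr_nat. Qed.

Let b_le1 k : (k <= N)%N -> b k <= 1.
Proof.
by move=> kN; rewrite -sqrtr1 ler_wsqrtr// ler_pdivrMr// mul1r ler_nat.
Qed.

Let W m := \int[mu]_(r in `]0, b m]) (h r * r).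

Let WS m : (m < N)%N ->
  W m.+1 = W m + \int[mu]_(r in `]b m, b m.+1]) (h r * r).
Proof.
move=> mN; rewrite -(@Rintegral_itvB _ (fun r => h r * r) (BRight 0) (BRight (b m.+1)) (b m)).
- by rewrite addrC subrK.
- by apply: integrableS iH => //; apply: sub01 => //; exact: b_le1.
- by rewrite bnd_simp.
- by rewrite bnd_simp ltW.
Qed.

Let W_bound m : (m <= N)%N ->
  `|W m - \sum_(k < m) h (b k.+1) / (2 * N%:R)| <= K / (2 * N%:R) * b m.
Proof.
elim: m => [|m ih] mN.
  rewrite big_ord0 subr0 /W /b mul0r sqrtr0 set_itvoc0 Rintegral_set0 normr0.
  by rewrite mulr0.
rewrite WS// big_ord_recr/=.
have e : (b m.+1 ^+ 2 - b m ^+ 2) / 2 = (2 * N%:R)^-1.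
  by rewrite !b_sqr -natr1; field; rewrite gt_eqF.
have := piece (b_ge0 m) (b_lt m) (b_le1 mN); rewrite e => p.
have := ih (ltnW mN); set S := \sum_(k < m) _ => q.
set J := \int[mu]_(r in _) _; rewrite -/J in p.
have -> : W m + J - (S + h (b m.+1) / (2 * N%:R)) =
  (W m - S) + (J - h (b m.+1) / (2 * N%:R)) by ring.
apply: (le_trans (ler_normD _ _)); apply: (le_trans (lerD q p)).
by apply: le_of_eq; field; rewrite gt_eqF.
Qed.

(** The weight [r] gives the same mass [1 / (2 N)] to each interval between
    consecutive nodes, and the oscillations of [h] on them are at most [K] times
    their lengths, which add up to [1]. *)
Lemma radial_riemann_sum :
  `|2^-1 * \int[mu]_(r in `[0, 1]) (h r * r) -
    \sum_(k < N) h (Num.sqrt (k.+1%:R / N%:R)) / (4 * N%:R)| <= K / (4 * N%:R).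
Proof.
have bN : b N = 1 by rewrite /b divff ?gt_eqF// sqrtr1.
have := W_bound (leqnn N); rewrite bN mulr1 /W bN => w.
rewrite -Rintegral_itv_obnd_cbnd//.
have -> : \sum_(k < N) h (Num.sqrt (k.+1%:R / N%:R)) / (4 * N%:R) =
    2^-1 * \sum_(k < N) h (b k.+1) / (2 * N%:R).
  rewrite mulr_sumr; apply: eq_bigr => k _; rewrite /b.
  by field; rewrite gt_eqF.
rewrite -mulrBr normrM ger0_norm ?invr_ge0//.
rewrite (_ : K / (4 * N%:R) = 2^-1 * (K / (2 * N%:R))); last by field; rewrite gt_eqF.
by rewrite ler_wpM2l// invr_ge0.
Qed.

End partition.
End riemann_sum.

(** * The law of one modulus *)

Section radial_law_moments.
Variable R : realType.
Local Notation normc := (@Normc.normc R).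
Local Notation lebC := (@lebesgueC R).
Implicit Types (k m : nat) (s : R) (z : R[i]).

Let measurable_radial_density_pow m : measurable_fun setT (fun z => (normc z ^+ 2) ^+ m).
Proof. by apply: measurable_funX; apply: measurable_funX; exact: measurable_normc. Qed.

Lemma radial_law_moment k m s : 0 < s ->
  (radial_law k s).-integrable setT (EFin \o (fun z => (normc z ^+ 2) ^+ m)) /\
  \int[radial_law k s]_z ((normc z ^+ 2) ^+ m) =
    radial_moment (m + k) s / radial_moment k s.
Proof.
move=> s0.
have E z : (normc z ^+ 2) ^+ m * (radial_weight k s z / radial_moment k s) =
    (radial_moment k s)^-1 * radial_weight (m + k) s z.
  by rewrite /radial_weight exprD; ring.
split.
  apply: (integrable_density (measurable_radial_density k s) _ (radial_lawE k s0)) => //.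
    by move=> z; exact: radial_density_ge0.
  rewrite (funext E).
  exact: (integrableZl measurableT _ (integrable_radial_weight (m + k) s0)).
rewrite Rintegral_radial_law// (funext E) RintegralZl//; first by rewrite mulrC.
exact: integrable_radial_weight.
Qed.

(** With [q = k + 1], the squared modulus has the Gamma law of shape [q] and
    rate [s]. *)
Lemma radial_law_central_moments k s : 0 < s ->
  let q : R := k.+1%:R in
  let G z := normc z ^+ 2 - q / s in
  [/\ (radial_law k s).-integrable setT (EFin \o (fun z => G z ^+ 4)),
      \int[radial_law k s]_z G z = 0,
      \int[radial_law k s]_z (G z ^+ 2) = q / s ^+ 2 &
      \int[radial_law k s]_z (G z ^+ 4) <= 9 * q ^+ 2 / s ^+ 4].
Proof.
move=> s0 q G; set P := radial_law k s.
have sne : s != 0 by rewrite gt_eqF.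
have I0 : radial_moment k s != 0 by rewrite gt_eqF// radial_moment_gt0.
have i m := (radial_law_moment k m s0).1.
have E m := (radial_law_moment k m s0).2.
have M1 : \int[P]_z ((normc z ^+ 2) ^+ 1) = q / s.
  by rewrite E add1n radial_momentSs// mulfK.
have M2 : \int[P]_z ((normc z ^+ 2) ^+ 2) = q * (q + 1) / s ^+ 2.
  rewrite E !addSn add0n 2?radial_momentSs// mulrA mulfK// -(natr1 k.+1) -/q.
  by field.
have M3 : \int[P]_z ((normc z ^+ 2) ^+ 3) = q * (q + 1) * (q + 2) / s ^+ 3.
  rewrite E !addSn add0n 3?radial_momentSs// !mulrA mulfK//.
  by rewrite -(natr1 k.+2) -(natr1 k.+1) -/q; field.
have M4 : \int[P]_z ((normc z ^+ 2) ^+ 4) = q * (q + 1) * (q + 2) * (q + 3) / s ^+ 4.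
  rewrite E !addSn add0n 4?radial_momentSs// !mulrA mulfK//.
  by rewrite -(natr1 k.+3) -(natr1 k.+2) -(natr1 k.+1) -/q; field.
have Ecst (c : R) : \int[P]_z c = c.
  exact: Rintegral_cst_probability.
have iC (c : R) : P.-integrable setT (EFin \o (fun=> c)).
  exact: finite_measure_integrable_cst.
have iD (u v : R[i] -> R) : P.-integrable setT (EFin \o u) ->
    P.-integrable setT (EFin \o v) -> P.-integrable setT (EFin \o (fun x => u x + v x)).
  by move=> iu iv; exact: (integrableD measurableT iu iv).
have iZ (c : R) m : P.-integrable setT (EFin \o (fun z => c * (normc z ^+ 2) ^+ m)).
  exact: (integrableZl measurableT c (i m)).
pose e := q / s.
have G2E z : G z ^+ 2 = (normc z ^+ 2) ^+ 2 + (- 2 * e * (normc z ^+ 2) ^+ 1 + e ^+ 2).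
  by rewrite /G -/e; ring.
have G4E z : G z ^+ 4 = (normc z ^+ 2) ^+ 4 + (- 4 * e * (normc z ^+ 2) ^+ 3 +
    (6 * e ^+ 2 * (normc z ^+ 2) ^+ 2 + (- 4 * e ^+ 3 * (normc z ^+ 2) ^+ 1 + e ^+ 4))).
  by rewrite /G -/e; ring.
have i1 := iD _ _ (iZ (- 4 * e ^+ 3) 1%N) (iC (e ^+ 4)).
have i2 := iD _ _ (iZ (6 * e ^+ 2) 2%N) i1.
have i3 := iD _ _ (iZ (- 4 * e) 3%N) i2.
have i4 := iD _ _ (iZ (- 2 * e) 1%N) (iC (e ^+ 2)).
split.
- by rewrite (funext G4E); exact: iD.
- by rewrite /G RintegralB ?Ecst ?M1 ?subrr//; exact: (i 1%N).
- rewrite (funext G2E) RintegralD// RintegralD// ?RintegralZl// M2 M1 Ecst.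
  by rewrite /e; field.
- rewrite (funext G4E) RintegralD// RintegralD// RintegralD// RintegralD//.
  rewrite !RintegralZl// M1 M2 M3 M4 Ecst.
  rewrite (_ : _ + _ = (3 * q ^+ 2 + 6 * q) / s ^+ 4); last by rewrite /e; field.
  rewrite ler_wpM2r ?invr_ge0 ?exprn_ge0 ?(ltW s0)//.
  (* [3 q ^ 2 + 6 q <= 9 q ^ 2]. *)
  have : 1 <= q by rewrite ler1n.
  by nra.
Qed.

Lemma lebesgueC_set1 : lebC [set 0] = 0%E.
Proof.
rewrite /lebesgueC /pushforward.
rewrite (_ : _ @^-1` _ = [set 0] `*` [set 0]).
  by rewrite product_measure1E//= lebesgue_measure_set1 mul0e.
by apply/seteqP; split=> -[x y] /= [-> ->].
Qed.

(** The origin is negligible, and it has to be avoided: a radial function may be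
    discontinuous there. *)
Lemma eq_Rintegral_radial_law k s (f g : R[i] -> R) : 0 < s ->
  measurable_fun setT f -> measurable_fun setT g ->
  (forall z, z != 0 -> f z = g z) ->
  \int[radial_law k s]_z f z = \int[radial_law k s]_z g z.
Proof.
move=> s0 mf mg fg; rewrite !Rintegral_radial_law// /Rintegral; congr fine.
have md (u : R[i] -> R) : measurable_fun setT u -> measurable_fun setT
    (EFin \o (fun z => u z * (radial_weight k s z / radial_moment k s))).
  by move=> mu; apply/measurable_EFinP; apply: measurable_funM => //; exact: measurable_radial_density.
apply: ae_eq_integral => //; [exact: (md f)|exact: (md g)|].
have m0 : measurable [set (0 : R[i])].
  rewrite (_ : [set 0] = setT `&` (fun z => normc z) @^-1` [set 0]); first exact: measurable_normc.
  apply/seteqP; split=> z /=; first by move=> ->; split => //; exact: Normc.normc0.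
  by move=> [_ /Normc.eq0_normc].
exists [set 0]; split => //; first exact: lebesgueC_set1.
move=> z /= H; apply: contrapT => /eqP z0; apply: H => _ /=.
by rewrite fg.
Qed.

End radial_law_moments.

Section radial_statistics.
Variable R : realType.
Local Notation normc := (@Normc.normc R).
Implicit Types (f g D E : R -> R) (z : R[i]).

Lemma measurable_radial f : measurable_fun (`[0, +oo[ : set R) f ->
  measurable_fun setT (fun z => f (normc z)).
Proof.
move=> mf; apply: (measurable_comp _ _ mf) => //.
- move=> _ [z _ <-]; rewrite /= in_itv/= andbT; exact: normc_ge0.
- exact: measurable_normc.
Qed.

Lemma radial_expansion_le (c c' : R) f D : c <= c' ->
  radial_expansion c f D -> radial_expansion c' f D.
Proof.
move=> cc' h a a01; have [h1 h2] := h a a01; have /andP[a0 _] := a01.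
have i1 : c / a <= c' / a by rewrite ler_wpM2r// invr_ge0 ltW.
have i3 : c / a ^+ 3 <= c' / a ^+ 3 by rewrite ler_wpM2r// invr_ge0 exprn_ge0// ltW.
split; first exact: le_trans i1.
move=> r r0; have [h3 h4] := h2 r r0; split.
  by rewrite (le_trans h3)// ler_wpM2r.
by rewrite (le_trans h4)// ler_wpM2r// sqr_ge0.
Qed.

Section one_radius.
Variables (N k : nat).
Hypothesis kN : (k < N)%N.
Let s : R := N%:R.
Let s0 : 0 < s. Proof. by rewrite ltr0n (leq_ltn_trans _ kN). Qed.
Local Notation P := (radial_law k s).
Let q : R := k.+1%:R.
Let a : R := Num.sqrt (q / s).
Let b : R := Num.sqrt s.
Let G z : R := normc z ^+ 2 - q / s.

Let a01 : 0 < a <= 1.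
Proof.
rewrite sqrtr_gt0 divr_gt0//= -[leRHS]sqrtr1 ler_wsqrtr// ler_pdivrMr// mul1r.
by rewrite ler_nat.
Qed.

Let a0 : 0 < a. Proof. by have /andP[] := a01. Qed.
Let b0 : 0 < b. Proof. by rewrite sqrtr_gt0. Qed.
Let a2 : a ^+ 2 = q / s. Proof. by rewrite sqr_sqrtr// divr_ge0// ltW. Qed.
Let b2 : b ^+ 2 = s. Proof. by rewrite sqr_sqrtr// ltW. Qed.
Let ab : a * b = Num.sqrt q.
Proof. by rewrite -sqrtrM ?divr_ge0 ?(ltW s0)// divfK// gt_eqF. Qed.
Let ab1 : 1 <= a * b. Proof. by rewrite ab -[leLHS]sqrtr1 ler_wsqrtr// ler1n. Qed.

Let mG : measurable_fun setT G.
Proof. by apply: measurable_funB => //; apply: measurable_funX; exact: measurable_normc. Qed.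

Let moments : [/\ P.-integrable setT (EFin \o (fun z => G z ^+ 4)),
  \int[P]_z G z = 0, \int[P]_z (G z ^+ 2) = a ^+ 2 / b ^+ 2 &
  \int[P]_z (G z ^+ 4) <= 9 * a ^+ 4 / b ^+ 4].
Proof.
have [i E1 E2 E4] := radial_law_central_moments k s0; split => //.
  by rewrite /G E2 a2 b2 expr2 invfM mulrA.
have a4 : a ^+ 4 = (q / s) ^+ 2 by rewrite -a2 -exprM.
have b4 : b ^+ 4 = s ^+ 2 by rewrite -b2 -exprM.
rewrite /G (le_trans E4)// a4 b4.
by apply: le_of_eq; field; rewrite gt_eqF.
Qed.

(** A null modification at the origin, where a radial function may be
    discontinuous, makes the expansion hold everywhere. *)
Let amend f D z : R :=
  f (normc z) + \1_[set 0] z * (f a + D a / (2 * a) * G z - f 0).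

Let amend_ne0 f D z : z != 0 -> amend f D z = f (normc z).
Proof.
by move=> z0; rewrite /amend indicE memNset ?mul0r ?addr0//=; exact/eqP.
Qed.

Let amend0 f D : amend f D 0 = f a + D a / (2 * a) * G 0.
Proof.
have n0 : normc (0 : R[i]) = 0 by exact: Normc.normc0.
by rewrite /amend indicE mem_set// mul1r n0 addrC subrK.
Qed.

Let measurable_set0C : measurable [set (0 : R[i])].
Proof.
rewrite (_ : [set 0] = setT `&` (fun z => normc z) @^-1` [set 0]); first exact: measurable_normc.
apply/seteqP; split=> z /=; first by move=> ->; split => //; exact: Normc.normc0.
by move=> [_ /Normc.eq0_normc].
Qed.

Let measurable_amend f D : measurable_fun (`[0, +oo[ : set R) f ->
  measurable_fun setT (amend f D).
Proof.
move=> mf; apply: measurable_funD; first exact: measurable_radial.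
apply: measurable_funM; first exact: measurable_indic.
by apply: measurable_funB => //; apply: measurable_funD => //; exact: measurable_funM.
Qed.

Let amend_expansion (c : R) f D : 0 <= c -> radial_expansion c f D -> forall z,
  `|amend f D z - f a| <= c / a * `|G z| /\
  `|amend f D z - f a - D a / (2 * a) * G z| <= c / a ^+ 3 * G z ^+ 2.
Proof.
move=> c0 h z; have [h1 h2] := h a a01; have [->|z0] := eqVneq z 0.
  rewrite amend0 addrAC subrr add0r subrr normr0 normrM; split.
    by rewrite ler_wpM2r.
  by rewrite mulr_ge0 ?sqr_ge0// divr_ge0// exprn_ge0// ltW.
rewrite amend_ne0// /G -a2; apply: h2; rewrite lt_def normc_ge0 andbT.
by apply: contra z0 => /eqP/Normc.eq0_normc ->.
Qed.

Let transfer f D (phi : R -> R) : measurable_fun (`[0, +oo[ : set R) f ->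
  measurable_fun setT phi ->
  \int[P]_z phi (amend f D z) = \int[P]_z phi (f (normc z)).
Proof.
move=> mf mphi; apply: eq_Rintegral_radial_law => //.
- exact: (measurableT_comp mphi (measurable_amend D mf)).
- exact: (measurableT_comp mphi (measurable_radial mf)).
- by move=> z z0; rewrite amend_ne0.
Qed.

(** In [G = |z| ^ 2 - a ^ 2], of variance [a ^ 2 / N], the linear parts of the two
    statistics have coefficients [D a / (2 a)] and [E a / (2 a)]. *)
Lemma radial_law_covariance (c : R) f g D E : 0 <= c ->
  measurable_fun (`[0, +oo[ : set R) f -> measurable_fun (`[0, +oo[ : set R) g ->
  radial_expansion c f D -> radial_expansion c g E ->
  `|\int[P]_z (f (normc z) * g (normc z))
    - (\int[P]_z f (normc z)) * (\int[P]_z g (normc z))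
    - D a * E a / (4 * s)| <= 30 * c ^+ 2 / (Num.sqrt q * s).
Proof.
move=> c0 mf mg hf hg; have [i E1 E2 E4] := moments.
have [h1 _] := hf a a01; have [h2 _] := hg a a01.
have [_] := concentrated_covariance a0 b0 c0 ab1 mG i E1 E2 E4
  (measurable_amend D mf) (measurable_amend E mg) h1 h2
  (fun z => (amend_expansion c0 hf z).1) (fun z => (amend_expansion c0 hg z).1)
  (fun z => (amend_expansion c0 hf z).2) (fun z => (amend_expansion c0 hg z).2).
have -> : \int[P]_z (amend f D z * amend g E z) = \int[P]_z (f (normc z) * g (normc z)).
  apply: eq_Rintegral_radial_law => //.
  - by apply: measurable_funM; exact: measurable_amend.
  - by apply: measurable_funM; exact: measurable_radial.
  - by move=> z z0; rewrite !amend_ne0.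
have -> : \int[P]_z amend f D z = \int[P]_z f (normc z) by exact: (@transfer f D id).
have -> : \int[P]_z amend g E z = \int[P]_z g (normc z) by exact: (@transfer g E id).
have -> : D a / (2 * a) * (E a / (2 * a)) * (a ^+ 2 / b ^+ 2) = D a * E a / (4 * s).
  by rewrite b2; field; rewrite !gt_eqF.
by rewrite -ab -b2 (_ : a * b ^+ 3 = a * b * b ^+ 2)//; ring.
Qed.

(** The centred third moment is [O(N ^ (- 3 / 2))] and the squared variance
    [O(N ^ (- 2))]. *)
Lemma radial_law_charfun (c t : R) f D : 0 <= c ->
  measurable_fun (`[0, +oo[ : set R) f -> radial_expansion c f D ->
  let m := \int[P]_z f (normc z) in
  let v := \int[P]_z (f (normc z) ^+ 2) - m ^+ 2 in
  0 <= v /\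
  normc (Cint P (fun z => expi (t * (f (normc z) - m))) -
         (expR (- (t ^+ 2 * v / 2)))%:C%C) <=
    (144 * c ^+ 3 * `|t| ^+ 3 + 100 * c ^+ 4 * t ^+ 4) / (s * Num.sqrt s).
Proof.
move=> c0 mf hf m v; have [i E1 E2 E4] := moments.
pose X z := amend f D z - m.
have mA := measurable_amend D mf.
have mX : measurable_fun setT X by exact: measurable_funB.
have EA : \int[P]_z amend f D z = m by exact: (@transfer f D id).
have iA := integrable_concentrated a0 b0 c0 mG i E2 E4 mA
  (fun z => (amend_expansion c0 hf z).1).
have [i3 M3] := concentrated_third_moment a0 b0 c0 mG i E2 E4 mA
  (fun z => (amend_expansion c0 hf z).1).
have [i2 M2] := concentrated_variance_le a0 b0 c0 mG i E2 E4 mA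
  (fun z => (amend_expansion c0 hf z).1).
rewrite EA in i3 M3 i2 M2.
have Ecst (x : R) : \int[P]_z x = x.
  exact: Rintegral_cst_probability.
have iC (x : R) : P.-integrable setT (EFin \o (fun=> x)).
  exact: finite_measure_integrable_cst.
have iX : P.-integrable setT (EFin \o X) by exact: (integrableB measurableT iA (iC m)).
have EX : \int[P]_z X z = 0 by rewrite /X RintegralB// EA Ecst subrr.
have EX2 : \int[P]_z (X z ^+ 2) = v.
  have iA2 : P.-integrable setT (EFin \o (fun z => amend f D z ^+ 2)).
    have iZ := integrableZl measurableT (2 * m) iX.
    have := integrableD measurableT i2 (integrableD measurableT iZ (iC (m ^+ 2))).
    congr (P.-integrable _ _); apply/funext => z /=; congr EFin.
    by rewrite /X; ring.
  have iZ : P.-integrable setT (EFin \o (fun z => - 2 * m * amend f D z + m ^+ 2)).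
    exact: (integrableD measurableT (integrableZl measurableT (- 2 * m) iA) (iC (m ^+ 2))).
  have -> : \int[P]_z (X z ^+ 2) =
      \int[P]_z (amend f D z ^+ 2 + (- 2 * m * amend f D z + m ^+ 2)).
    by apply: eq_Rintegral => z _; rewrite /X; ring.
  rewrite RintegralD// RintegralD//; last exact: (integrableZl measurableT (- 2 * m) iA).
  have msq : measurable_fun setT (fun x : R => x ^+ 2) by exact: exprn_measurable.
  by rewrite RintegralZl// EA Ecst (transfer D mf msq) /v; ring.
have v0 : 0 <= v by rewrite -EX2; apply: Rintegral_ge0 => z _; exact: sqr_ge0.
split=> //.
have -> : Cint P (fun z => expi (t * (f (normc z) - m))) = Cint P (fun z => expi (t * X z)).
  have mfm : measurable_fun setT (fun z => f (normc z) - m).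
    by apply: measurable_funB => //; exact: measurable_radial.
  have e z : z != 0 -> expi (t * (f (normc z) - m)) = expi (t * X z).
    by move=> z0; rewrite /X amend_ne0.
  apply: complex_eqP; rewrite /Cint; apply: eq_Rintegral_radial_law => //.
  - exact: (measurable_funRe (measurable_expi_comp mfm t)).
  - exact: (measurable_funRe (measurable_expi_comp mX t)).
  - by move=> z z0; rewrite e.
  - exact: (measurable_funIm (measurable_expi_comp mfm t)).
  - exact: (measurable_funIm (measurable_expi_comp mX t)).
  - by move=> z z0; rewrite e.
apply: (le_trans (charfun_gauss_bound mX t iX i2 i3 EX EX2)).
have b1 : 1 <= b by rewrite -[leLHS]sqrtr1 ler_wsqrtr// ler1n (leq_ltn_trans _ kN).
have b3 : s * Num.sqrt s = b ^+ 3 by rewrite -/b -b2; ring.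
rewrite b3 [leRHS]mulrDl; apply: lerD.
  have t3 : 0 <= 2 * `|t| ^+ 3 by rewrite mulr_ge0// exprn_ge0.
  apply: (le_trans (ler_wpM2l t3 M3)).
  by apply: le_of_eq; field; rewrite gt_eqF.
have t4 : 0 <= t ^+ 4 by rewrite (_ : t ^+ 4 = (t ^+ 2) ^+ 2) ?sqr_ge0// -exprM.
have M2' : v <= 10 * c ^+ 2 / b ^+ 2 by rewrite -EX2.
have v2 : v ^+ 2 <= (10 * c ^+ 2 / b ^+ 2) ^+ 2 by rewrite lerXn2r ?nnegrE// (le_trans v0).
apply: (le_trans (ler_wpM2l t4 v2)).
have -> : t ^+ 4 * (10 * c ^+ 2 / b ^+ 2) ^+ 2 = 100 * c ^+ 4 * t ^+ 4 / b ^+ 3 * b^-1.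
  by field; rewrite gt_eqF.
rewrite ler_piMr// ?invf_le1//.
apply: divr_ge0; last by rewrite exprn_ge0// ltW.
by apply: mulr_ge0 => //; apply: mulr_ge0 => //; exact: exprn_ge0.
Qed.

End one_radius.
End radial_statistics.

(** * Linear statistics of a finite sample *)

Section ginibre_statistics.
Variables (R : realType) (N : nat).
Hypothesis N0 : (0 < N)%N.
Local Notation normc := (@Normc.normc R).
Local Notation P k := (radial_law k (N%:R : R)).
Local Notation stat f := (@linear_stat R N (f \o normc)).
Implicit Types (f g : R -> R) (t : R).

Definition bounded_on_halfline f :=
  measurable_fun (`[0, +oo[ : set R) f /\
  exists B, forall x : R, 0 <= x -> `|f x| <= B.

Lemma bounded_halflineM f g : bounded_on_halfline f -> bounded_on_halfline g ->
  bounded_on_halfline (fun x => f x * g x).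
Proof.
move=> [mf [B fB]] [mg [C gC]]; split; first exact: measurable_funM.
by exists (B * C) => x x0; rewrite normrM ler_pM// ?fB// gC.
Qed.

Lemma bounded_halfline_cst (c : R) : bounded_on_halfline (fun=> c).
Proof. by split=> //; exists `|c|. Qed.

Lemma bounded_radial_realC f : bounded_on_halfline f ->
  bounded_radial (fun z : R[i] => (f (normc z))%:C%C).
Proof.
move=> [mf [B fB]]; split.
- by apply: measurable_funrealC; exact: measurable_radial.
- by exists B => z; rewrite normc_realC fB// normc_ge0.
- by move=> w z w1; rewrite Normc.normcM w1 mul1r.
Qed.

Lemma Rintegral_ginibre_prod (psi : 'I_N -> R -> R) :
  (forall k, bounded_on_halfline (psi k)) ->
  \int[ginibre R N]_z (\prod_(k < N) psi k (normc (tnth z k))) =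
  (N`!%:R)^-1 * \sum_(s : 'S_N) \prod_(k < N) \int[P (s k)]_z psi k (normc z).
Proof.
move=> bpsi; apply: (@complexI R).
rewrite -[LHS]Cint_realC.
rewrite (eq_Cint _ (G := fun z : N.-tuple R[i] => \prod_(k < N) (psi k (normc (tnth z k)))%:C%C)).
  rewrite (Cint_ginibre N0 (phi := fun k z => (psi k (normc z))%:C%C)); last first.
    by move=> k; exact: bounded_radial_realC.
  rewrite rmorphM fmorphV rmorph_nat rmorph_sum/=; congr (_ * _).
  apply: eq_bigr => s _; rewrite rmorph_prod; apply: eq_bigr => k _.
  by rewrite Cint_realC.
by move=> z; rewrite rmorph_prod.
Qed.

Lemma measurable_tnth_radial f (i : 'I_N) : bounded_on_halfline f ->
  measurable_fun setT (fun z : N.-tuple R[i] => f (normc (tnth z i))).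
Proof.
move=> [mf _]; apply: (measurableT_comp (measurable_radial mf)).
exact: measurable_tnth.
Qed.

Lemma integrable_ginibre_bounded (F : N.-tuple R[i] -> R) (B : R) :
  measurable_fun setT F -> (forall z, `|F z| <= B) ->
  (ginibre R N).-integrable setT (EFin \o F).
Proof.
move=> mF FB; apply: (integrable_bound mF _ FB).
exact: finite_measure_integrable_cst.
Qed.

Lemma integrable_tnth_radial f (i : 'I_N) : bounded_on_halfline f ->
  (ginibre R N).-integrable setT (EFin \o (fun z => f (normc (tnth z i)))).
Proof.
move=> bf; have [_ [B fB]] := bf.
apply: (@integrable_ginibre_bounded _ B); first exact: measurable_tnth_radial.
by move=> z; rewrite fB// normc_ge0.
Qed.

Let fact_cancel (x : R) : (N`!%:R)^-1 * \sum_(s : 'S_N) x = x.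
Proof.
rewrite sumr_const card_Sn -[x *+ _]mulr_natl mulrA mulVf ?mul1r//.
Qed.

Let mean_cst k (c : R) : \int[P k]_z c = c.
Proof. exact: Rintegral_cst_probability. Qed.

Lemma Rintegral_ginibre_tnth f (i : 'I_N) : bounded_on_halfline f ->
  \int[ginibre R N]_z f (normc (tnth z i)) =
  (N`!%:R)^-1 * \sum_(s : 'S_N) \int[P (s i)]_z f (normc z).
Proof.
move=> bf; pose psi (k : 'I_N) := if k == i then f else fun=> 1.
have bpsi k : bounded_on_halfline (psi k).
  by rewrite /psi; case: eqP => // _; exact: bounded_halfline_cst.
rewrite -[LHS](_ : \int[ginibre R N]_z (\prod_(k < N) psi k (normc (tnth z k))) = _).
  rewrite Rintegral_ginibre_prod//; congr (_ * _); apply: eq_bigr => s _.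
  rewrite (bigD1 i)//= big1 ?mulr1; first by rewrite /psi eqxx.
  by move=> k ki; rewrite /psi (negbTE ki) mean_cst.
apply: eq_Rintegral => z _; rewrite (bigD1 i)//= big1 ?mulr1.
  by rewrite /psi eqxx.
by move=> k ki; rewrite /psi (negbTE ki).
Qed.

Lemma Rintegral_ginibre_tnth2 f g (i j : 'I_N) : i != j ->
  bounded_on_halfline f -> bounded_on_halfline g ->
  \int[ginibre R N]_z (f (normc (tnth z i)) * g (normc (tnth z j))) =
  (N`!%:R)^-1 * \sum_(s : 'S_N)
    (\int[P (s i)]_z f (normc z)) * (\int[P (s j)]_z g (normc z)).
Proof.
move=> ij bf bg.
pose psi (k : 'I_N) := if k == i then f else if k == j then g else fun=> 1.
have ji : j != i by rewrite eq_sym.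
have bpsi k : bounded_on_halfline (psi k).
  by rewrite /psi; case: eqP => // _; case: eqP => // _; exact: bounded_halfline_cst.
rewrite -[LHS](_ : \int[ginibre R N]_z (\prod_(k < N) psi k (normc (tnth z k))) = _).
  rewrite Rintegral_ginibre_prod//; congr (_ * _); apply: eq_bigr => s _.
  rewrite (bigD1 i)//= (bigD1 j)//= big1 ?mulr1.
    by rewrite /psi eqxx (negbTE ji) eqxx.
  by move=> k /andP[ki kj]; rewrite /psi (negbTE ki) (negbTE kj) mean_cst.
apply: eq_Rintegral => z _; rewrite (bigD1 i)//= (bigD1 j)//= big1 ?mulr1.
  by rewrite /psi eqxx (negbTE ji) eqxx.
by move=> k /andP[ki kj]; rewrite /psi (negbTE ki) (negbTE kj).
Qed.

Lemma measurable_stat f : bounded_on_halfline f -> measurable_fun setT (stat f).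
Proof. by move=> bf; apply: measurable_sum => i; exact: measurable_tnth_radial. Qed.

Lemma stat_bounded f : bounded_on_halfline f -> exists B, forall z, `|stat f z| <= B.
Proof.
move=> [_ [B fB]]; exists (\sum_(i < N) B) => z.
rewrite (le_trans (ler_norm_sum _ _ _))// ler_sum// => i _.
by rewrite fB// normc_ge0.
Qed.

Lemma integrable_stat f : bounded_on_halfline f ->
  (ginibre R N).-integrable setT (EFin \o stat f).
Proof.
move=> bf; have [B hB] := stat_bounded bf.
exact: (integrable_ginibre_bounded (measurable_stat bf) hB).
Qed.

Lemma Rintegral_stat f : bounded_on_halfline f ->
  \int[ginibre R N]_z stat f z = \sum_(k < N) \int[P k]_z f (normc z).
Proof.
move=> bf; rewrite /linear_stat Rintegral_sum; last by move=> i; exact: integrable_tnth_radial.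
under eq_bigr do rewrite Rintegral_ginibre_tnth//.
rewrite -mulr_sumr exchange_big/= -[RHS]fact_cancel; congr (_ * _).
by apply: eq_bigr => s _; rewrite [RHS](reindex_inj (@perm_inj _ s)).
Qed.

(** The diagonal terms give the sum of the [\int f g]; averaged over the random
    order, the off-diagonal ones factor as products of means of distinct radii,
    so that only the covariances of the single radii remain. *)
Lemma Rintegral_stat_mul f g : bounded_on_halfline f -> bounded_on_halfline g ->
  \int[ginibre R N]_z (stat f z * stat g z) -
    (\int[ginibre R N]_z stat f z) * (\int[ginibre R N]_z stat g z) =
  \sum_(k < N) (\int[P k]_z (f (normc z) * g (normc z)) -
    (\int[P k]_z f (normc z)) * (\int[P k]_z g (normc z))).
Proof.
move=> bf bg; rewrite !Rintegral_stat//.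
pose ef (k : 'I_N) := \int[P k]_z f (normc z).
pose eg (k : 'I_N) := \int[P k]_z g (normc z).
have bfg := bounded_halflineM bf bg.
pose F (i j : 'I_N) (z : N.-tuple R[i]) := f (normc (tnth z i)) * g (normc (tnth z j)).
have iF i j : (ginibre R N).-integrable setT (EFin \o F i j).
  have [_ [B fB]] := bf; have [_ [C gC]] := bg.
  apply: (@integrable_ginibre_bounded _ (B * C)).
    by apply: measurable_funM; exact: measurable_tnth_radial.
  by move=> z; rewrite /F normrM ler_pM// ?fB ?gC// normc_ge0.
have -> : \int[ginibre R N]_z (stat f z * stat g z) =
    \sum_(i < N) \sum_(j < N) \int[ginibre R N]_z F i j z.
  rewrite pair_big /= -Rintegral_sum//.
  apply: eq_Rintegral => z _; rewrite /linear_stat big_distrlr/= pair_big/=.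
  by [].
have diag : \sum_(i < N) \int[ginibre R N]_z F i i z =
    \sum_(k < N) \int[P k]_z (f (normc z) * g (normc z)).
  by rewrite -(Rintegral_stat bfg) /linear_stat Rintegral_sum// => i; exact: iF.
have off : \sum_(i < N) \sum_(j < N | j != i) \int[ginibre R N]_z F i j z =
    \sum_(i < N) \sum_(j < N | j != i) ef i * eg j.
  transitivity (\sum_(i < N) \sum_(j < N | j != i)
      (N`!%:R)^-1 * \sum_(s : 'S_N) ef (s i) * eg (s j)).
    apply: eq_bigr => i _; apply: eq_bigr => j ji.
    by rewrite /F Rintegral_ginibre_tnth2// eq_sym.
  rewrite (eq_bigr (fun i => (N`!%:R)^-1 * \sum_(s : 'S_N) \sum_(j < N | j != i) ef (s i) * eg (s j))).
    rewrite -mulr_sumr exchange_big/= -[RHS]fact_cancel; congr (_ * _).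
    apply: eq_bigr => s _; rewrite [RHS](reindex_inj (@perm_inj _ s))/=.
    apply: eq_bigr => i _; rewrite [RHS](reindex_inj (@perm_inj _ s))/=.
    by apply: eq_bigl => j; rewrite (inj_eq perm_inj).
  by move=> i _; rewrite -mulr_sumr exchange_big.
have -> : \sum_(i < N) \sum_(j < N) \int[ginibre R N]_z F i j z =
    \sum_(i < N) \int[ginibre R N]_z F i i z +
    \sum_(i < N) \sum_(j < N | j != i) \int[ginibre R N]_z F i j z.
  by rewrite -big_split/=; apply: eq_bigr => i _; rewrite (bigD1 i).
rewrite diag off big_distrlr/=.
have -> : \sum_(i < N) \sum_(j < N) ef i * eg j =
    \sum_(i < N) ef i * eg i + \sum_(i < N) \sum_(j < N | j != i) ef i * eg j.
  by rewrite -big_split/=; apply: eq_bigr => i _; rewrite (bigD1 i).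
by rewrite sumrB opprD addrACA subrr addr0.
Qed.

(** The integrand is symmetric, so all orderings contribute equally. *)
Lemma Cint_stat_expi f t : bounded_on_halfline f ->
  let m k := \int[P k]_z f (normc z) in
  Cint (ginibre R N) (fun z => expi (t * (stat f z - \int[ginibre R N]_z stat f z))) =
  \prod_(k < N) Cint (P k) (fun z => expi (t * (f (normc z) - m k))).
Proof.
move=> bf m; have [mf [B fB]] := bf.
have mfz := measurable_radial mf.
pose phi (z : R[i]) := expi (t * f (normc z)).
have bphi : bounded_radial phi.
  split; first exact: measurable_expi_comp.
    by exists 1 => z; rewrite normc_expi.
  by move=> w z w1; rewrite /phi Normc.normcM w1 mul1r.
have sumE (r : 'I_N -> R) : expi (\sum_(k < N) r k) = \prod_(k < N) expi (r k).
  have e0 : expi (0 : R) = 1 by rewrite /expi cos0 sin0.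
  have eD : {morph (@expi R) : x y / x + y >-> x * y} by move=> x y; exact: expiD.
  exact: (big_morph (@expi R) eD e0).
have iphi k : Cintegrable (P k) phi by exact: Cintegrable_expi.
rewrite Rintegral_stat//.
rewrite (eq_Cint _ (G := fun z : N.-tuple R[i] =>
    expi (- (t * \sum_(k < N) m k)) * \prod_(k < N) phi (tnth z k))); last first.
  move=> z; rewrite mulrBr addrC expiD; congr (_ * _).
  by rewrite /linear_stat mulr_sumr sumE.
rewrite CintZl; last first.
  apply: (@Cintegrable_le _ _ _ _ _ (fun=> 1)).
  - apply: measurable_funCprod => k; have [mphi _ _] := bphi.
    by apply: (measurableT_comp mphi); exact: measurable_tnth.
  - exact: finite_measure_integrable_cst.
  - by move=> z; rewrite normc_prod big1// => k _; rewrite normc_expi.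
rewrite (Cint_ginibre N0 (phi := fun _ => phi)) //.
have -> : \sum_(s : 'S_N) \prod_(k < N) Cint (P (s k)) phi =
    N`!%:R * \prod_(k < N) Cint (P k) phi.
  rewrite (eq_bigr (fun=> \prod_(k < N) Cint (P k) phi)).
    by rewrite sumr_const card_Sn mulr_natl.
  by move=> s _; rewrite (prod_perm (fun k : 'I_N => Cint (P k) phi)).
rewrite [in X in _ * X]mulrA mulVf ?mul1r; last by rewrite pnatr_eq0 -lt0n fact_gt0.
rewrite mulr_sumr -sumrN sumE -big_split/=; apply: eq_bigr => k _.
rewrite -CintZl//; apply: eq_Cint => z.
by rewrite /phi -expiD; congr expi; ring.
Qed.

End ginibre_statistics.

(** * Asymptotics *)

Section asymptotics.
Variable R : realType.
Local Notation normc := (@Normc.normc R).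
Local Notation P N k := (radial_law k (N%:R : R)).
Local Notation stat N f := (@linear_stat R N (f \o normc)).
Implicit Types (c t x y : R) (N : nat).

Lemma sum_inv_sqrt_le N : \sum_(k < N) (Num.sqrt (k.+1%:R : R))^-1 <= 2 * Num.sqrt N%:R.
Proof.
elim: N => [|N ih]; first by rewrite big_ord0 sqrtr0 mulr0.
rewrite big_ord_recr/=; apply: (le_trans (lerD ih (lexx _))).
set s : R := Num.sqrt N%:R; set t : R := Num.sqrt N.+1%:R.
have t0 : 0 < t by rewrite sqrtr_gt0 ltr0n.
have tE : t ^+ 2 = s ^+ 2 + 1 by rewrite !sqr_sqrtr// -natr1.
rewrite addrC -lerBrDr -(ler_pM2r t0) mulVf ?gt_eqF//.
by have := sqr_ge0 (t - s); nra.
Qed.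

Lemma cvg_of_inv_sqrt_bound (u : nat -> R) (l C : R) :
  (forall N, (0 < N)%N -> `|u N - l| <= C / Num.sqrt N%:R) -> u N @[N --> \oo] --> l.
Proof.
move=> ul; apply/cvgrPdist_lt => e e0.
near=> N.
have N0 : (0 < N)%N by near: N; exact: nbhs_infty_gt.
have sN0 : 0 < Num.sqrt (N%:R : R) by rewrite sqrtr_gt0 ltr0n.
have sN : (`|C| + 1) / e < Num.sqrt N%:R.
  have a0 : 0 <= (`|C| + 1) / e by rewrite divr_ge0// ?ltW//; have := normr_ge0 C; lra.
  rewrite -(ltr_pXn2r (n := 2))// ?nnegrE ?sqrtr_ge0// sqr_sqrtr//.
  by near: N; exact: nbhs_infty_gtr.
rewrite distrC (le_lt_trans (ul _ N0))// ltr_pdivrMr//.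
move: sN; rewrite ltr_pdivrMr// mulrC => sN; apply: le_lt_trans sN.
by have := ler_norm C; lra.
Unshelve. all: by end_near. Qed.

(** What the asymptotics retain of the smoothness and boundedness of a profile,
    with a single constant. *)
Definition regular_profile c (f : R -> R) :=
  [/\ 0 <= c /\ radial_expansion c f f^`()%classic, bounded_on_halfline f,
      measurable_fun (`]0, 1] : set R) f^`()%classic,
      forall x, 0 < x <= 1 -> `|f^`()%classic x| <= c &
      forall x y, 0 < x <= 1 -> 0 < y <= 1 ->
        `|f^`()%classic x - f^`()%classic y| <= c * `|x - y|].

Lemma regular_profile_le c c' f : c <= c' -> regular_profile c f -> regular_profile c' f.
Proof.
move=> cc' [[c0 fX] fB mD Dc DL]; split => //.
- by split; [exact: le_trans cc'|exact: radial_expansion_le fX].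
- by move=> x x01; apply: (le_trans (Dc x x01)).
- by move=> x y x01 y01; apply: (le_trans (DL x y x01 y01)); exact: ler_wpM2r.
Qed.

Lemma C2_holder_regular_profile (f : R -> R) (delta eps : R) :
  0 < delta -> 0 < eps ->
  measurable_fun (`[0, +oo[ : set R) f ->
  C2_holder_on `]0, 1 + eps[ delta f ->
  [bounded f r | r in `[0, +oo[ `\` `]0, 1 + eps[] ->
  exists c, regular_profile c f.
Proof.
move=> delta0 eps0 mf f_C2 f_bnd.
have [c c0 [Dc DL fc]] := C2_holder_lipschitz delta0 eps0 f_C2 f_bnd.
have [c' c'0 fX] := C2_holder_expansion delta0 eps0 f_C2 f_bnd.
have sub (x : R) : 0 < x <= 1 -> `]0, 1 + eps[%classic x.
  by move=> /andP[x0 x1]; rewrite /= in_itv/= x0/=; lra.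
have cC : c <= c + c' by rewrite lerDl.
exists (c + c'); split.
- split; first exact: addr_ge0.
  by apply: (radial_expansion_le _ fX); rewrite lerDr.
- by split => //; exists c.
- have [_ dD _] := f_C2.
  have subI : (`]0, 1] : set R) `<=` `]0, 1 + eps[.
    by move=> x; rewrite /= in_itv/= => /sub.
  apply: (measurable_funS _ subI); first exact: measurable_itv.
  apply: open_continuous_measurable_fun; first exact: interval_open.
  move=> x; rewrite inE => Ix.
  by apply: differentiable_continuous; apply/derivable1_diffP; exact: dD.
- by move=> x /sub Ix; apply: le_trans cC; exact: Dc.
- move=> x y /sub Ix /sub Iy; apply: (le_trans (DL _ _ Ix Iy)).
  exact: ler_wpM2r.
Qed.

Definition stat_covariance N (f g : R -> R) : R :=
  \int[ginibre R N]_z (stat N f z * stat N g z) -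
  (\int[ginibre R N]_z stat N f z) * (\int[ginibre R N]_z stat N g z).

Definition limit_covariance (f g : R -> R) : R :=
  2^-1 * \int[lebesgue_measure]_(r in `[0, 1]) (f^`()%classic r * g^`()%classic r * r).

(** Replacing each radius covariance by its linear approximation costs
    [30 c ^ 2 / (N sqrt (k + 1))], hence [60 c ^ 2 / sqrt N] in total; the
    Riemann sum accounts for the rest. *)
Lemma stat_covariance_estimate N c (f g : R -> R) : (0 < N)%N ->
  regular_profile c f -> regular_profile c g ->
  `|stat_covariance N f g - limit_covariance f g| <= (61 * c ^+ 2) / Num.sqrt N%:R.
Proof.
move=> N0 [[c0 fX] bf mD Dc DL] [[_ gX] bg mE Ec EL].
pose h x := f^`()%classic x * g^`()%classic x.
have hK x y : 0 < x <= 1 -> 0 < y <= 1 -> `|h x - h y| <= (2 * c ^+ 2) * `|x - y|.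
  move=> x01 y01.
  have -> : h x - h y = (f^`()%classic x - f^`()%classic y) * g^`()%classic x +
      f^`()%classic y * (g^`()%classic x - g^`()%classic y) by rewrite /h; ring.
  apply: (le_trans (ler_normD _ _)); rewrite !normrM.
  have e1 : `|f^`()%classic x - f^`()%classic y| * `|g^`()%classic x| <= c * `|x - y| * c.
    by apply: ler_pM => //; [exact: DL|exact: Ec].
  have e2 : `|f^`()%classic y| * `|g^`()%classic x - g^`()%classic y| <= c * (c * `|x - y|).
    by apply: ler_pM => //; [exact: Dc|exact: EL].
  by apply: (le_trans (lerD e1 e2)); rewrite (_ : _ + _ = 2 * c ^+ 2 * `|x - y|)//; ring.
have mh : measurable_fun (`]0, 1] : set R) h by exact: measurable_funM.
have K0 : 0 <= 2 * c ^+ 2 by rewrite mulr_ge0// sqr_ge0.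
have riemann := radial_riemann_sum K0 mh hK N0.
set S := \sum_(k < N) _ in riemann.
have NR : 0 < (N%:R : R) by rewrite ltr0n.
set s : R := Num.sqrt N%:R; have s0 : 0 < s by rewrite sqrtr_gt0.
have sN : s ^+ 2 = N%:R by rewrite sqr_sqrtr// ltW.
have s1 : 1 <= s by rewrite -(sqrtr1 R) ler_sqrt// ler1n.
have covS : `|stat_covariance N f g - S| <= 60 * c ^+ 2 / s.
  rewrite /stat_covariance Rintegral_stat_mul// /S -sumrB.
  apply: (le_trans (ler_norm_sum _ _ _)).
  apply: (@le_trans _ _ (\sum_(k < N) 30 * c ^+ 2 / N%:R * (Num.sqrt (k.+1%:R : R))^-1)).
    apply: ler_sum => k _.
    apply: (le_trans (radial_law_covariance (ltn_ord k) c0 bf.1 bg.1 fX gX)).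
    by rewrite invfM mulrA mulrAC.
  rewrite -mulr_sumr; apply: (@le_trans _ _ (30 * c ^+ 2 / N%:R * (2 * s))).
    by apply: ler_wpM2l (sum_inv_sqrt_le N); rewrite divr_ge0// ?mulr_ge0// ?sqr_ge0// ltW.
  rewrite -sN; apply: le_of_eq; field; exact: lt0r_neq0.
have -> : stat_covariance N f g - limit_covariance f g =
  (stat_covariance N f g - S) - (limit_covariance f g - S) by ring.
apply: (le_trans (ler_normB _ _)).
apply: (le_trans (lerD covS riemann)).
have -> : 61 * c ^+ 2 / s = 60 * c ^+ 2 / s + c ^+ 2 / s by field; exact: lt0r_neq0.
rewrite lerD2l -sN.
rewrite ler_pdivrMr; last by rewrite mulr_gt0// exprn_gt0.
have -> : c ^+ 2 / s * (4 * s ^+ 2) = c ^+ 2 * (4 * s) by field; exact: lt0r_neq0.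
by have := sqr_ge0 c; nra.
Qed.

Lemma limit_covariance_ge0 f : 0 <= limit_covariance f f.
Proof.
rewrite mulr_ge0// Rintegral_ge0// => r; rewrite /= in_itv/= => /andP[r0 _].
by rewrite mulr_ge0// -expr2 sqr_ge0.
Qed.

Lemma stat_covariance_cvg c f g : regular_profile c f -> regular_profile c g ->
  stat_covariance N f g @[N --> \oo] --> limit_covariance f g.
Proof.
move=> fr gr; apply: (@cvg_of_inv_sqrt_bound _ _ (61 * c ^+ 2)) => N N0.
exact: stat_covariance_estimate.
Qed.

Lemma fine_expectation d (T : measurableType d) (Q : probability T R) (X : T -> R) :
  fine 'E_Q[X] = \int[Q]_w X w.
Proof. by rewrite unlock. Qed.

Lemma covariance_Rintegral d (T : measurableType d) (Q : probability T R) (X Y : T -> R) :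
  Q.-integrable setT (EFin \o X) -> Q.-integrable setT (EFin \o Y) ->
  Q.-integrable setT (EFin \o (fun w => X w * Y w)) ->
  covariance Q X Y = (\int[Q]_w (X w * Y w) - (\int[Q]_w X w) * (\int[Q]_w Y w))%:E.
Proof.
move=> iX iY iXY; rewrite covarianceE; try exact/Lfun1_integrable.
rewrite !unlock EFinB EFinM /Rintegral !fineK//; exact: (integrable_fin_num measurableT).
Qed.

Lemma integrable_stat_mul N f g : bounded_on_halfline f -> bounded_on_halfline g ->
  (ginibre R N).-integrable setT (EFin \o (fun z => stat N f z * stat N g z)).
Proof.
move=> bf bg; have [B fB] := stat_bounded N bf.
have [C gC] := stat_bounded N bg.
apply: (@integrable_ginibre_bounded _ _ _ (B * C)).
  by apply: measurable_funM; exact: measurable_stat.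
by move=> z; rewrite normrM ler_pM.
Qed.

Lemma covariance_stat N f g : bounded_on_halfline f -> bounded_on_halfline g ->
  covariance (ginibre R N) (stat N f) (stat N g) = (stat_covariance N f g)%:E.
Proof.
move=> bf bg; apply: covariance_Rintegral.
- exact: integrable_stat.
- exact: integrable_stat.
- exact: integrable_stat_mul.
Qed.

Definition centered_stat N (f : R -> R) (z : N.-tuple R[i]) : R :=
  stat N f z - \int[ginibre R N]_w stat N f w.

Lemma measurable_centered_stat N f : bounded_on_halfline f ->
  measurable_fun setT (@centered_stat N f).
Proof. by move=> bf; apply: measurable_funB => //; exact: measurable_stat. Qed.

Lemma centered_stat_moment2 N f : bounded_on_halfline f ->
  (ginibre R N).-integrable setT (EFin \o (fun z => centered_stat f z ^+ 2)) /\
  \int[ginibre R N]_z centered_stat f z ^+ 2 = stat_covariance N f f.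
Proof.
move=> bf; split.
  have [B fB] := stat_bounded N bf.
  apply: (@integrable_ginibre_bounded _ _ _ ((B + `|\int[ginibre R N]_w stat N f w|) ^+ 2)).
    by apply: measurable_funX; exact: measurable_centered_stat.
  move=> z; rewrite normrX lerXn2r ?nnegrE//.
    by rewrite addr_ge0// (le_trans _ (fB z)).
  by rewrite (le_trans (ler_normB _ _))// lerD2r.
have := covariance_stat N bf bf; rewrite [in LHS]unlock unlock => /(congr1 fine)/= <-.
by congr fine; apply: eq_integral => z _; rewrite /centered_stat unlock.
Qed.

(** A product of [N] factors, each within [O(N ^ (- 3 / 2))] of the Gaussian one
    with the same variance. *)
Lemma centered_stat_charfun_estimate N c t f : (0 < N)%N -> regular_profile c f ->
  normc (Cint (ginibre R N) (fun z => expi (t * centered_stat f z)) -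
    (expR (- (t ^+ 2 * stat_covariance N f f / 2)))%:C%C) <=
  (144 * c ^+ 3 * `|t| ^+ 3 + 100 * c ^+ 4 * t ^+ 4) / Num.sqrt N%:R.
Proof.
move=> N0 [[c0 fX] bf _ _ _].
rewrite /centered_stat Cint_stat_expi//.
pose m k := \int[P N k]_z f (normc z).
pose v k := \int[P N k]_z (f (normc z) ^+ 2) - m k ^+ 2.
have -> : expR (- (t ^+ 2 * stat_covariance N f f / 2)) =
    \prod_(k < N) expR (- (t ^+ 2 * v k / 2)).
  rewrite /stat_covariance Rintegral_stat_mul// -expR_sum; congr expR.
  by rewrite mulr_sumr mulr_suml -sumrN.
rewrite rmorph_prod/=.
have key (k : 'I_N) := radial_law_charfun (ltn_ord k) t c0 bf.1 fX.
apply: (le_trans (normc_prod_sub_le _ _)).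
- move=> k; apply: normc_charfun_le1.
  by apply: measurable_funB => //; exact: (measurable_radial bf.1).
- move=> k; rewrite normc_realC ger0_norm ?expR_ge0// -expR0 ler_expR oppr_le0.
  have [v0 _] := key k; rewrite divr_ge0// mulr_ge0// ?sqr_ge0//.
set K : R := _ + _.
apply: (@le_trans _ _ (\sum_(k < N) K / (N%:R * Num.sqrt N%:R))).
  by apply: ler_sum => k _; have [_] := key k.
rewrite sumr_const card_ord -[X in X <= _]mulr_natl.
have NR : 0 < (N%:R : R) by rewrite ltr0n.
have s0 : 0 < Num.sqrt (N%:R : R) by rewrite sqrtr_gt0.
by apply: le_of_eq; field; rewrite !lt0r_neq0.
Qed.

Lemma centered_stat_charfun_cvg c t f : regular_profile c f ->
  \int[ginibre R N]_z cos (t * centered_stat f z) @[N --> \oo] -->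
    expR (- (t ^+ 2 * limit_covariance f f / 2)) /\
  \int[ginibre R N]_z sin (t * centered_stat f z) @[N --> \oo] --> (0 : R).
Proof.
move=> fr.
pose phi N := Cint (ginibre R N) (fun z => expi (t * centered_stat f z)).
pose e N := expR (- (t ^+ 2 * stat_covariance N f f / 2)).
pose K := 144 * c ^+ 3 * `|t| ^+ 3 + 100 * c ^+ 4 * t ^+ 4.
have est N : (0 < N)%N -> normc (phi N - (e N)%:C%C) <= K / Num.sqrt N%:R.
  by move=> N0; exact: centered_stat_charfun_estimate.
have ecvg : e N @[N --> \oo] --> expR (- (t ^+ 2 * limit_covariance f f / 2)).
  have argcvg : - (t ^+ 2 * stat_covariance N f f / 2) @[N --> \oo] -->
      - (t ^+ 2 * limit_covariance f f / 2).
    by apply: cvgN; apply: cvgMl; apply: cvgMr; exact: (stat_covariance_cvg fr fr).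
  exact: (cvg_comp _ _ argcvg (@continuous_expR R _)).
split; last first.
  apply: (@cvg_of_inv_sqrt_bound _ _ K) => N N0.
  apply: le_trans (est _ N0).
  have := normr_Im_le (phi N - (e N)%:C%C).
  by rewrite ImD /= oppr0 addr0 ?subr0.
have dcvg : complex.Re (phi N) - e N @[N --> \oo] --> (0 : R).
  apply: (@cvg_of_inv_sqrt_bound _ _ K) => N N0.
  apply: le_trans (est _ N0).
  have := normr_Re_le (phi N - (e N)%:C%C).
  by rewrite ReD /= !subr0.
rewrite -[X in _ --> X]add0r (_ : (fun N => _) = fun N => complex.Re (phi N) - e N + e N).
  exact: cvgD dcvg ecvg.
by apply/funext => N; rewrite subrK.
Qed.

Lemma centered_stat_clt c f : regular_profile c f ->
  cvg_in_distribution (fun N => ginibre R N) (fun N => @centered_stat N f)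
    (centered_gaussian (limit_covariance f f)).
Proof.
move=> fr; have [_ bf _ _ _] := fr.
set v := limit_covariance f f; have v0 : 0 <= v by exact: limit_covariance_ge0.
have charQ t := centered_gaussian_charfun t v0.
apply: (@cvg_in_distribution_of_charfun _ _ _ _ _ _ _ _ _ (v + 1)).
- by move=> N; exact: measurable_centered_stat.
- move=> t; have [cc _] := centered_stat_charfun_cvg t fr.
  by have := congr1 (@complex.Re R) (charQ t) => /= ->.
- move=> t; have [_ cs] := centered_stat_charfun_cvg t fr.
  by have := congr1 (@complex.Im R) (charQ t) => /= ->.
- have vv1 : v < v + 1 by rewrite ltrDl.
  have Vlt := cvgr_lt _ (stat_covariance_cvg fr fr) _ vv1.
  near=> N; have [i2 e2] := centered_stat_moment2 N bf.
  by split => //; rewrite e2; apply: ltW; near: N; exact: Vlt.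
- have [i2 e2] := centered_gaussian_variance v0; split => //.
  by rewrite e2 lerDl.
Unshelve. all: by end_near. Qed.

End asymptotics.

Theorem theorem1p3 (R : realType) (f g : R -> R) (delta eps : R)
    (delta_gt0 : 0 < delta) (eps_gt0 : 0 < eps)
    (f_meas : measurable_fun (`[0, +oo[ : set R) f)
    (g_meas : measurable_fun (`[0, +oo[ : set R) g)
    (f_C2 : C2_holder_on `]0, 1 + eps[ delta f)
    (g_C2 : C2_holder_on `]0, 1 + eps[ delta g)
    (f_bnd : [bounded f r | r in `[0, +oo[ `\` `]0, 1 + eps[])
    (g_bnd : [bounded g r | r in `[0, +oo[ `\` `]0, 1 + eps[]) :
  (covariance (ginibre R N) (linear_stat (f \o @Normc.normc R))
     (linear_stat (g \o @Normc.normc R)) @[N --> \oo] -->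
   (2^-1 * \int[lebesgue_measure]_(r in `[0, 1]) (f^`()%classic r * g^`()%classic r * r))%:E) /\
  cvg_in_distribution (fun N => ginibre R N)
    (fun N z => linear_stat (f \o @Normc.normc R) z -
                fine 'E_(ginibre R N)[linear_stat (f \o @Normc.normc R)]%E)
    (centered_gaussian
       (2^-1 * \int[lebesgue_measure]_(r in `[0, 1]) ((f^`()%classic r) ^+ 2 * r))).
Proof.
have [cf fr] := C2_holder_regular_profile delta_gt0 eps_gt0 f_meas f_C2 f_bnd.
have [cg gr] := C2_holder_regular_profile delta_gt0 eps_gt0 g_meas g_C2 g_bnd.
have [[cf0 _] bf _ _ _] := fr; have [[cg0 _] bg _ _ _] := gr.
split.
  have fr' : regular_profile (cf + cg) f by apply: regular_profile_le fr; rewrite lerDl.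
  have gr' : regular_profile (cf + cg) g by apply: regular_profile_le gr; rewrite lerDr.
  rewrite (_ : (fun N => _) = fun N => (stat_covariance N f g)%:E).
    by apply: cvg_EFin; [exact: nearW|exact: stat_covariance_cvg fr' gr'].
  by apply/funext => N; rewrite covariance_stat.
have centeredE : (fun N (z : N.-tuple R[i]) => linear_stat (f \o @Normc.normc R) z -
      fine 'E_(ginibre R N)[linear_stat (f \o @Normc.normc R)]%E) =
    (fun N => @centered_stat R N f).
  by apply: functional_extensionality_dep => N; apply/funext => z; rewrite fine_expectation.
by rewrite centeredE; exact: (centered_stat_clt fr).
Qed.
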